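(* Let $n\ge 2$, $0<a<1$, $r_0>r>0$, $\tau>\tau_0>0$, $1<\kappa<2$, and assume that $$r>c\tau,\qquad c=c(a,\kappa):=32^{a/(1-a)}(\kappa-1)(\kappa^{1-a}-1)^{-1/(1-a)}.$$ Let $\rho:=r-c\tau>0$, $\upsilon:=8^{-a/(1-a)}\rho>0$, $\nu:=\upsilon/2$ and $\iota:=8^{-a/(1-a)}(2r)^{-1}\upsilon$. Then there exist a (small) constant $\varepsilon^*>0$ and a (large) constant $C>0$, depending only on $a,r_0,r,\tau,\tau_0,\kappa$ and $n$, such that the following holds. For every vector field $X=X_\omega+F$ on $\mathbb{T}^n$ with $$\omega\in\mathcal{A}^a_{\tau_0},\qquad F\in\mathcal{F}^a_{r_0},\qquad \|F\|_{r_0}=\varepsilon\le \gamma_{\tau_0}(\omega)\,\varepsilon^*,$$ there exist a vector $\lambda\in\mathbb{R}^n$ and a diffeomorphism $\Phi:\mathbb{T}^n\to\mathbb{T}^n$ with $\Phi\in\mathcal{F}^a_\nu$ such that $$\Phi^*(X-X_\lambda)=X_\omega,$$ and $$|\lambda|\le C\varepsilon,\qquad \|\Phi-\mathrm{Id}\|_\nu\le C\,(\varepsilon/\gamma_{\tau_0}(\omega))^{\iota}.$$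
   Context: $\mathbb{T}^n=\mathbb{R}^n/\mathbb{Z}^n$; $|x|=\max_{1\le i\le n}|x_i|$ for $x\in\mathbb{R}^n$; $k\cdot\omega$ is the Euclidean inner product. For $0<a<1$ set $\varphi_a(t)=t^a/a$, $t\ge0$. Regularity classes: for $r\in\mathbb{R}$, $\mathcal{F}^a_r$ is the Banach space of real formal Fourier series $f=\sum_{k\in\mathbb{Z}^n}f_k e^{2\pi i k\cdot x}$ (with $f_k\in\mathbb{C}$, $\overline{f_k}=f_{-k}$) such that $\|f\|_r:=\sup_{k\in\mathbb{Z}^n}|f_k|e^{r\varphi_a(|k|)}<+\infty$. For $r>0$ the elements of $\mathcal{F}^a_r$ are smooth real functions on $\mathbb{T}^n$. A vector field (or map) $F=(f_1,\dots,f_n):\mathbb{T}^n\to\mathbb{R}^n$ is said to be in $\mathcal{F}^a_r$ if each $f_i\in\mathcal{F}^a_r$, with $\|F\|_r:=\max_{1\le i\le n}\|f_i\|_r$. A diffeomorphism $\Phi$ of $\mathbb{T}^n$ is said to be in $\mathcal{F}^a_\nu$ if $\Phi-\mathrm{Id}$ is ($\mathbb{Z}^n$-periodic and) in $\mathcal{F}^a_\nu$. Arithmetic classes: for $\tau>0$, $\mathcal{A}^a_\tau$ is the set of $\omega\in\mathbb{R}^n$ with $k\cdot\omega\neq0$ for all nonzero $k\in\mathbb{Z}^n$ such that $\gamma_\tau^{-1}(\omega):=\sup_{k\in\mathbb{Z}^n\setminus\{0\}}|2\pi k\cdot\omega|^{-1}e^{-\tau\varphi_a(|k|)}<+\infty$;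 $\gamma_\tau(\omega)>0$ denotes the inverse of this supremum. For $\omega,\lambda\in\mathbb{R}^n$, $X_\omega=\omega$ and $X_\lambda=\lambda$ denote the constant vector fields on $\mathbb{T}^n$. The pullback of a vector field $Y$ by a diffeomorphism $\Phi$ is $(\Phi^*Y)(x)=(D_x\Phi)^{-1}Y(\Phi(x))$. *)

(* Defs.v *)
From HB Require Import structures.
From mathcomp Require Import all_boot all_order all_algebra.
From mathcomp Require Import complex.
From mathcomp Require Import all_classical all_reals all_analysis.
From mathcomp Require summability.

Set Implicit Arguments.
Unset Strict Implicit.
Unset Printing Implicit Defensive.

Import Order.TTheory GRing.Theory Num.Theory.
Import numFieldNormedType.Exports.

Local Open Scope classical_set_scope.
Local Open Scope ring_scope.

(* Points and vectors of R^n are row vectors 'rV[R]_n, whose library norm is  *)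
(* the max norm.  Functions, vector fields and diffeomorphisms on the torus   *)
(* R^n / Z^n are represented by their lifts to R^n.                           *)

Section Gevrey.
Context {R : realType} {n : nat}.
Implicit Types (a r tau : R) (k : 'rV[int]_n) (x y omega : 'rV[R]_n).

Definition phi a (t : R) : R := t `^ a / a.

Definition supn k : nat := \max_(i < n) absz (k 0%R i).

Definition toR k : 'rV[R]_n := map_mx intr k.

Definition dotp x y : R := \sum_(i < n) x 0 i * y 0 i.

(* A formal Fourier series is its family of coefficients. *)
Definition fseries := 'rV[int]_n -> R[i].

Implicit Types f : fseries.

Definition fnorm a r f : \bar R :=
  ereal_sup (range (fun k : 'rV[int]_n =>
    (Normc.normc (f k) * expR (r * phi a (supn k)%:R))%:E)).

Definition in_F a r f : Prop :=
  (forall k, conjc (f k) = f (- k)) /\ (fnorm a r f < +oo)%E.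

Definition expi (t : R) : R[i] := Complex (cos t) (sin t).

(* [summability.sum] is the unconditional sum (limit over finite sets of      *)
(* indices).  For f in F^a_r with r > 0 the series converges absolutely and,  *)
(* since the terms of indices k and -k are conjugate, its sum is real: taking *)
(* real parts of the terms does not change it.                                *)
Definition feval f x : R :=
  summability.sum (fun k : 'rV[int]_n =>
    complex.Re (f k * expi (2 * pi * dotp (toR k) x)) : R^o).

Definition vfseries := 'I_n -> fseries.

Implicit Types F : vfseries.

Definition vfnorm a r F : \bar R := \big[maxe/0%E]_(i < n) fnorm a r (F i).

Definition vin_F a r F : Prop := forall i, in_F a r (F i).

Definition vfeval F x : 'rV[R]_n := \row_i feval (F i) x.

(* gamma_tau^{-1}(omega) *)
Definition gammaV a tau omega : \bar R :=
  ereal_sup [set (`|2 * pi * dotp (toR k) omega|^-1 *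
                  expR (- (tau * phi a (supn k)%:R)))%:E
            | k in [set k : 'rV[int]_n | k != 0]].

Definition arithm a tau omega : Prop :=
  (forall k, k != 0 -> dotp (toR k) omega != 0) /\
  (gammaV a tau omega < +oo)%E.

Definition gamma a tau omega : R := (fine (gammaV a tau omega))^-1.

Fixpoint Ck (m : nat) (f : 'rV[R]_n -> 'rV[R]_n) : Prop :=
  if m is m'.+1 then
    continuous f /\
    forall i : 'I_n, (forall x, derivable f x (delta_mx 0 i)) /\
                     Ck m' (fun x => 'D_(delta_mx 0 i) f x)
  else continuous f.

Definition smooth (f : 'rV[R]_n -> 'rV[R]_n) : Prop := forall m, Ck m f.

(* Lifts Phi, with Phi - Id periodic, of C^infty diffeomorphisms of the torus.*)
(* The inverse Psi then commutes with integer translations as well, so that   *)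
(* Phi and Psi descend to mutually inverse smooth maps of the torus.          *)
Definition torus_diffeo (Phi : 'rV[R]_n -> 'rV[R]_n) : Prop :=
  (forall x k, Phi (x + toR k) = Phi x + toR k) /\
  smooth Phi /\
  exists Psi : 'rV[R]_n -> 'rV[R]_n,
    [/\ cancel Phi Psi, cancel Psi Phi & smooth Psi].

(* (Phi^* Y)(x) = (D_x Phi)^{-1} Y(Phi(x)); with row vectors, the library's   *)
(* Jacobian acts on the right.                                                *)
Definition pullback (Phi Y : 'rV[R]_n -> 'rV[R]_n) x : 'rV[R]_n :=
  Y (Phi x) *m invmx (jacobian Phi x).

End Gevrey.

Arguments fseries : clear implicits.
Arguments vfseries : clear implicits.

Definition c_ak {R : realType} (a kappa : R) : R :=
  32 `^ (a / (1 - a)) * (kappa - 1) *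
  (kappa `^ (1 - a) - 1) `^ (- (1 / (1 - a))).

(* Main.v *)
(* Let F_j be the truncation of F to the frequencies |k| <= 2^j: it is a trigonometric
   polynomial, hence analytic, and at the j-th step of a Newton (KAM) scheme we work on the
   complex strip { sum_i |Im z_i| <= s_j }, where 2 pi s_j = 2^-a r 2^(-j(1-a)). An approximate
   solution consists of a displacement u, its Jacobian matrix M = 1 + Du and a vector lambda,
   with defect e = omega M - omega - F_j(z + u) + lambda. Put g = (e + dl) M^-1 with dl such
   that g has zero mean, let w be the solution of omega . Dw = - g, and replace u by w + u(z +
   w). The defect becomes (g(z + w) - g(z)) M(z + w) - (F_(j+1) - F_j)(z + u+), so it is
   quadratically small up to the newly introduced frequencies, and all errors decrease like exp
   (- beta phi_a(2^j)). Solving for w costs the factor exp (tau phi_a(|k|)), absorbed by a loss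
   of width proportional to s_j; the condition r > c tau makes this loss smaller than the
   quadratic gain. The concavity of phi_a turns the decay of the j-th increment on the strip s_j
   into a bound of its Fourier coefficients by exp (- nu phi_a(|k|)), with constants summable in
   j. The limit has Lipschitz constant at most 1/2, so that x + u(x) is a diffeomorphism. All
   bounds are linear in eps / gamma <= 1, which is at most its power iota <= 1. *)

Require Import Defs.
From mathcomp Require Import all_boot all_order all_algebra.
From mathcomp Require Import complex.
From mathcomp Require Import all_classical all_reals all_analysis.
From mathcomp Require Import perm finmap ring lra zify.
From mathcomp Require summability.

Import Order.TTheory GRing.Theory Num.Theory.
Import numFieldNormedType.Exports.

Local Open Scope ring_scope.

Set Implicit Arguments.
Unset Strict Implicit.
Unset Printing Implicit Defensive.

(** Neither holomorphy nor integration is used. A function on a strip is a uniform limit of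
    trigonometric polynomials; this class is stable under products, exponentials, inverses of
    near-identity matrices and composition with [z + U z], and the Cauchy estimates become finite
    averages over grids, exact on polynomials. The class has no derivative operation, so the
    Jacobian is carried as separate data, tied to the displacement by a quadratic expansion at real
    points only. That suffices, because the strips shrink to the real torus and the limit equation
    lives there. The widths come from slopes: [r * phi a] has slope [r * K^(a-1)] at K, and
    [2 pi s_(j+1)] is half of it for [K = 2^j], so a frequency between K and 2K keeps a definite
    part of its decay on the strip. Tangent lines of the concave [phi a] trade Gevrey weights for
    linear ones, in both directions: a small divisor costs a width and a factor
    [expR (L * phi a K)]. Since [phi a (2 K) = 2^a * phi a K], the quadratic error falls below the
    next target exactly when [L < beta * (2 - 2^a)]. *)

Local Notation nc := Normc.normc.

(** * Complex numbers and exponentials *)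

Section ComplexNorm.
Context {R : realType}.
Local Notation C := R[i].
Implicit Types (x y z : C) (t b : R).

Definition cR t : C := Complex t 0.

Lemma nc_ge0 z : 0 <= nc z.
Proof. by case: z => a b /=; rewrite sqrtr_ge0. Qed.

Lemma nc0 : nc (0 : C) = 0. Proof. exact: Normc.normc0. Qed.
Lemma nc1 : nc (1 : C) = 1. Proof. exact: Normc.normc1. Qed.
Lemma ncM x y : nc (x * y) = nc x * nc y. Proof. exact: Normc.normcM. Qed.
Lemma ncV x : nc x^-1 = (nc x)^-1. Proof. exact: Normc.normcV. Qed.
Lemma ncN x : nc (- x) = nc x. Proof. exact: normcN. Qed.
Lemma ncD x y : nc (x + y) <= nc x + nc y. Proof. exact: le_normcD. Qed.
Lemma ncB x y : nc (x - y) <= nc x + nc y.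
Proof. by rewrite -(ncN y) ncD. Qed.
Lemma ncC x y : nc (x - y) = nc (y - x).
Proof. by rewrite -ncN opprB. Qed.
Lemma ncX x m : nc (x ^+ m) = nc x ^+ m.
Proof. by elim: m => [|m IH]; rewrite ?expr0 ?nc1 // !exprS ncM IH. Qed.

Lemma nc_eq0 z : nc z = 0 -> z = 0. Proof. exact: Normc.eq0_normc. Qed.

Lemma nc_sum (I : Type) (s : seq I) (P : pred I) (F : I -> C) :
  nc (\sum_(i <- s | P i) F i) <= \sum_(i <- s | P i) nc (F i).
Proof.
elim/big_rec2: _ => [|i b z _ le_zb]; first by rewrite nc0.
by apply: le_trans (ncD _ _) _; rewrite lerD2l.
Qed.

Lemma nc_dist x y z : nc (x - z) <= nc (x - y) + nc (y - z).
Proof. by apply: le_trans (ncD _ _); rewrite addrA subrK. Qed.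

Lemma nc_cR t : nc (cR t) = `|t|.
Proof. by rewrite /cR /= expr0n addr0 sqrtr_sqr. Qed.

Lemma nc_Re z : `|complex.Re z| <= nc z.
Proof.
by case: z => a b /=; rewrite -sqrtr_sqr ler_sqrt ?addr_ge0 ?sqr_ge0 // lerDl sqr_ge0.
Qed.

Lemma nc_Im z : `|complex.Im z| <= nc z.
Proof.
by case: z => a b /=; rewrite -sqrtr_sqr ler_sqrt ?addr_ge0 ?sqr_ge0 // lerDr sqr_ge0.
Qed.

Lemma nc_i t : nc (Complex 0 t) = `|t|.
Proof. by rewrite /= expr0n add0r sqrtr_sqr. Qed.

Lemma nc_le_ReIm z : nc z <= `|complex.Re z| + `|complex.Im z|.
Proof.
case: z => a b.
have -> : Complex a b = cR a + Complex 0 b by rewrite /cR; simpc.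
by apply: le_trans (ncD _ _) _; rewrite nc_cR nc_i; simpc.
Qed.

Lemma nc_conj z : nc (conjc z) = nc z.
Proof. by case: z => a b /=; rewrite sqrrN. Qed.

Lemma cR0 : cR 0 = 0. Proof. by []. Qed.
Lemma cR1 : cR 1 = 1. Proof. by []. Qed.
Lemma cRD t b : cR (t + b) = cR t + cR b. Proof. by rewrite /cR; simpc. Qed.
Lemma cRN t : cR (- t) = - cR t. Proof. by rewrite /cR; simpc. Qed.
Lemma cRB t b : cR (t - b) = cR t - cR b. Proof. by rewrite cRD cRN. Qed.
Lemma cRM t b : cR (t * b) = cR t * cR b. Proof. by rewrite /cR; simpc. Qed.
Lemma cR_sum (I : Type) (s : seq I) (P : pred I) (F : I -> R) :
  cR (\sum_(i <- s | P i) F i) = \sum_(i <- s | P i) cR (F i).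
Proof. by elim/big_rec2: _ => [|i b z _ <-] //; rewrite -cRD. Qed.

Lemma conj_cR t : conjc (cR t) = cR t. Proof. by rewrite /cR /= oppr0. Qed.

Lemma conjcM x y : conjc (x * y) = conjc x * conjc y.
Proof. exact: rmorphM. Qed.
Lemma conjcD x y : conjc (x + y) = conjc x + conjc y.
Proof. exact: rmorphD. Qed.
Lemma conjcN x : conjc (- x) = - conjc x.
Proof. exact: rmorphN. Qed.
Lemma conjc_sum (I : Type) (s : seq I) (P : pred I) (F : I -> C) :
  conjc (\sum_(i <- s | P i) F i) = \sum_(i <- s | P i) conjc (F i).
Proof. exact: rmorph_sum. Qed.
Lemma conjcI x : conjc (conjc x) = x.
Proof. by case: x => a b /=; rewrite opprK. Qed.

Lemma conjc_fix z : conjc z = z -> z = cR (complex.Re z).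
Proof.
case: z => a b [] /eqP; rewrite eq_sym -subr_eq0 opprK => /eqP h.
by congr Complex; lra.
Qed.

Lemma nc_small z : (forall e, 0 < e -> nc z <= e) -> z = 0.
Proof.
move=> h; apply: nc_eq0; apply/eqP; rewrite eq_le nc_ge0 andbT.
by apply/ler_addgt0Pl => e /h; rewrite addr0.
Qed.

Lemma ReD x y : complex.Re (x + y) = complex.Re x + complex.Re y.
Proof. by case: x y => a b [c d]. Qed.
Lemma ImD x y : complex.Im (x + y) = complex.Im x + complex.Im y.
Proof. by case: x y => a b [c d]. Qed.
Lemma ReN x : complex.Re (- x) = - complex.Re x.
Proof. by case: x. Qed.
Lemma ImN x : complex.Im (- x) = - complex.Im x.
Proof. by case: x. Qed.
Lemma Re_sum (I : Type) (s : seq I) (P : pred I) (F : I -> C) :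
  complex.Re (\sum_(i <- s | P i) F i) = \sum_(i <- s | P i) complex.Re (F i).
Proof. by elim/big_rec2: _ => [|i b z _ <-] //; rewrite ReD. Qed.
Lemma Im_sum (I : Type) (s : seq I) (P : pred I) (F : I -> C) :
  complex.Im (\sum_(i <- s | P i) F i) = \sum_(i <- s | P i) complex.Im (F i).
Proof. by elim/big_rec2: _ => [|i b z _ <-] //; rewrite ImD. Qed.
Lemma Im_cRM t z : complex.Im (cR t * z) = t * complex.Im z.
Proof. by case: z => a b; rewrite /cR /= mul0r addr0. Qed.
Lemma Re_cRM t z : complex.Re (cR t * z) = t * complex.Re z.
Proof. by case: z => a b; rewrite /cR /= mul0r subr0. Qed.

End ComplexNorm.

Section ComplexExp.
Context {R : realType}.
Local Notation C := R[i].
Implicit Types (x y z : C) (t b : R).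

Lemma normr_sin_le b : `|sin b| <= `|b|.
Proof.
wlog b0 : b / 0 <= b => [hw|].
  case: (leP 0 b) => [/hw//|b0].
  by have := hw (- b); rewrite sinN !normrN; apply; rewrite oppr_ge0 ltW.
have dsin : forall x : R, x \in `]0, b[ -> is_derive x 1 sin (cos x).
  by move=> x _; exact: is_derive_sin.
have csin : {within `[0, b], continuous (@sin R)}%classic.
  by apply: continuous_subspaceT => x; exact: continuous_sin.
have [c _] := MVT_segment b0 dsin csin; rewrite sin0 !subr0 => ->.
by rewrite normrM ler_piMl // cos_max.
Qed.

Lemma cos_ge b : 1 - cos b <= b ^+ 2 / 2.
Proof.
have -> : 1 - cos b = 2 * sin (b / 2) ^+ 2.
  by have := cos2Dsin2 (b / 2); rewrite {3}(_ : b = b / 2 + b / 2) ?cosD; lra.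
have : sin (b / 2) ^+ 2 <= (b / 2) ^+ 2.
  by rewrite -ler_sqrt ?sqr_ge0 // !sqrtr_sqr normr_sin_le.
by rewrite expr_div_n; lra.
Qed.

Lemma normr_cosB1 b : `|cos b - 1| <= `|b|.
Proof.
have -> : `|cos b - 1| = 1 - cos b by rewrite distrC ger0_norm // subr_ge0 cos_le1.
case: (leP `|b| 2) => hb; last first.
  by have := cos_geN1 b; lra.
apply: le_trans (cos_ge b) _.
rewrite -[b ^+ 2]real_normK ?num_real // expr2.
by have := normr_ge0 b; nra.
Qed.

Lemma normr_sinB b : `|sin b - b| <= b ^+ 2.
Proof.
wlog b0 : b / 0 <= b => [hw|].
  case: (leP 0 b) => [/hw//|b0].
  have := hw (- b); rewrite sinN sqrrN -opprD normrN; apply.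
  by rewrite oppr_ge0 ltW.
have d : forall x : R, x \in `]0, b[ ->
    is_derive x 1 (fun t : R => sin t - t) (cos x - 1).
  by move=> x _; apply: is_deriveB.
have csin : {within `[0, b], continuous (fun t : R => sin t - t)}%classic.
  apply: continuous_subspaceT => x; apply: cvgB; last exact: cvg_id.
  exact: continuous_sin.
have [c] := MVT_segment b0 d csin; rewrite sin0 !subr0 in_itv /= => /andP[c0 cb] ->.
rewrite normrM expr2 (ger0_norm b0) ler_wpM2r //.
by apply: le_trans (normr_cosB1 _) _; rewrite ger0_norm.
Qed.

(** Convexity alone: [1 + t <= expR t] taken at [t] bounds the difference from below, and taken at
    [- t] and multiplied by [expR t] it gives the upper bound [t * expR t]. *)
Lemma normr_expRB1 t : `|expR t - 1| <= `|t| * expR `|t|.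
Proof.
have h1 := expR_ge1Dx t; have h2 := expR_ge1Dx (- t).
rewrite expRN in h2; have p := expR_gt0 t.
have h3 : expR t - t * expR t <= 1.
  by rewrite -[X in X - _]mul1r -mulrBl -ler_pdivlMr // div1r.
case: (leP 0 t) => t0.
  by rewrite !ger0_norm; lra.
rewrite (ltr0_norm t0) ler0_norm; last first.
  by rewrite subr_le0 -expR0 ler_expR ltW.
have q : 1 <= expR (- t) by rewrite -expR0 ler_expR; lra.
by nra.
Qed.

Lemma normr_expRB1B t : `|expR t - 1 - t| <= t ^+ 2 * expR `|t|.
Proof.
have h1 := expR_ge1Dx t; have h2 := expR_ge1Dx (- t).
rewrite expRN in h2; have p := expR_gt0 t.
have h3 : expR t - t * expR t <= 1.
  by rewrite -[X in X - _]mul1r -mulrBl -ler_pdivlMr // div1r.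
rewrite ger0_norm; last by lra.
apply: (@le_trans _ _ (t * (expR t - 1))); first by nra.
apply: le_trans (ler_norm _) _; rewrite normrM -[t ^+ 2]real_normK ?num_real // expr2 -mulrA.
by rewrite ler_wpM2l // normr_expRB1.
Qed.

Definition cexp z : C := cR (expR (complex.Re z)) * expi (complex.Im z).

Lemma expiD t b : expi (t + b) = expi t * expi b.
Proof. by rewrite /expi cosD sinD; simpc; congr Complex; ring. Qed.

Lemma expi0 : expi 0 = 1 :> C. Proof. by rewrite /expi cos0 sin0. Qed.

Lemma nc_expi t : nc (expi t) = 1.
Proof. by rewrite /= cos2Dsin2 sqrtr1. Qed.

Lemma conj_expi t : conjc (expi t) = expi (- t).
Proof. by rewrite /expi /= cosN sinN. Qed.

Lemma cexpD x y : cexp (x + y) = cexp x * cexp y.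
Proof. by rewrite /cexp ReD ImD expRD expiD cRM; ring. Qed.

Lemma cexp0 : cexp 0 = 1.
Proof. by rewrite /cexp /= expR0 expi0 mulr1. Qed.

Lemma nc_cexp z : nc (cexp z) = expR (complex.Re z).
Proof. by rewrite /cexp ncM nc_expi mulr1 nc_cR gtr0_norm ?expR_gt0. Qed.

Lemma conj_cexp z : conjc (cexp z) = cexp (conjc z).
Proof. by rewrite /cexp conjcM conj_cR conj_expi; case: z. Qed.

Lemma cexp_i t : cexp (Complex 0 t) = expi t.
Proof. by rewrite /cexp /= expR0 cR1 mul1r. Qed.

Lemma cexpMn z m : cexp (z *+ m) = cexp z ^+ m.
Proof.
by elim: m => [|m IH]; rewrite ?mulr0n ?cexp0 // mulrS cexpD IH exprS.
Qed.

Lemma nc_expiB1 b : nc (expi b - 1) <= `|b|.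
Proof.
have -> : expi b - 1 = Complex (cos b - 1) (sin b).
  by apply/eqP; rewrite eq_complex /=; apply/andP; split; apply/eqP; ring.
rewrite /= -[leRHS]sqrtr_sqr ler_sqrt ?sqr_ge0 //.
by have := cos2Dsin2 b; have := cos_ge b; lra.
Qed.

Lemma nc_expiB1B b : nc (expi b - 1 - Complex 0 b) <= 2 * b ^+ 2.
Proof.
have -> : expi b - 1 - Complex 0 b = Complex (cos b - 1) (sin b - b).
  by apply/eqP; rewrite eq_complex /=; apply/andP; split; apply/eqP; ring.
apply: le_trans (nc_le_ReIm _) _ => /=.
have -> : `|cos b - 1| = 1 - cos b by rewrite distrC ger0_norm // subr_ge0 cos_le1.
by have := cos_ge b; have := normr_sinB b; have := sqr_ge0 b; lra.
Qed.

Lemma nc_cexpB1 z : nc (cexp z - 1) <= 2 * nc z * expR (nc z).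
Proof.
have -> : cexp z - 1 = cR (expR (complex.Re z)) * (expi (complex.Im z) - 1)
    + cR (expR (complex.Re z) - 1).
  by rewrite /cexp cRB cR1; ring.
apply: le_trans (ncD _ _) _; rewrite ncM !nc_cR (gtr0_norm (expR_gt0 _)).
have e1 : expR (complex.Re z) <= expR (nc z).
  by rewrite ler_expR; apply: le_trans (ler_norm _) (nc_Re z).
have e2 : expR `|complex.Re z| <= expR (nc z) by rewrite ler_expR nc_Re.
have -> : 2 * nc z * expR (nc z) = expR (nc z) * nc z + nc z * expR (nc z) by ring.
apply: lerD.
  apply: ler_pM => //; rewrite ?expR_ge0 ?nc_ge0 //.
  exact: le_trans (nc_expiB1 _) (nc_Im z).
apply: le_trans (normr_expRB1 _) _.
by apply: ler_pM => //; rewrite ?expR_ge0 ?nc_ge0 // nc_Re.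
Qed.

Lemma nc_cexpB1B z : nc (cexp z - 1 - z) <= 4 * nc z ^+ 2 * expR (nc z).
Proof.
set a := complex.Re z; set b := complex.Im z.
(* Real and imaginary parts are separated so that each summand is a one-variable remainder: second
   order for [expi], a product of two first-order terms, and second order for [expR]. *)
have -> : cexp z - 1 - z = cR (expR a) * (expi b - 1 - Complex 0 b)
    + cR (expR a - 1) * Complex 0 b + cR (expR a - 1 - a).
  have -> : z = cR a + Complex 0 b by rewrite /a /b; case: (z) => ? ?; rewrite /cR; simpc.
  have -> : cexp (cR a + Complex 0 b) = cR (expR a) * expi b.
    by rewrite /cexp /cR; simpc.
  by rewrite !cRB cR1; ring.
apply: le_trans (ncD _ _) _; apply: le_trans (lerD (ncD _ _) (lexx _)) _.
rewrite !ncM !nc_cR nc_i (gtr0_norm (expR_gt0 _)).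
have ha : `|a| <= nc z := nc_Re z; have hb : `|b| <= nc z := nc_Im z.
have e2 : expR `|a| <= expR (nc z) by rewrite ler_expR.
have e1 : expR a <= expR (nc z).
  by apply: le_trans e2; rewrite ler_expR ler_norm.
have sq (c : R) : `|c| <= nc z -> c ^+ 2 <= nc z ^+ 2.
  by move=> hc; rewrite -[c ^+ 2]real_normK ?num_real // ler_sqr ?nnegrE ?nc_ge0.
have -> : 4 * nc z ^+ 2 * expR (nc z) = expR (nc z) * (2 * nc z ^+ 2)
  + nc z * expR (nc z) * nc z + nc z ^+ 2 * expR (nc z) by ring.
apply: lerD; first apply: lerD.
- apply: ler_pM => //; rewrite ?expR_ge0 ?nc_ge0 //.
  apply: le_trans (nc_expiB1B _) _; rewrite ler_pM2l //; exact: sq.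
- apply: ler_pM => //; apply: le_trans (normr_expRB1 _) _.
  by apply: ler_pM => //; rewrite expR_ge0.
- apply: le_trans (normr_expRB1B _) _.
  by apply: ler_pM => //; rewrite ?expR_ge0 ?sqr_ge0 ?sq.
Qed.

End ComplexExp.

(** * Characters of the torus *)

Section Lattice.
Context {R : realType} {n : nat}.
Local Notation C := R[i].
Local Notation V := 'rV[C]_n.
Local Notation K := 'rV[int]_n.
Implicit Types (k l : K) (z w : V) (x : 'rV[R]_n).

Definition lin k z : C := \sum_(i < n) cR (k 0 i)%:~R * z 0 i.

Definition ek k z : C := cexp (Complex 0 (2 * pi) * lin k z).

(** The norm dual to the sup norm of frequencies: [|Im (k . z)| <= |k| * l1im z] is sharp, so
    [expR (2 pi s |k|)] is the exact size of [ek k] on the strip of width s. *)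
Definition l1im z : R := \sum_(i < n) `|complex.Im (z 0 i)|.

Definition vconj z : V := map_mx conjc z.

Definition toC x : V := map_mx cR x.

Lemma linD k z w : lin k (z + w) = lin k z + lin k w.
Proof. by rewrite -big_split /=; apply: eq_bigr => i _; rewrite mxE mulrDr. Qed.

Lemma lin0 k : lin k 0 = 0.
Proof. by apply: big1 => i _; rewrite mxE mulr0. Qed.

Lemma linDk k l z : lin (k + l) z = lin k z + lin l z.
Proof.
rewrite -big_split /=; apply: eq_bigr => i _.
by rewrite mxE rmorphD cRD mulrDl.
Qed.

Lemma linNk k z : lin (- k) z = - lin k z.
Proof.
rewrite -sumrN /=; apply: eq_bigr => i _.
by rewrite mxE rmorphN cRN mulNr.
Qed.

Lemma lin0k z : lin 0 z = 0.
Proof. by apply: big1 => i _; rewrite mxE /= cR0 mul0r. Qed.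

Lemma lin_toC k x : lin k (toC x) = cR (dotp (toR k) x).
Proof.
rewrite /dotp cR_sum; apply: eq_bigr => i _.
by rewrite !mxE cRM.
Qed.

Lemma Im_lin k z : complex.Im (lin k z) = \sum_(i < n) (k 0 i)%:~R * complex.Im (z 0 i).
Proof. by rewrite Im_sum; apply: eq_bigr => i _; rewrite Im_cRM. Qed.

Lemma ekD k z w : ek k (z + w) = ek k z * ek k w.
Proof. by rewrite /ek linD mulrDr cexpD. Qed.

Lemma ekDk k l z : ek (k + l) z = ek k z * ek l z.
Proof. by rewrite /ek linDk mulrDr cexpD. Qed.

Lemma ek0 k : ek k 0 = 1.
Proof. by rewrite /ek lin0 mulr0 cexp0. Qed.

Lemma ek0k z : ek 0 z = 1.
Proof. by rewrite /ek lin0k mulr0 cexp0. Qed.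

Lemma nc_ek k z : nc (ek k z) = expR (- (2 * pi * complex.Im (lin k z))).
Proof. by rewrite nc_cexp; congr expR; case: (lin k z) => a b /=; ring. Qed.

Lemma ek_toC k x : ek k (toC x) = expi (2 * pi * dotp (toR k) x).
Proof. by rewrite /ek lin_toC -cexp_i; congr cexp; rewrite /cR; simpc. Qed.

Lemma conj_lin k z : conjc (lin k z) = lin k (vconj z).
Proof.
by rewrite conjc_sum; apply: eq_bigr => i _; rewrite mxE conjcM conj_cR.
Qed.

Lemma conj_ek k z : conjc (ek k z) = ek (- k) (vconj z).
Proof.
rewrite conj_cexp /ek linNk -conj_lin; congr cexp.
by case: (lin k z) => a b; simpc.
Qed.

Lemma vconjK z : vconj (vconj z) = z.
Proof. by apply/rowP => i; rewrite !mxE conjcI. Qed.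

Lemma vconjD z w : vconj (z + w) = vconj z + vconj w.
Proof. by apply/rowP => i; rewrite !mxE conjcD. Qed.

Lemma vconj_toC x : vconj (toC x) = toC x.
Proof. by apply/rowP => i; rewrite !mxE conj_cR. Qed.

Lemma toCD x y : toC (x + y) = toC x + toC y.
Proof. by apply/rowP => i; rewrite !mxE cRD. Qed.

Lemma toCB x y : toC (x - y) = toC x - toC y.
Proof. by apply/rowP => i; rewrite !mxE cRB. Qed.

Lemma l1im_ge0 z : 0 <= l1im z.
Proof. by apply: sumr_ge0 => i _; exact: normr_ge0. Qed.

Lemma l1im_toC x : l1im (toC x) = 0.
Proof. by apply: big1 => i _; rewrite mxE /= normr0. Qed.

Lemma l1im_vconj z : l1im (vconj z) = l1im z.
Proof.
by apply: eq_bigr => i _; rewrite mxE; case: (z 0 i) => a b /=; rewrite normrN.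
Qed.

Lemma l1imD z w : l1im (z + w) <= l1im z + l1im w.
Proof.
by rewrite -big_split /=; apply: ler_sum => i _; rewrite mxE ImD ler_normD.
Qed.

Lemma le_supn k i : (absz (k 0%R i) <= supn k)%N.
Proof. exact: leq_bigmax. Qed.

Lemma supn_le k m : (supn k <= m)%N = [forall i : 'I_n, absz (k 0%R i) <= m]%N.
Proof.
apply/bigmax_leqP/forallP => h i; first exact: h.
by move=> _; exact: h.
Qed.

Lemma supnN k : supn (- k) = supn k.
Proof. by apply: eq_bigr => i _; rewrite mxE abszN. Qed.

Lemma supn0 : supn (0 : K) = 0%N.
Proof. by apply/eqP; rewrite -leqn0 supn_le; apply/forallP => i; rewrite mxE. Qed.

Lemma supn_eq0 k : (supn k == 0%N) = (k == 0).
Proof.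
apply/idP/eqP => [|->]; last by rewrite supn0.
rewrite -leqn0 supn_le => /forallP h; apply/rowP => i; rewrite mxE.
by have := h i; rewrite leqn0 absz_eq0 => /eqP.
Qed.

Lemma supnD k l : (supn (k + l) <= supn k + supn l)%N.
Proof.
rewrite supn_le; apply/forallP => i; rewrite mxE.
have := le_supn k i; have := le_supn l i.
by move: (k 0%R i) (l 0%R i) => a b; lia.
Qed.

Lemma normr_intr_le k i : `|(k 0 i)%:~R : R| <= (supn k)%:R.
Proof.
by rewrite -intr_norm -natr_absz ler_nat le_supn.
Qed.

Lemma Im_lin_le k z : `|complex.Im (lin k z)| <= (supn k)%:R * l1im z.
Proof.
rewrite Im_lin mulr_sumr; apply: le_trans (ler_norm_sum _ _ _) _.
by apply: ler_sum => i _; rewrite normrM ler_wpM2r // normr_intr_le.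
Qed.

Lemma nc_lin_le k z b : (forall i, nc (z 0 i) <= b) ->
  nc (lin k z) <= n%:R * ((supn k)%:R * b).
Proof.
move=> h; apply: le_trans (nc_sum _ _ _) _.
apply: (@le_trans _ _ (\sum_(i < n) (supn k)%:R * b)); last first.
  by rewrite sumr_const card_ord (mulr_natl (_ * b)).
apply: ler_sum => i _; rewrite ncM nc_cR; apply: ler_pM; rewrite ?nc_ge0 //.
exact: normr_intr_le.
Qed.

(** For a purely imaginary displacement the duality between [supn] and [l1im] applies to the modulus
    itself, so no factor [n] is lost; this is what later makes the imaginary part of a correction
    proportional to [l1im z]. *)
Lemma nc_lin_l1 k z : (forall i, complex.Re (z 0 i) = 0) ->
  nc (lin k z) <= (supn k)%:R * l1im z.
Proof.
move=> h; apply: le_trans (nc_sum _ _ _) _; rewrite mulr_sumr.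
apply: ler_sum => i _; rewrite ncM nc_cR; apply: ler_pM; rewrite ?nc_ge0 //.
  exact: normr_intr_le.
by apply: le_trans (nc_le_ReIm _) _; rewrite h normr0 add0r.
Qed.

Lemma nc_ek_le k z s : l1im z <= s ->
  nc (ek k z) <= expR (2 * pi * s * (supn k)%:R).
Proof.
move=> hz; rewrite nc_ek ler_expR; apply: le_trans (ler_norm _) _.
rewrite normrN normrM (ger0_norm (_ : 0 <= 2 * pi)); last by rewrite mulr_ge0 // pi_ge0.
rewrite -mulrA ler_wpM2l ?mulr_ge0 ?pi_ge0 //.
by apply: le_trans (Im_lin_le _ _) _; rewrite mulrC ler_wpM2r.
Qed.

Definition box (N : nat) : seq K :=
  [seq \row_i ((f i : nat)%:Z - N%:Z)%R | f : {ffun 'I_n -> 'I_(N.*2.+1)}].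

Lemma box_uniq N : uniq (box N).
Proof.
rewrite map_inj_uniq ?enum_uniq // => f g /rowP h.
apply/ffunP => i; apply/val_inj; have := h i; rewrite !mxE /= => /eqP.
by rewrite (inj_eq (addIr _)) eqz_nat => /eqP.
Qed.

Lemma mem_box N k : (k \in box N) = (supn k <= N)%N.
Proof.
apply/mapP/idP => [[f _ ->]|].
  rewrite supn_le; apply/forallP => i; rewrite mxE.
  by move: (nat_of_ord (f i)) (ltn_ord (f i)) => m; rewrite -addnn; lia.
rewrite supn_le => /forallP h.
have hi i : (absz (k 0%R i + N%:Z)%R < N.*2.+1)%N.
  by move: (k 0%R i) (h i) => m; rewrite -addnn; lia.
exists [ffun i => Ordinal (hi i)]; first by rewrite mem_enum.
by apply/rowP => i; rewrite mxE ffunE /=; move: (k 0%R i) (h i) => m; lia.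
Qed.

(** A fixed summable weight on the lattice. Every absolutely convergent family is compared with it,
    which reduces all sums to two numbers, its total mass and its tails. *)
Definition pw k : R := ((1 + supn k)%:R ^+ (2 * n))^-1.

Lemma pw_gt0 k : 0 < pw k.
Proof. by rewrite invr_gt0 exprn_gt0 // ltr0n. Qed.

Lemma pw_ge0 k : 0 <= pw k. Proof. exact/ltW/pw_gt0. Qed.

Lemma sum_inv_sqr m :
  \sum_(0 <= j < m) ((1 + j)%:R ^+ 2)^-1 <= 2 :> R.
Proof.
case: m => [|m]; first by rewrite big_geq.
(* The induction closes only for the telescoping bound [2 - 1/(m+1)], since
   [1/(x+1)^2 <= 1/x - 1/(x+1)]. *)
apply: (@le_trans _ _ (2 - (m.+1%:R)^-1)); last by rewrite gerBl invr_ge0.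
elim: m => [|m IH]; first by rewrite big_nat1 expr1n invr1; lra.
rewrite big_nat_recr //=; apply: le_trans (lerD IH (lexx _)) _.
rewrite add1n; set x : R := m.+1%:R.
have -> : m.+2%:R = x + 1 :> R by rewrite -natr1.
have x0 : 0 < x by rewrite ltr0n.
rewrite -subr_ge0.
rewrite (_ : _ - _ = (x * (x + 1) ^+ 2)^-1).
  by rewrite invr_ge0; apply: mulr_ge0; [exact: ltW|exact: sqr_ge0].
by field; rewrite !gt_eqF //; lra.
Qed.

Lemma sum_pw1 N :
  \sum_(j < N.*2.+1) ((1 + absz ((j : nat)%:Z - N%:Z))%:R ^+ 2)^-1 <= 4 :> R.
Proof.
rewrite -(big_mkord xpredT (fun j => ((1 + absz (j%:Z - N%:Z)%R)%:R ^+ 2)^-1)).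
rewrite (big_cat_nat (n := N)) //=; last by rewrite -addnn -addnS leq_addr.
have -> : 4 = 2 + 2 :> R by ring.
apply: lerD.
  rewrite big_nat_rev /= add0n big_nat.
  rewrite (eq_bigr (fun j => ((1 + (N - (N - j.+1)))%:R ^+ 2)^-1)); last first.
    by move=> j /andP[_ hj]; congr ((_ %:R ^+ 2)^-1); lia.
  apply: (@le_trans _ _ (\sum_(0 <= j < N) ((1 + j)%:R ^+ 2)^-1)).
    rewrite [leRHS]big_nat; apply: ler_sum => j /andP[_ hj].
    rewrite lef_pV2 ?posrE ?exprn_gt0 ?ltr0n // ler_pXn2r ?nnegrE //.
    by rewrite ler_nat; lia.
  exact: sum_inv_sqr N.
rewrite -{1}[N]add0n big_addn.
rewrite (eq_bigr (fun j => ((1 + j)%:R ^+ 2)^-1)); last first.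
  by move=> j _; congr ((_ %:R ^+ 2)^-1); lia.
exact: sum_inv_sqr.
Qed.

(** As [1 + supn k] dominates each [1 + |k_i|], the weight is at most a product of one-dimensional
    weights; the sum over the cube then factors into [n] sums, each at most 4. *)
Lemma sum_pw_box N : \sum_(k <- box N) pw k <= 4 ^+ n.
Proof.
rewrite big_map big_enum /=.
apply: (@le_trans _ _ (\sum_(f : {ffun 'I_n -> 'I_(N.*2.+1)})
   \prod_(i < n) ((1 + absz ((f i : nat)%:Z - N%:Z))%:R ^+ 2)^-1)).
  apply: ler_sum => f _.
  rewrite prodfV lef_pV2 ?posrE; last 2 first.
  - by rewrite exprn_gt0 // ltr0n.
  - by apply: prodr_gt0 => i _; rewrite exprn_gt0 // ltr0n.
  apply: (@le_trans _ _ (\prod_(i < n)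
      ((1 + supn (\row_i0 ((f i0 : nat)%:Z - N%:Z)))%:R ^+ 2))).
    apply: ler_prod => i _; rewrite exprn_ge0 //=.
    rewrite ler_pXn2r ?nnegrE // ler_nat leq_add2l.
    by apply: leq_trans (le_supn _ i); rewrite mxE.
  by rewrite prodr_const card_ord -exprM.
rewrite -(bigA_distr_bigA (fun (i : 'I_n) (j : 'I_(N.*2.+1)) =>
  ((1 + absz ((j : nat)%:Z - N%:Z))%:R ^+ 2)^-1)).
apply: (@le_trans _ _ (\prod_(i < n) 4)); last by rewrite prodr_const card_ord.
apply: ler_prod => i _; rewrite sum_pw1 andbT.
by apply: sumr_ge0 => j _; rewrite invr_ge0 exprn_ge0.
Qed.

Lemma box_split (U : zmodType) (a : K -> U) N M : (N <= M)%N ->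
  \sum_(k <- box M) a k =
  \sum_(k <- box N) a k + \sum_(k <- box M | (N < supn k)%N) a k.
Proof.
move=> NM; rewrite (bigID (fun k => (supn k <= N)%N)) /=; congr (_ + _).
  rewrite -big_filter; apply: perm_big; apply: uniq_perm.
  - by rewrite filter_uniq ?box_uniq.
  - exact: box_uniq.
  move=> k; rewrite mem_filter !mem_box.
  by case: leqP => //= h; rewrite (leq_trans h NM).
by apply: eq_bigl => k; rewrite -ltnNge.
Qed.

End Lattice.

(** * Absolutely convergent sums over Z^n *)

Section Sums.
Context {R : realType} {n : nat}.
Local Notation C := R[i].
Local Notation K := 'rV[int]_n.
Implicit Types (a b : K -> C) (B : R) (k : K).

(** Completeness in the form used throughout: [P e x] reads as an approximation [x] known up to [e].
    If these are mutually compatible, the supremum of the lower ends [x - e] satisfies all the error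
    bars at once. *)
Lemma squeeze_exR (P : R -> R -> Prop) :
  (forall e, 0 < e -> exists x, P e x) ->
  (forall e e' x x', P e x -> P e' x' -> `|x - x'| <= e + e') ->
  exists c, forall e x, P e x -> `|c - x| <= e.
Proof.
move=> hex hP.
pose S : set R := [set y | exists e x, P e x /\ y = x - e]%classic.
have [x1 P1] := hex 1 ltr01.
have bnd e x : P e x -> ubound S (x + e).
  move=> Px y [e' [x' [Px' ->]]].
  by have := hP _ _ _ _ Px Px'; rewrite ler_norml => /andP[]; lra.
have supS : has_sup S.
  by split; [exists (x1 - 1), 1, x1 | exists (x1 + 1); exact: bnd P1].
exists (sup S) => e x Px; rewrite ler_norml; apply/andP; split.
  suff : x - e <= sup S by lra.
  by apply: ub_le_sup; [case: supS | exists e, x].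
suff : sup S <= x + e by lra.
by apply: ge_sup; [case: supS | exact: bnd Px].
Qed.

Lemma squeeze_exC (P : R -> C -> Prop) :
  (forall e, 0 < e -> exists x, P e x) ->
  (forall e e' x x', P e x -> P e' x' -> nc (x - x') <= e + e') ->
  exists c, forall e x, P e x -> nc (c - x) <= e.
Proof.
move=> hex hP.
have exR (f : C -> R) (fB : forall x y, f x - f y = f (x - y))
    (hf : forall x, `|f x| <= nc x) :
    exists c, forall e x, P e x -> `|c - f x| <= e.
  have [||c hc] := @squeeze_exR (fun e y => exists x, P e x /\ y = f x).
  - by move=> e /hex[x Px]; exists (f x), x.
  - move=> e e' _ _ [x [Px ->]] [x' [Px' ->]]; rewrite fB.
    by apply: le_trans (hf _) _; exact: hP.
  by exists c => e x Px; apply: hc; exists x.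
have [||cr hr] := exR (@complex.Re R).
- by move=> x y; rewrite ReD ReN.
- exact: nc_Re.
have [||ci hi] := exR (@complex.Im R).
- by move=> x y; rewrite ImD ImN.
- exact: nc_Im.
exists (Complex cr ci) => e x Px; apply/ler_addgt0Pr => d d0.
have d30 : 0 < d / 3 by rewrite divr_gt0.
have [y Py] := hex _ d30.
apply: le_trans (nc_dist _ y _) _.
have h1 : nc (Complex cr ci - y) <= d / 3 + d / 3.
  apply: le_trans (nc_le_ReIm _) _; rewrite ReD ImD ReN ImN /=.
  by apply: lerD; [apply: hr | apply: hi].
by have := hP _ _ _ _ Py Px; lra.
Qed.

Definition Sbox N a : C := \sum_(k <- box N) a k.

Definition pwbox N : R := \sum_(k <- @box n N) pw k.

Definition Cn : R := sup (range pwbox).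

(** The mass of [pw] outside the box of radius [N]: the universal rate at which dominated sums
    converge. *)
Definition Tl N : R := Cn - pwbox N.

Lemma has_sup_pwbox : has_sup (range pwbox).
Proof.
split; first by exists (pwbox 0), 0%N.
by exists (4 ^+ n) => _ [N _ <-]; exact: sum_pw_box.
Qed.

Lemma le_pwbox N : pwbox N <= Cn.
Proof. by apply: ub_le_sup; [case: has_sup_pwbox | exists N]. Qed.

Lemma Tl_ge0 N : 0 <= Tl N.
Proof. by rewrite subr_ge0 le_pwbox. Qed.

Lemma pwbox_homo N M : (N <= M)%N -> pwbox N <= pwbox M.
Proof.
move=> NM; rewrite /pwbox (box_split _ NM) lerDl.
by apply: sumr_ge0 => k _; exact: pw_ge0.
Qed.

Lemma Tl_small e : 0 < e -> exists N0, forall N, (N0 <= N)%N -> Tl N <= e.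
Proof.
move=> e0; have [_ [N0 _ <-] h] := sup_adherent e0 has_sup_pwbox.
exists N0 => N hN; have := pwbox_homo hN; rewrite /Tl /Cn.
by move: h; rewrite -/Cn; lra.
Qed.

Lemma Cn_ge1 : 1 <= Cn.
Proof.
apply: le_trans (le_pwbox 0); rewrite /pwbox.
have -> : \sum_(k <- @box n 0) pw k = \sum_(k <- [:: 0 : K]) pw k :> R.
  apply: perm_big; apply: uniq_perm; rewrite ?box_uniq // => k.
  by rewrite mem_box leqn0 supn_eq0 inE.
by rewrite big_seq1 /pw supn0 addn0 expr1n invr1.
Qed.

Lemma Cn_gt0 : 0 < Cn. Proof. exact: lt_le_trans ltr01 Cn_ge1. Qed.

Definition dom a B := forall k, nc (a k) <= B * pw k.

Lemma dom_ge0 a B : dom a B -> 0 <= B.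
Proof.
move=> h; have := h 0; rewrite /pw supn0 addn0 expr1n invr1 mulr1.
exact: le_trans (nc_ge0 _).
Qed.

Lemma dom_sub a B N M : dom a B -> (N <= M)%N ->
  nc (Sbox M a - Sbox N a) <= B * (pwbox M - pwbox N).
Proof.
move=> h NM; rewrite /Sbox /pwbox !(box_split _ NM) addrC addKr addrC addKr.
apply: le_trans (nc_sum _ _ _) _; rewrite mulr_sumr.
by apply: ler_sum => k _; exact: h.
Qed.

Lemma Sbox_cauchy a B N M : dom a B ->
  nc (Sbox M a - Sbox N a) <= B * Tl M + B * Tl N.
Proof.
move=> h; have B0 := dom_ge0 h.
wlog NM : N M / (N <= M)%N => [hw|].
  case: (leqP N M) => [/hw//|/ltnW/hw h1].
  by rewrite ncC [leRHS]addrC.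
apply: le_trans (dom_sub h NM) _; rewrite -mulrDr ler_wpM2l // /Tl.
by have := le_pwbox M; lra.
Qed.

(** The value is pinned down by its rate of approximation by box sums and selected with [xget]; on a
    family that is not dominated it defaults to 0. *)
Definition tsum a : C :=
  xget 0 [set x | exists B, dom a B /\ forall N, nc (x - Sbox N a) <= B * Tl N]%classic.

Lemma small_MTl B e : 0 < e -> exists N0, forall N, (N0 <= N)%N -> B * Tl N <= e.
Proof.
move=> e0.
have B1 : 0 < `|B| + 1 by rewrite ltr_wpDl.
have /Tl_small[N0 h] : 0 < e / (`|B| + 1) by rewrite divr_gt0.
exists N0 => N /h hN.
apply: (@le_trans _ _ ((`|B| + 1) * Tl N)).
  by rewrite ler_wpM2r ?Tl_ge0 //; apply: le_trans (ler_norm B) _; rewrite lerDl.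
by rewrite mulrC -ler_pdivlMr.
Qed.

Lemma tsum_ex a B : dom a B -> exists x, forall N, nc (x - Sbox N a) <= B * Tl N.
Proof.
move=> h.
have [||c hc] := @squeeze_exC (fun e x => exists2 N, x = Sbox N a & B * Tl N <= e).
- by move=> e /(small_MTl B)[N0 hN]; exists (Sbox N0 a), N0 => //; exact: hN.
- move=> e e' _ _ [N -> hN] [M -> hM].
  by apply: le_trans (Sbox_cauchy _ _ h) _; exact: lerD.
by exists c => N; apply: hc; exists N.
Qed.

Lemma tsum_spec a B : dom a B ->
  exists B', dom a B' /\ forall N, nc (tsum a - Sbox N a) <= B' * Tl N.
Proof.
move=> h; have [x hx] := tsum_ex h.
have := @xgetPex _ 0
  [set x | exists B, dom a B /\ forall N, nc (x - Sbox N a) <= B * Tl N]%classic.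
by apply; exists x, B.
Qed.

Lemma lim_uniq a x y :
  (forall e, 0 < e -> exists N0, forall N, (N0 <= N)%N -> nc (x - Sbox N a) <= e) ->
  (forall e, 0 < e -> exists N0, forall N, (N0 <= N)%N -> nc (y - Sbox N a) <= e) ->
  x = y.
Proof.
move=> hx hy; apply/eqP; rewrite -subr_eq0; apply/eqP/nc_small => e e0.
have e20 : 0 < e / 2 by rewrite divr_gt0.
have [N1 h1] := hx _ e20; have [N2 h2] := hy _ e20.
apply: le_trans (nc_dist _ (Sbox (maxn N1 N2) a) _) _.
have := h1 _ (leq_maxl N1 N2); have := h2 _ (leq_maxr N1 N2).
by rewrite [nc (_ - y)]ncC; lra.
Qed.

Lemma tsum_uniq a B x : dom a B ->
  (forall e, 0 < e -> exists N0, forall N, (N0 <= N)%N -> nc (x - Sbox N a) <= e) ->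
  tsum a = x.
Proof.
move=> /tsum_spec[B' [_ h]] hx; apply: (lim_uniq _ hx) => e /(small_MTl B')[N0 hN].
by exists N0 => N /hN; apply: le_trans.
Qed.

Lemma tsum_tail a B N : dom a B -> nc (tsum a - Sbox N a) <= B * Tl N.
Proof.
move=> h; have [x hx] := tsum_ex h; rewrite (tsum_uniq h (x := x)) //.
move=> e /(small_MTl B)[N0 hN].
by exists N0 => M /hN; apply: le_trans.
Qed.

Lemma tsum_bound a B : dom a B -> nc (tsum a) <= B * Cn.
Proof.
move=> h; have := tsum_tail 0 h; have B0 := dom_ge0 h.
have : nc (Sbox 0 a) <= B * pwbox 0.
  apply: le_trans (nc_sum _ _ _) _; rewrite mulr_sumr.
  by apply: ler_sum => k _; exact: h.
have := ncD (tsum a - Sbox 0 a) (Sbox 0 a); rewrite subrK /Tl mulrBr.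
by lra.
Qed.

Lemma domD a b B B' : dom a B -> dom b B' -> dom (fun k => a k + b k) (B + B').
Proof.
move=> ha hb k; apply: le_trans (ncD _ _) _; rewrite mulrDl.
exact: lerD.
Qed.

Lemma domZ a B c : dom a B -> dom (fun k => c * a k) (nc c * B).
Proof. by move=> ha k; rewrite ncM -mulrA ler_wpM2l ?nc_ge0. Qed.

Lemma dom_le a b B : dom b B -> (forall k, nc (a k) <= nc (b k)) -> dom a B.
Proof. by move=> hb hab k; apply: le_trans (hab k) (hb k). Qed.

Lemma dom_leB a B B' : dom a B -> B <= B' -> dom a B'.
Proof.
move=> hb hab k; apply: le_trans (hb k) _.
by rewrite ler_wpM2r // pw_ge0.
Qed.

Lemma tsumD a b B B' : dom a B -> dom b B' ->
  tsum (fun k => a k + b k) = tsum a + tsum b.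
Proof.
move=> ha hb; apply: (tsum_uniq (domD ha hb)) => e.
move=> /(small_MTl (B + B'))[N0 hN]; exists N0 => N /hN.
apply: le_trans; rewrite /Sbox big_split /= opprD addrACA mulrDl.
apply: le_trans (ncD _ _) _.
by apply: lerD; apply: tsum_tail.
Qed.

Lemma tsumZ a B c : dom a B -> tsum (fun k => c * a k) = c * tsum a.
Proof.
move=> ha; apply: (tsum_uniq (domZ c ha)) => e.
move=> /(small_MTl (nc c * B))[N0 hN]; exists N0 => N /hN.
apply: le_trans; rewrite /Sbox -mulr_sumr -mulrBr ncM -mulrA.
by rewrite ler_wpM2l ?nc_ge0 // tsum_tail.
Qed.

Lemma domN a B : dom a B -> dom (fun k => - a k) B.
Proof. by move=> h; apply: dom_le h _ => k; rewrite ncN. Qed.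

Lemma tsumN a B : dom a B -> tsum (fun k => - a k) = - tsum a.
Proof.
move=> h; rewrite -mulN1r -(tsumZ _ h); congr tsum.
by apply/funext => k; rewrite mulN1r.
Qed.

Lemma tsumB a b B B' : dom a B -> dom b B' ->
  tsum (fun k => a k - b k) = tsum a - tsum b.
Proof. by move=> ha hb; rewrite (tsumD ha (domN hb)) (tsumN hb). Qed.

Lemma tsum_sum (I : Type) (s : seq I) (F : I -> K -> C) B :
  (forall i, dom (F i) B) ->
  (dom (fun k => \sum_(i <- s) F i k) ((size s)%:R * B)) /\
  tsum (fun k => \sum_(i <- s) F i k) = \sum_(i <- s) tsum (F i).
Proof.
move=> h.
have z0 : dom (fun=> 0) 0 by move=> k; rewrite nc0 mul0r.
elim: s => [|i s [d IH]].
  rewrite (_ : (fun k => _) = (fun=> 0)); last by apply/funext => k; rewrite big_nil.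
  rewrite big_nil mul0r; split => //; apply: (tsum_uniq z0) => e e0; exists 0%N => N _.
  by rewrite /Sbox big1 // subr0 nc0 ltW.
rewrite (_ : (fun k => _) = (fun k => F i k + \sum_(j <- s) F j k)); last first.
  by apply/funext => k; rewrite big_cons.
split; last by rewrite (tsumD (h i) d) IH big_cons.
by apply: dom_leB (domD (h i) d) _; rewrite /= -natr1 mulrDl mul1r addrC.
Qed.

Lemma dom_conj a B : dom a B -> dom (fun k => conjc (a (- k))) B.
Proof. by move=> h k; rewrite nc_conj; apply: le_trans (h _) _; rewrite /pw supnN. Qed.

(** The boxes are invariant under [k -> - k], so conjugation can be moved through each partial sum
    by reindexing. *)
Lemma tsum_conj a B : dom a B -> tsum (fun k => conjc (a (- k))) = conjc (tsum a).
Proof.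
move=> h; apply: (tsum_uniq (dom_conj h)) => e.
move=> /(small_MTl B)[N0 hN]; exists N0 => N /hN.
apply: le_trans; rewrite (_ : Sbox N _ = conjc (Sbox N a)).
  by rewrite -conjcN -conjcD nc_conj; exact: tsum_tail.
rewrite conjc_sum /Sbox.
transitivity (\sum_(k <- [seq - l | l <- box N]) conjc (a k)); first by rewrite [RHS]big_map.
apply: perm_big; apply: uniq_perm; rewrite ?box_uniq //.
  by rewrite map_inj_uniq ?box_uniq //; exact: oppr_inj.
move=> k; rewrite mem_box; apply/mapP/idP => [[l]|h'].
  by rewrite mem_box => hl ->; rewrite supnN.
by exists (- k); rewrite ?opprK // mem_box supnN.
Qed.

Lemma tsum_fin a N : (forall k, (N < supn k)%N -> a k = 0) ->
  (exists B, dom a B) /\ tsum a = Sbox N a.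
Proof.
move=> h; have [B hB] : exists B, dom a B.
  (* Any finite family is dominated: the constant adds up all the ratios to [pw], and one of them is
     the ratio at [k]. *)
  exists (\sum_(k <- box N) nc (a k) / pw k) => k.
  case: (leqP (supn k) N) => hk; last first.
    rewrite h // nc0 mulr_ge0 ?pw_ge0 //; apply: sumr_ge0 => l _.
    by rewrite divr_ge0 ?nc_ge0 ?pw_ge0.
  rewrite -ler_pdivrMr ?pw_gt0 // (bigD1_seq k) ?mem_box ?box_uniq //= lerDl.
  by apply: sumr_ge0 => l _; rewrite divr_ge0 ?nc_ge0 ?pw_ge0.
split; first by exists B.
apply: (tsum_uniq hB) => e e0; exists N => M hM.
rewrite /Sbox (box_split _ hM) [X in _ - (_ + X)]big1 => [|k]; last exact: h.
by rewrite addr0 subrr nc0 ltW.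
Qed.

End Sums.

(** * Uniform limits of trigonometric polynomials on complex strips *)

Section MatrixBounds.
Context {R : realType} {n : nat}.
Local Notation C := R[i].
Implicit Types (A B M : 'M[C]_n) (v : 'rV[C]_n).

Definition rsum {m} (A : 'M[C]_(m, n)) i : R := \sum_(j < n) nc (A i j).

Lemma rsum_ge0 m (A : 'M[C]_(m, n)) i : 0 <= rsum A i.
Proof. by apply: sumr_ge0 => j _; exact: nc_ge0. Qed.

Lemma le_rsum m (A : 'M[C]_(m, n)) i j : nc (A i j) <= rsum A i.
Proof.
rewrite /rsum (bigD1 j) //= lerDl; apply: sumr_ge0 => l _; exact: nc_ge0.
Qed.

Lemma nc_mulmx m (X : 'M[C]_(m, n)) A b i j : (forall k, nc (A k j) <= b) ->
  nc ((X *m A) i j) <= rsum X i * b.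
Proof.
move=> h; rewrite mxE; apply: le_trans (nc_sum _ _ _) _; rewrite mulr_suml.
by apply: ler_sum => k _; rewrite ncM ler_wpM2l ?nc_ge0.
Qed.

Lemma rsum_mulmx m (X : 'M[C]_(m, n)) A b i : (forall k j, nc (A k j) <= b) ->
  rsum (X *m A) i <= rsum X i * (n%:R * b).
Proof.
move=> h; apply: (@le_trans _ _ (\sum_(j < n) rsum X i * b)).
  by apply: ler_sum => j _; apply: nc_mulmx => k.
by rewrite sumr_const card_ord -(mulr_natl (_ * b)) mulrCA.
Qed.

Lemma rsum_le m (X : 'M[C]_(m, n)) b i : (forall j, nc (X i j) <= b) ->
  rsum X i <= n%:R * b.
Proof.
move=> h; apply: (@le_trans _ _ (\sum_(j < n) b)); first by apply: ler_sum.
by rewrite sumr_const card_ord mulr_natl.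
Qed.

Lemma rsumD m (X Y : 'M[C]_(m, n)) i : rsum (X + Y) i <= rsum X i + rsum Y i.
Proof. by rewrite -big_split; apply: ler_sum => j _; rewrite mxE ncD. Qed.

Lemma rsum1 i : rsum (1%:M : 'M[C]_n) i = 1.
Proof.
rewrite /rsum (bigD1 i) //= mxE eqxx nc1 big1 ?addr0 // => j /negPf h.
by rewrite mxE eq_sym h nc0.
Qed.

Section NearIdentity.
Variables (M : 'M[C]_n) (m : R).
Hypothesis hM : forall i j, nc ((M - 1%:M) i j) <= m.
Hypothesis hm : n%:R * m <= 1 / 2.

Lemma nc_1subM i j : nc ((1%:M - M) i j) <= m.
Proof. by rewrite -opprB mxE ncN. Qed.

(** A row [X] of the kernel satisfies [X = X (1 - M)], and right multiplication by [1 - M] at least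
    halves the row sum, so [X = 0]. *)
Lemma near1_unit : M \in unitmx.
Proof.
rewrite -row_free_unit -kermx_eq0; apply/eqP.
set X := kermx M; have XM : X *m M = 0 by exact: mulmx_ker.
have XE : X = X *m (1%:M - M) by rewrite mulmxBr mulmx1 XM subr0.
apply/matrixP => i j; rewrite [RHS]mxE.
have h : rsum X i <= rsum X i * (n%:R * m).
  by rewrite {1}XE; apply: rsum_mulmx; exact: nc_1subM.
have := le_rsum X i j; have := rsum_ge0 X i; have := nc_ge0 (X i j) => h1 h2 h3.
apply: nc_eq0; apply/eqP; rewrite eq_le h1 andbT.
by have := ler_wpM2l h2 hm; lra.
Qed.

(** Self-improving bound: [M^-1 = 1 + M^-1 (1 - M)] gives [rho <= 1 + rho / 2] for each row sum
    [rho] of the inverse. *)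
Lemma rsum_inv i : rsum (invmx M) i <= 2.
Proof.
have E : invmx M = 1%:M + invmx M *m (1%:M - M).
  by rewrite mulmxBr mulmx1 mulVmx ?near1_unit // addrC subrK.
have h : rsum (invmx M) i <= 1 + rsum (invmx M) i * (n%:R * m).
  rewrite {1}E; apply: le_trans (rsumD _ _ _) _; rewrite rsum1 lerD2l.
  by apply: rsum_mulmx; exact: nc_1subM.
have := rsum_ge0 (invmx M) i => r0.
by have := ler_wpM2l r0 hm; lra.
Qed.

Lemma nc_inv i j : nc (invmx M i j) <= 2.
Proof. exact: le_trans (le_rsum _ _ _) (rsum_inv _). Qed.

Lemma nc_invB1 i j : nc ((invmx M - 1%:M) i j) <= 2 * m.
Proof.
have -> : invmx M - 1%:M = invmx M *m (1%:M - M).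
  by rewrite mulmxBr mulmx1 mulVmx ?near1_unit.
have m0 : 0 <= m := le_trans (nc_ge0 _) (hM i j).
apply: (@le_trans _ _ (rsum (invmx M) i * m)).
  by apply: nc_mulmx => k; exact: nc_1subM.
by rewrite ler_wpM2r // rsum_inv.
Qed.

(** The partial sums of the geometric series of [1 - M]. They are polynomials in the entries of [M],
    hence remain uniform limits of trigonometric polynomials, and they converge to the inverse at a
    uniform rate. *)
Fixpoint neumann (q : nat) : 'M[C]_n :=
  if q is q'.+1 then 1%:M + neumann q' *m (1%:M - M) else 0.

Lemma neumannP q i : rsum (invmx M - neumann q) i <= 2 * (1 / 2) ^+ q.
Proof.
elim: q => [|q IH]; first by rewrite /= subr0 expr0 mulr1 rsum_inv.
have -> : invmx M - neumann q.+1 = (invmx M - neumann q) *m (1%:M - M).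
  have E : invmx M *m (1%:M - M) = invmx M - 1%:M.
    by rewrite mulmxBr mulmx1 mulVmx ?near1_unit.
  by rewrite mulmxBl E /= opprD addrA.
have h : rsum ((invmx M - neumann q) *m (1%:M - M)) i <=
    rsum (invmx M - neumann q) i * (n%:R * m) by apply: rsum_mulmx; exact: nc_1subM.
apply: le_trans h _.
have := ler_wpM2l (rsum_ge0 (invmx M - neumann q) i) hm.
by rewrite exprS; lra.
Qed.

End NearIdentity.
End MatrixBounds.

(** * The closure of trigonometric polynomials and its stability properties *)

Section TrigClass.
Context {R : realType} {n : nat}.
Local Notation C := R[i].
Local Notation V := 'rV[C]_n.
Local Notation K := 'rV[int]_n.
Implicit Types (k l : K) (z w : V) (s e : R) (f g : V -> C) (p q : seq (K * C)).

(* Trigonometric polynomials are lists of pairs (frequency, coefficient). *)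
Definition tev p z : C := \sum_(t <- p) t.2 * ek t.1 z.

Definition cl s e p f := forall z, l1im z <= s -> nc (f z - tev p z) <= e.

(** The substitute for holomorphy on the strip: only the operations of the Newton step have to
    preserve this property, and its members automatically have Fourier coefficients decaying like
    [wt s]. *)
Definition ap s f := forall e, 0 < e -> exists p, cl s e p f.

Lemma ap_ext s f g : (forall z, l1im z <= s -> f z = g z) -> ap s f -> ap s g.
Proof.
by move=> fg hf e /hf[p hp]; exists p => z hz; rewrite -fg //; exact: hp.
Qed.

Lemma ap_mono s s' f : s' <= s -> ap s f -> ap s' f.
Proof.
by move=> ss hf e /hf[p hp]; exists p => z hz; apply: hp; exact: le_trans ss.
Qed.

Lemma ap_tev s p : ap s (tev p).
Proof. by move=> e e0; exists p => z _; rewrite subrr nc0 ltW. Qed.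

Lemma ap_cst s (c : C) : ap s (fun=> c).
Proof.
by apply: ap_ext (ap_tev s [:: (0, c)]) => z _; rewrite /tev big_seq1 /= ek0k mulr1.
Qed.

Lemma ap_ek s k : ap s (ek k).
Proof.
by apply: ap_ext (ap_tev s [:: (k, 1)]) => z _; rewrite /tev big_seq1 /= mul1r.
Qed.

Lemma tev_bnd s p : exists2 B, 0 < B & forall z, l1im z <= s -> nc (tev p z) <= B.
Proof.
exists (1 + \sum_(t <- p) nc t.2 * expR (2 * pi * s * (supn t.1)%:R)).
  rewrite ltr_pwDl //; apply: sumr_ge0 => t _.
  by rewrite mulr_ge0 ?nc_ge0 ?expR_ge0.
move=> z hz; apply: le_trans (nc_sum _ _ _) _.
apply: (@le_trans _ _ (\sum_(t <- p) nc t.2 * expR (2 * pi * s * (supn t.1)%:R))).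
  by apply: ler_sum => t _; rewrite ncM ler_wpM2l ?nc_ge0 // nc_ek_le.
by rewrite lerDr.
Qed.

Lemma ap_bnd s f : ap s f -> exists2 B, 0 < B & forall z, l1im z <= s -> nc (f z) <= B.
Proof.
move=> /(_ 1 ltr01)[p hp]; have [B B0 hB] := tev_bnd s p.
exists (1 + B) => [|z hz]; first by rewrite addr_gt0.
by have := ncD (f z - tev p z) (tev p z); rewrite subrK; have := hp z hz;
  have := hB z hz; lra.
Qed.

Lemma ap_lim s f :
  (forall e, 0 < e -> exists2 g, ap s g & forall z, l1im z <= s -> nc (f z - g z) <= e) ->
  ap s f.
Proof.
move=> h e e0; have e20 : 0 < e / 2 by rewrite divr_gt0.
have [g /(_ _ e20)[p hp] fg] := h _ e20; exists p => z hz.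
by apply: le_trans (nc_dist _ (g z) _) _; have := fg z hz; have := hp z hz; lra.
Qed.

Lemma tev_cat p q z : tev (p ++ q) z = tev p z + tev q z.
Proof. by rewrite /tev big_cat. Qed.

Lemma apD s f g : ap s f -> ap s g -> ap s (fun z => f z + g z).
Proof.
move=> hf hg e e0; have e20 : 0 < e / 2 by rewrite divr_gt0.
have [p hp] := hf _ e20; have [q hq] := hg _ e20; exists (p ++ q) => z hz.
rewrite tev_cat opprD addrACA; apply: le_trans (ncD _ _) _.
by have := hp z hz; have := hq z hz; lra.
Qed.

Lemma tevM p q z :
  tev [seq (t.1 + u.1, t.2 * u.2) | t <- p, u <- q] z = tev p z * tev q z.
Proof.
rewrite /tev big_allpairs_dep /= mulr_suml; apply: eq_bigr => t _.
by rewrite mulr_sumr; apply: eq_bigr => u _ /=; rewrite ekDk; ring.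
Qed.

Lemma apM s f g : ap s f -> ap s g -> ap s (fun z => f z * g z).
Proof.
move=> hf hg; have [A A0 hA] := ap_bnd hf; have [B B0 hB] := ap_bnd hg.
apply: ap_lim => e e0.
(* The cap at 1 bounds the product of the two approximation errors by a single one, which accounts
   for the [+ 1] in the denominator. *)
pose d := Num.min 1 (e / (A + B + 1)).
have d0 : 0 < d by rewrite lt_min ltr01 divr_gt0 ?addr_gt0.
have [p hp] := hf _ d0; have [q hq] := hg _ d0.
exists (fun z => tev p z * tev q z).
  by apply: ap_ext (ap_tev s [seq (t.1 + u.1, t.2 * u.2) | t <- p, u <- q]) => z _;
    rewrite tevM.
move=> z hz.
have -> : f z * g z - tev p z * tev q z =
  (f z - tev p z) * g z + (f z * (g z - tev q z) - (f z - tev p z) * (g z - tev q z)).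
  by ring.
apply: le_trans (ncD _ _) _; apply: le_trans (lerD (lexx _) (ncB _ _)) _.
rewrite !ncM.
have := hp z hz; have := hq z hz; have := hA z hz; have := hB z hz.
have d1 : d <= 1 by rewrite ge_min lexx.
have d2 : d * (A + B + 1) <= e by rewrite -ler_pdivlMr ?addr_gt0 // ge_min lexx orbT.
move: (nc (f z)) (nc (g z)) (nc (f z - _)) (nc (g z - _))
  (nc_ge0 (f z)) (nc_ge0 (g z)) (nc_ge0 (f z - tev p z)) (nc_ge0 (g z - tev q z))
  => a b x y a0 b0 x0 y0 hb ha hy hx.
apply: le_trans d2; nra.
Qed.

Lemma apZ s c f : ap s f -> ap s (fun z => c * f z).
Proof. by move=> hf; apply: apM hf; exact: ap_cst. Qed.

Lemma apN s f : ap s f -> ap s (fun z => - f z).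
Proof. by move=> /(apZ (-1)); apply: ap_ext => z _; rewrite mulN1r. Qed.

Lemma apB s f g : ap s f -> ap s g -> ap s (fun z => f z - g z).
Proof. by move=> hf hg; apply: apD hf (apN hg). Qed.

Lemma ap_sum (I : Type) (r : seq I) s (F : I -> V -> C) :
  (forall i, ap s (F i)) -> ap s (fun z => \sum_(i <- r) F i z).
Proof.
move=> h; elim: r => [|i r IH].
  by apply: ap_ext (ap_cst s 0) => z _; rewrite big_nil.
by apply: ap_ext (apD (h i) IH) => z _; rewrite big_cons.
Qed.

Lemma apX s f m : ap s f -> ap s (fun z => f z ^+ m).
Proof.
move=> hf; elim: m => [|m IH]; first exact: ap_cst.
by apply: ap_ext (apM hf IH) => z _; rewrite exprS.
Qed.

Lemma nc_subX (x y : C) b m : nc x <= b -> nc y <= b -> 1 <= b ->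
  nc (x ^+ m - y ^+ m) <= m%:R * b ^+ m * nc (x - y).
Proof.
move=> hx hy b1; have b0 : 0 <= b by lra.
elim: m => [|m IH]; first by rewrite !expr0 subrr nc0 !mul0r.
have -> : x ^+ m.+1 - y ^+ m.+1 = x * (x ^+ m - y ^+ m) + (x - y) * y ^+ m.
  by rewrite !exprS; ring.
apply: le_trans (ncD _ _) _; rewrite !ncM ncX -natr1.
have h1 : nc x * nc (x ^+ m - y ^+ m) <= b * (m%:R * b ^+ m * nc (x - y)).
  by apply: ler_pM; rewrite ?nc_ge0.
have h2 : nc y ^+ m <= b ^+ m by rewrite lerXn2r ?nnegrE ?nc_ge0.
have h3 : b ^+ m <= b ^+ m.+1 by rewrite exprS ler_peMl // exprn_ge0.
have h4 : nc (x - y) * nc y ^+ m <= nc (x - y) * b ^+ m.+1.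
  by rewrite ler_wpM2l ?nc_ge0 //; exact: le_trans h3.
apply: le_trans (lerD h1 h4) _; rewrite exprS.
by rewrite le_eqVlt; apply/orP; left; apply/eqP; ring.
Qed.

(** Both sides are [m]-th powers, of [cexp (w / m)] and of [1 + w / m]. These bases differ by
    [O(1 / m^2)], and raising to the power [m] costs only a factor [m] times a bounded exponential.
    The exponential is thus reached by polynomials, uniformly for bounded [w]. *)
Lemma cexp_approx (w : C) (B : R) m : nc w <= B -> (0 < m)%N -> B <= m%:R ->
  nc (cexp w - (1 + cR m%:R^-1 * w) ^+ m) <= 4 * B ^+ 2 * expR (B + 1) / m%:R.
Proof.
move=> hw m0 hm; have B0 : 0 <= B := le_trans (nc_ge0 _) hw.
have mp : 0 < m%:R :> R by rewrite ltr0n.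
set v := cR m%:R^-1 * w.
have vE : nc v = nc w / m%:R by rewrite ncM nc_cR gtr0_norm ?invr_gt0 // mulrC.
have vm : nc v <= B / m%:R by rewrite vE ler_wpM2r // invr_ge0 ltW.
have v1 : nc v <= 1.
  by apply: le_trans vm _; rewrite ler_pdivrMr // mul1r.
have -> : cexp w = cexp v ^+ m.
  rewrite -cexpMn; congr cexp; rewrite -mulr_natl /v mulrA.
  have -> : m%:R = cR m%:R :> C by rewrite [LHS](_ : _ = (m%:R)%:C%C) // rmorph_nat.
  by rewrite -cRM divff ?gt_eqF // cR1 mul1r.
have h := @nc_subX (cexp v) (1 + v) (expR (nc v)) m.
apply: le_trans (h _ _ _) _.
- by rewrite nc_cexp ler_expR; apply: le_trans (ler_norm _) (nc_Re _).
- apply: le_trans (ncD _ _) _; rewrite nc1; exact: expR_ge1Dx.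
- by rewrite -expR0 ler_expR nc_ge0.
rewrite -expRM_natl; have e1 : expR (m%:R * nc v) <= expR B.
  by rewrite ler_expR mulrC -ler_pdivlMr.
have h2 : nc (cexp v - (1 + v)) <= 4 * (B / m%:R) ^+ 2 * expR 1.
  rewrite opprD addrA; apply: le_trans (nc_cexpB1B v) _.
  apply: ler_pM; rewrite ?expR_ge0 ?ler_expR ?mulr_ge0 ?sqr_ge0 ?nc_ge0 //.
  by rewrite ler_wpM2l // lerXn2r ?nnegrE ?nc_ge0 ?divr_ge0 // ltW.
have h3 : m%:R * expR (m%:R * nc v) <= m%:R * expR B by rewrite ler_wpM2l // ltW.
apply: (@le_trans _ _ (m%:R * expR B * (4 * (B / m%:R) ^+ 2 * expR 1))).
  by apply: ler_pM; rewrite ?nc_ge0 ?mulr_ge0 ?expR_ge0 // ltW.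
rewrite expRD le_eqVlt; apply/orP; left; apply/eqP; field.
by rewrite gt_eqF.
Qed.

Lemma ap_cexp s f : ap s f -> ap s (fun z => cexp (f z)).
Proof.
move=> hf; have [B B0 hB] := ap_bnd hf.
apply: ap_lim => e e0.
pose T := Num.max B (4 * B ^+ 2 * expR (B + 1) / e).
have [m hm] : exists m : nat, T < m%:R.
  by exists (Num.bound `|T|); apply: le_lt_trans (ler_norm T) (archi_boundP (normr_ge0 T)).
have TB : B <= T by rewrite le_max lexx.
have TE : 4 * B ^+ 2 * expR (B + 1) / e <= T by rewrite le_max lexx orbT.
have mp : 0 < m%:R :> R by lra.
exists (fun z => (1 + cR m%:R^-1 * f z) ^+ m).
  by apply: apX; apply: apD; [exact: ap_cst | exact: apZ].
move=> z hz; apply: le_trans (cexp_approx (hB z hz) _ _) _.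
- by move: mp; rewrite ltr0n.
- by lra.
by rewrite ler_pdivrMr // -ler_pdivrMl // [e^-1 * _]mulrC; lra.
Qed.

Lemma ap_lin s k (U : V -> V) : (forall i, ap s (fun z => U z 0 i)) ->
  ap s (fun z => lin k (U z)).
Proof. by move=> h; apply: ap_sum => i; apply: apZ. Qed.

Lemma ap_tev_comp s p (U : V -> V) : (forall i, ap s (fun z => U z 0 i)) ->
  ap s (fun z => tev p (z + U z)).
Proof.
move=> h; apply: ap_sum => t; apply: apZ.
have H : ap s (fun z => ek t.1 z * ek t.1 (U z)).
  by apply: apM; [exact: ap_ek | apply: ap_cexp; apply: apZ; exact: ap_lin].
by apply: ap_ext H => z _; rewrite ekD.
Qed.

(** On the larger strip [f] is replaced by a polynomial [p]; each character splits as
    [ek k (z + U z) = ek k z * ek k (U z)], and the second factor is an exponential of members of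
    the class. *)
Lemma ap_comp s s' f (U : V -> V) : ap s' f -> (forall i, ap s (fun z => U z 0 i)) ->
  (forall z, l1im z <= s -> l1im (z + U z) <= s') -> ap s (fun z => f (z + U z)).
Proof.
move=> hf hU hS; apply: ap_lim => e /hf[p hp].
exists (fun z => tev p (z + U z)); first exact: ap_tev_comp.
by move=> z /hS hz; exact: hp.
Qed.

Lemma ap_mulmx m (s : R) (X : V -> 'M[C]_(m, n)) (Y : V -> 'M[C]_n) i j :
  (forall i j, ap s (fun z => X z i j)) -> (forall i j, ap s (fun z => Y z i j)) ->
  ap s (fun z => (X z *m Y z) i j).
Proof.
move=> hX hY.
have H : ap s (fun z => \sum_(k < n) X z i k * Y z k j).
  by apply: ap_sum => k; apply: apM.
by apply: ap_ext H => z _; rewrite mxE.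
Qed.

Lemma ap_invmx s (M : V -> 'M[C]_n) m :
  (forall i j, ap s (fun z => M z i j)) ->
  (forall z, l1im z <= s -> forall i j, nc ((M z - 1%:M) i j) <= m) ->
  n%:R * m <= 1 / 2 ->
  forall i j, ap s (fun z => invmx (M z) i j).
Proof.
move=> hM hb hm i j; apply: ap_lim => e e0.
have [q hq] : exists q : nat, 2 * (1 / 2) ^+ q <= e.
  have [q hq] : exists q : nat, 2 / e < q%:R.
    by exists (Num.bound `|2 / e|); apply: le_lt_trans (ler_norm _) (archi_boundP (normr_ge0 _)).
  exists q; rewrite expr_div_n expr1n mulrA mulr1 ler_pdivrMr ?exprn_gt0 //.
  have : q%:R <= 2 ^+ q :> R by rewrite -natrX ler_nat ltnW // ltn_expl.
  by rewrite -ler_pdivrMl // mulrC; lra.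
exists (fun z => neumann (M z) q i j).
  elim: q {hq} i j => [|q IH] i j /=.
    by apply: ap_ext (ap_cst s 0) => z _; rewrite mxE.
  have H : ap s (fun z => (1%:M : 'M[C]_n) i j + (neumann (M z) q *m (1%:M - M z)) i j).
    apply: apD; first exact: ap_cst.
    apply: ap_mulmx => // i' j'.
    have H : ap s (fun z => (1%:M : 'M[C]_n) i' j' - M z i' j').
      by apply: apB => //; exact: ap_cst.
    by apply: ap_ext H => z _; rewrite !mxE.
  by apply: ap_ext H => z _; rewrite [RHS]mxE.
move=> z hz; apply: le_trans hq; apply: le_trans (neumannP (hb z hz) hm q i).
by have := le_rsum (invmx (M z) - neumann (M z) q) i j; rewrite !mxE.
Qed.

End TrigClass.

(** * Fourier coefficients *)

Section Fourier.
Context {R : realType} {n : nat}.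
Local Notation C := R[i].
Local Notation V := 'rV[C]_n.
Local Notation K := 'rV[int]_n.
Implicit Types (k l : K) (z w : V) (s e : R) (f g : V -> C) (p q : seq (K * C)).
Implicit Types (c d : K -> C).

Lemma expi_neq1 (t : R) : 0 < `|t| -> `|t| < 2 * pi -> expi t != 1.
Proof.
move=> t0 t2; apply/eqP => -[ct _].
have {}ct : cos `|t| = 1 by case: (normrEsign t) => _; case: ger0P => _ //; rewrite cosN.
have sp : 0 < sin (`|t| / 2).
  by apply: sin_gt0_pi; rewrite divr_gt0 //= ltr_pdivrMr // mulrC.
have := cos2Dsin2 (`|t| / 2).
have : cos (`|t| / 2 + `|t| / 2) = 1 by rewrite -splitr.
rewrite cosD => h1 h2; have : sin (`|t| / 2) ^+ 2 = 0 by move: h1 h2; rewrite !expr2; lra.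
by move/eqP; rewrite sqrf_eq0 gt_eqF.
Qed.

Lemma expiX (t : R) m : expi (t * m%:R) = expi t ^+ m :> C.
Proof.
elim: m => [|m IH]; first by rewrite mulr0 expi0.
by rewrite -[m.+1%:R]natr1 mulrDr mulr1 expiD IH exprSr.
Qed.

Lemma expi_int (l : int) : expi (2 * pi * l%:~R) = 1 :> C.
Proof.
have e1 : expi (2 * pi) = 1 :> C by rewrite mulr_natl /expi cos2pi sin2pi.
case: l => m; first by rewrite -[m%:~R]/(m%:R) expiX e1 expr1n.
rewrite NegzE mulrNz mulrN -conj_expi -[m.+1%:~R]/(m.+1%:R) expiX e1 expr1n.
by rewrite -[1]/(cR 1) conj_cR.
Qed.

(** For [l != 0] the terms are the powers of an [m]-th root of unity, different from 1 because
    [|l| < m], and [x^m - 1] factors through their sum. *)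
Lemma geo_expi (l : int) m : (absz l < m)%N ->
  \sum_(j < m) expi (2 * pi * l%:~R / m%:R * j%:R) = (if l == 0 then m%:R else 0) :> C.
Proof.
move=> lm; have m0 : (0 < m)%N by apply: leq_ltn_trans lm.
have mR : 0 < m%:R :> R by rewrite ltr0n.
have E (j : 'I_m) : expi (2 * pi * l%:~R / m%:R * j%:R) = expi (2 * pi * l%:~R / m%:R) ^+ j :> C.
  exact: expiX.
rewrite (eq_bigr _ (fun j _ => E j)); case: eqP => [->|/eqP l0].
  rewrite (eq_bigr (fun=> 1)) => [|j _]; last by rewrite mulr0 mul0r expi0 expr1n.
  by rewrite sumr_const card_ord.
set x := expi _.
have x1 : x != 1.
  have lR : 0 < `|l%:~R : R| by rewrite normr_gt0 intr_eq0.
  have lmR : `|l%:~R : R| < m%:R by rewrite -intr_norm -natr_absz ltr_nat.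
  have p0 : 0 < 2 * pi :> R by rewrite mulr_gt0 // pi_gt0.
  have tE : `|2 * pi * l%:~R / m%:R| = 2 * pi * (`|l%:~R| / m%:R) :> R.
    by rewrite -mulrA normrM (gtr0_norm p0) normrM normfV (gtr0_norm mR).
  apply: expi_neq1; rewrite tE; first by rewrite mulr_gt0 ?divr_gt0.
  by rewrite -[ltRHS]mulr1 ltr_pM2l // ltr_pdivrMr // mul1r.
have xm : x ^+ m = 1.
  by rewrite /x -expiX divfK ?gt_eqF // expi_int.
have := subrX1 x m; rewrite xm subrr => /esym/eqP; rewrite mulf_eq0 subr_eq0 (negPf x1) /=.
by move/eqP.
Qed.

Definition grid m (F : {ffun 'I_n -> 'I_m}) : 'rV[R]_n := \row_i ((F i)%:R / m%:R).

Lemma sum_grid l m : (supn l < m)%N ->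
  \sum_(F : {ffun 'I_n -> 'I_m}) ek l (toC (grid F)) = (if l == 0 then m%:R ^+ n else 0).
Proof.
move=> lm.
transitivity (\sum_(F : {ffun 'I_n -> 'I_m})
   \prod_(i < n) (expi (2 * pi * (l 0 i)%:~R / m%:R * (F i)%:R) : C)).
  apply: eq_bigr => F _; rewrite ek_toC /dotp mulr_sumr.
  elim/big_rec2: _ => [|i y x _ <-]; first by rewrite expi0.
  by rewrite expiD !mxE; congr (expi _ * _); ring.
rewrite -(bigA_distr_bigA (fun i (j : 'I_m) =>
  expi (2 * pi * (l 0 i)%:~R / m%:R * j%:R) : C)).
rewrite (eq_bigr (fun i => if l 0 i == 0 then m%:R else 0)) => [|i _]; last first.
  by rewrite geo_expi //; apply: leq_ltn_trans (le_supn _ _) lm.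
case: eqP => [->|/eqP l0].
  rewrite (eq_bigr (fun=> m%:R)) => [|i _]; last by rewrite mxE eqxx.
  by rewrite prodr_const card_ord.
have [i li] : exists i, l 0 i != 0.
  apply/existsP; apply: contraNT l0 => /existsPn h; apply/eqP/rowP => i.
  by rewrite mxE; apply/eqP; move: (h i); rewrite negbK.
by rewrite (bigD1 i) //= (negPf li) mul0r.
Qed.

(** A list may contain the same frequency several times, hence a sum and not a lookup. *)
Definition tco p k : C := \sum_(t <- p | t.1 == k) t.2.

Lemma tco_cat p q k : tco (p ++ q) k = tco p k + tco q k.
Proof. by rewrite /tco big_cat. Qed.

Definition tneg p : seq (K * C) := [seq (t.1, - t.2) | t <- p].

Lemma tev_neg p z : tev (tneg p) z = - tev p z.
Proof. by rewrite /tev big_map -sumrN; apply: eq_bigr => t _; rewrite mulNr. Qed.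

Lemma tco_neg p k : tco (tneg p) k = - tco p k.
Proof. by rewrite /tco big_map -sumrN. Qed.

Lemma nc_natr m : nc (m%:R : C) = m%:R.
Proof.
have -> : m%:R = cR m%:R :> C by rewrite [RHS](_ : _ = (m%:R)%:C%C) // rmorph_nat.
by rewrite nc_cR ger0_norm.
Qed.

(** Quadrature on a regular grid is exact for a trigonometric polynomial once the mesh is finer than
    all the frequency differences. The complex translation [z] is free: this is the counterpart of
    moving the contour of integration. *)
Lemma tco_grid p k z : exists m, (0 < m)%N /\
  m%:R ^+ n * tco p k =
  \sum_(F : {ffun 'I_n -> 'I_m}) tev p (toC (grid F) + z) * ek (- k) (toC (grid F) + z).
Proof.
pose m := ((\max_(t <- p) supn t.1) + supn k).+1.
exists m; split => //.
under eq_bigr do rewrite /tev mulr_suml.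
rewrite exchange_big /= /tco mulr_sumr big_mkcond /=.
rewrite [LHS]big_seq [RHS]big_seq; apply: eq_bigr => t tp.
transitivity (t.2 * ek (t.1 - k) z *
   \sum_(F : {ffun 'I_n -> 'I_m}) ek (t.1 - k) (toC (grid F))).
  rewrite sum_grid; last first.
    rewrite ltnS; apply: leq_trans (supnD _ _) _; rewrite supnN leq_add2r.
    exact: leq_bigmax_seq.
  rewrite subr_eq0; case: eqP => [->|]; last by rewrite mulr0.
  by rewrite subrr ek0k mulr1 mulrC.
rewrite mulr_sumr; apply: eq_bigr => F _.
by rewrite !ekD !ekDk; ring.
Qed.

Definition wt s k : R := expR (- (2 * pi * s * (supn k)%:R)).

Lemma wt_gt0 s k : 0 < wt s k. Proof. exact: expR_gt0. Qed.

Lemma wt_ge0 s k : 0 <= wt s k. Proof. exact: expR_ge0. Qed.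

(** The whole width is spent on one coordinate where [|k_i| = |k|], with the sign that makes
    [ek (- k)] as small as possible. *)
Lemma extremal_point s k : 0 <= s -> exists z, l1im z <= s /\ nc (ek (- k) z) = wt s k.
Proof.
move=> s0; case: (eqVneq k 0) => [->|k0].
  exists 0; split; last by rewrite ek0 nc1 /wt supn0 mulr0 oppr0 expR0.
  by rewrite /l1im big1 // => i _; rewrite mxE normr0.
have [i /eqP ki] : exists i : 'I_n, absz (k 0 i) == supn k.
  apply/existsP; apply: contraT => /existsPn h.
  have : (supn k <= (supn k).-1)%N.
    rewrite supn_le; apply/forallP => i; have := h i; have := le_supn k i.
    by move: (absz (k 0%R i)) => j; lia.
  by move: k0; rewrite -supn_eq0; lia.
pose z : V := \row_j (if j == i then Complex 0 (- s * Num.sg (k 0 i)%:~R) else 0).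
exists z; split.
  rewrite /l1im (bigD1 i) //= big1 => [|j /negPf ji]; last by rewrite mxE ji normr0.
  rewrite mxE eqxx /= addr0 normrM normrN (ger0_norm s0) ler_piMr //.
  by rewrite normr_sg; case: eqP.
rewrite nc_ek Im_lin (bigD1 i) //= big1 => [|j /negPf ji]; last by rewrite !mxE ji mulr0.
rewrite !mxE eqxx /= addr0 /wt -ki natr_absz intr_norm; congr expR.
by rewrite normrEsg rmorphN /=; ring.
Qed.

(** Cauchy's estimate: the grid average is translated to the extremal point, where the factor
    [ek (- k)] has modulus [wt s k] at every grid point, real translations having no effect on
    it. *)
Lemma tco_bound s B p k : 0 <= s -> (forall z, l1im z <= s -> nc (tev p z) <= B) ->
  nc (tco p k) <= B * wt s k.
Proof.
move=> s0 hB; have [z [hz <-]] := extremal_point k s0.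
have [m [m0 E]] := tco_grid p k z.
have mR : 0 < m%:R ^+ n :> R by rewrite exprn_gt0 // ltr0n.
have : nc (m%:R ^+ n * tco p k) <= m%:R ^+ n * (B * nc (ek (- k) z)).
  rewrite E; apply: le_trans (nc_sum _ _ _) _.
  apply: (@le_trans _ _ (\sum_(F : {ffun 'I_n -> 'I_m}) B * nc (ek (- k) z))).
    apply: ler_sum => F _; rewrite ncM ekD ncM ek_toC nc_expi mul1r.
    rewrite ler_wpM2r ?nc_ge0 //; apply: hB.
    by apply: le_trans (l1imD _ _) _; rewrite l1im_toC add0r.
  by rewrite sumr_const card_ffun !card_ord -[leLHS]mulr_natl natrX.
by rewrite ncM ncX nc_natr ler_pM2l.
Qed.

(* [c] is the family of Fourier coefficients of [f], read off from its trigonometric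
   approximations; no integral is involved. *)
Definition fc s f c := forall e, 0 < e ->
  exists p, cl s e p f /\ forall k, nc (c k - tco p k) <= e * wt s k.

Lemma fc_ap s f c : fc s f c -> ap s f.
Proof. by move=> h e /h[p [hp _]]; exists p. Qed.

Lemma cl_dist s e e' p p' f k : 0 <= s -> cl s e p f -> cl s e' p' f ->
  nc (tco p k - tco p' k) <= (e + e') * wt s k.
Proof.
move=> s0 hp hp'; rewrite -tco_neg -tco_cat; apply: tco_bound => // z hz.
rewrite tev_cat tev_neg; apply: le_trans (nc_dist _ (f z) _) _.
by rewrite ncC; exact: lerD (hp z hz) (hp' z hz).
Qed.

(** Two approximations of [f] within [e] and [e'] have coefficients within [(e + e') * wt s k], by
    Cauchy's estimate for their difference. The coefficients therefore form a compatible system of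
    error bars. *)
Lemma fc_ex s f : 0 <= s -> ap s f -> exists c, fc s f c.
Proof.
move=> s0 hf.
have H k : exists x, forall e p, cl s e p f -> nc (x - tco p k) <= e * wt s k.
  have [||x hx] := @squeeze_exC R (fun e x => exists e' p,
     [/\ cl s e' p f, x = tco p k & e = e' * wt s k]).
  - move=> e e0; have e1 : 0 < e / wt s k by rewrite divr_gt0 ?wt_gt0.
    have [p hp] := hf _ e1; exists (tco p k), (e / wt s k), p; split=> //.
    by rewrite divfK // gt_eqF ?wt_gt0.
  - move=> _ _ _ _ [e [p [hp -> ->]]] [e' [p' [hp' -> ->]]].
    by rewrite -mulrDl; exact: cl_dist hp hp'.
  by exists x => e p hp; apply: hx; exists e, p.
have [c hc] := choice H.
by exists c => e /hf[p hp]; exists p; split=> // k; exact: hc.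
Qed.

Lemma fc_uniq s f c d : 0 <= s -> fc s f c -> fc s f d -> c = d.
Proof.
move=> s0 hc hd; apply/funext => k; apply/eqP; rewrite -subr_eq0; apply/eqP.
apply: nc_small => e e0.
have e1 : 0 < e / (4 * wt s k) by rewrite divr_gt0 ?mulr_gt0 ?wt_gt0.
have [p [hp pc]] := hc _ e1; have [q [hq qd]] := hd _ e1.
have h := cl_dist k s0 hp hq.
apply: le_trans (nc_dist _ (tco p k) _) _.
apply: le_trans (lerD (lexx _) (nc_dist _ (tco q k) _)) _.
have := pc k; have := qd k; rewrite [nc (d k - _)]ncC.
have : e / (4 * wt s k) * wt s k = e / 4 by field; rewrite gt_eqF ?wt_gt0.
by move: h; rewrite mulrDl; lra.
Qed.

Lemma fc_bound s B f c k : 0 <= s -> fc s f c ->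
  (forall z, l1im z <= s -> nc (f z) <= B) -> nc (c k) <= B * wt s k.
Proof.
move=> s0 hc hB; apply/ler_addgt0Pr => e e0.
have e1 : 0 < e / (2 * wt s k) by rewrite divr_gt0 ?mulr_gt0 ?wt_gt0.
have [p [hp pc]] := hc _ e1.
have : nc (tco p k) <= (B + e / (2 * wt s k)) * wt s k.
  apply: tco_bound => // z hz; rewrite -(subrK (f z) (tev p z)).
  apply: le_trans (ncD _ _) _; rewrite ncC addrC.
  exact: lerD (hB z hz) (hp z hz).
have := pc k; have := ncD (c k - tco p k) (tco p k); rewrite subrK.
have : e / (2 * wt s k) * wt s k = e / 2 by field; rewrite gt_eqF ?wt_gt0.
by rewrite mulrDl; lra.
Qed.

Lemma fcD s f g c d : fc s f c -> fc s g d ->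
  fc s (fun z => f z + g z) (fun k => c k + d k).
Proof.
move=> hf hg e e0; have e20 : 0 < e / 2 by rewrite divr_gt0.
have [p [hp pc]] := hf _ e20; have [q [hq qd]] := hg _ e20.
exists (p ++ q); split => [z hz|k].
  rewrite tev_cat opprD addrACA; apply: le_trans (ncD _ _) _.
  by have := hp z hz; have := hq z hz; lra.
rewrite tco_cat opprD addrACA; apply: le_trans (ncD _ _) _.
by have := pc k; have := qd k; lra.
Qed.

Lemma fcZ s f c (x : C) : fc s f c -> fc s (fun z => x * f z) (fun k => x * c k).
Proof.
move=> hf e e0; have e1 : 0 < e / (nc x + 1) by rewrite divr_gt0 // ltr_wpDl ?nc_ge0.
have x1 : nc x * (e / (nc x + 1)) <= e.
  rewrite mulrCA ler_piMr ?(ltW e0) // ler_pdivrMr ?ltr_wpDl ?nc_ge0 //; lra.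
have [p [hp pc]] := hf _ e1.
exists [seq (t.1, x * t.2) | t <- p].
have tE z : tev [seq (t.1, x * t.2) | t <- p] z = x * tev p z.
  by rewrite /tev big_map mulr_sumr; apply: eq_bigr => t _; rewrite mulrA.
split => [z hz|k].
  rewrite tE -mulrBr ncM; apply: le_trans x1.
  by rewrite ler_wpM2l ?nc_ge0 // hp.
have -> : tco [seq (t.1, x * t.2) | t <- p] k = x * tco p k.
  by rewrite /tco big_map mulr_sumr.
rewrite -mulrBr ncM; apply: le_trans (ler_wpM2r (wt_ge0 _ _) x1).
by rewrite -mulrA ler_wpM2l ?nc_ge0 // pc.
Qed.

Lemma fc_ext s f g c : (forall z, l1im z <= s -> f z = g z) -> fc s f c -> fc s g c.
Proof.
move=> fg hf e /hf[p [hp pc]]; exists p; split=> // z hz.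
by rewrite -fg //; exact: hp.
Qed.

(** Conjugating coefficients and reversing frequencies turns approximations of [f] into
    approximations of the same [f], by its symmetry; uniqueness of the coefficients concludes. *)
Lemma fc_real s f c k : 0 <= s -> fc s f c ->
  (forall z, l1im z <= s -> f (vconj z) = conjc (f z)) -> c (- k) = conjc (c k).
Proof.
move=> s0 hc fr.
have h : fc s f (fun k => conjc (c (- k))).
  move=> e e0; have [p [hp pc]] := hc _ e0.
  exists [seq (- t.1, conjc t.2) | t <- p].
  have tE z : tev [seq (- t.1, conjc t.2) | t <- p] z = conjc (tev p (vconj z)).
    rewrite /tev big_map conjc_sum; apply: eq_bigr => t _ /=.
    by rewrite conjcM conj_ek vconjK.
  split => [z hz|l].
    rewrite tE -(vconjK z) fr ?l1im_vconj // vconjK -conjcN -conjcD nc_conj.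
    by apply: hp; rewrite l1im_vconj.
  have -> : tco [seq (- t.1, conjc t.2) | t <- p] l = conjc (tco p (- l)).
    rewrite /tco big_map conjc_sum; apply: eq_bigl => t /=.
    by rewrite eqr_oppLR.
  by rewrite -conjcN -conjcD nc_conj; apply: le_trans (pc _) _; rewrite /wt supnN.
by have /(congr1 (fun F => F (- k))) := fc_uniq s0 hc h; rewrite opprK.
Qed.

(* A bound for [(1 + t) ^ m * exp (- x t)] on [t >= 0]. *)
Definition Pz (x : R) m : R := m`!%:R * expR x / x ^+ m.

Lemma Pz_gt0 x m : 0 < x -> 0 < Pz x m.
Proof. by move=> x0; rewrite divr_gt0 ?mulr_gt0 ?expR_gt0 ?exprn_gt0 ?ltr0n ?fact_gt0. Qed.

Lemma exprn_le_expR (x : R) m : 0 <= x -> x ^+ m <= m`!%:R * expR x.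
Proof.
move=> x0; case: m => [|m].
  by rewrite expr0 mul1r -expR0 ler_expR.
have := expR_ge1Dxn m x0.
rewrite -ler_pdivrMl ?ltr0n ?fact_gt0 // mulrC; lra.
Qed.

Lemma poly_decay (x : R) m (j : nat) : 0 < x ->
  (1 + j)%:R ^+ m * expR (- (x * j%:R)) <= Pz x m.
Proof.
move=> x0; rewrite expRN ler_pdivrMr ?expR_gt0 // /Pz mulrAC ler_pdivlMr ?exprn_gt0 //.
rewrite -exprMn -mulrA -expRD.
have -> : x + x * j%:R = (1 + j)%:R * x :> R by rewrite natrD; ring.
by apply: exprn_le_expR; rewrite mulr_ge0 // ltW.
Qed.

Lemma wt_decay (x : R) m k : 0 < x ->
  (1 + supn k)%:R ^+ m * wt x k <= Pz x (2 * n + m) * pw k.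
Proof.
move=> x0; rewrite /pw ler_pdivlMr ?exprn_gt0 ?ltr0n // mulrAC -exprD [(m + _)%N]addnC.
apply: le_trans (poly_decay _ (supn k) x0); rewrite ler_wpM2l ?exprn_ge0 //.
rewrite ler_expR lerN2 ler_wpM2r // ler_peMl ?(ltW x0) //.
have := @pi_ge2 R; lra.
Qed.

Lemma wtD s s' k : wt (s + s') k = wt s k * wt s' k.
Proof. by rewrite /wt -expRD; congr expR; ring. Qed.

Lemma nc_ek_wt s k z : l1im z <= s -> nc (ek k z) <= (wt s k)^-1.
Proof. by move=> hz; rewrite /wt expRN invrK nc_ek_le. Qed.

Lemma term_dom s x B c z m k : 0 < x -> l1im z <= s ->
  nc (c k) <= B * wt (s + x) k ->
  (1 + supn k)%:R ^+ m * nc (c k * ek k z) <= (B * Pz x (2 * n + m)) * pw k.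
Proof.
move=> x0 hz hc.
have B0 : 0 <= B by rewrite -(pmulr_lge0 _ (wt_gt0 (s + x) k)); apply: le_trans hc; exact: nc_ge0.
have h : nc (c k * ek k z) <= B * wt x k.
  rewrite ncM; apply: le_trans (ler_pM _ _ hc (nc_ek_wt _ hz)) _; rewrite ?nc_ge0 //.
  by rewrite wtD -mulrA [X in _ * X]mulrAC mulfV ?gt_eqF ?wt_gt0 // mul1r.
apply: (@le_trans _ _ ((1 + supn k)%:R ^+ m * (B * wt x k))).
  by rewrite ler_wpM2l ?exprn_ge0.
by rewrite mulrCA -mulrA ler_wpM2l // wt_decay.
Qed.

Lemma ser_dom s x B c z : 0 < x -> l1im z <= s ->
  (forall k, nc (c k) <= B * wt (s + x) k) ->
  dom (fun k => c k * ek k z) (B * Pz x (2 * n)).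
Proof.
move=> x0 hz hc k; have := term_dom 0 x0 hz (hc k).
by rewrite expr0 mul1r addn0.
Qed.

Definition ser c z : C := tsum (fun k => c k * ek k z).

Lemma tev_ser p z : tev p z = ser (tco p) z /\ exists B, dom (fun k => tco p k * ek k z) B.
Proof.
pose N := \max_(t <- p) supn t.1.
have h k : (N < supn k)%N -> tco p k * ek k z = 0.
  move=> hk; rewrite /tco big_seq_cond big1 ?mul0r // => t /andP[tp /eqP tk].
  by have := @leq_bigmax_seq _ p xpredT (fun t => supn t.1) t tp isT; rewrite tk leqNgt hk.
have [dm E] := tsum_fin h; split => //.
rewrite /ser E /Sbox /tco; under eq_bigr do rewrite mulr_suml big_mkcond.
rewrite exchange_big /=; rewrite /tev [LHS]big_seq [RHS]big_seq.
apply: eq_bigr => t tp; rewrite (bigD1_seq t.1) ?box_uniq //=; last first.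
  by rewrite mem_box; exact: (@leq_bigmax_seq _ p xpredT (fun t => supn t.1) t tp isT).
by rewrite eqxx big1 ?addr0 // => k /negPf; rewrite eq_sym => ->.
Qed.

(** A margin [x] of width is given up to sum the series. An approximating polynomial is close to [f]
    in value and to [c] in coefficients, and the margin turns the second closeness into closeness of
    the sums. *)
Lemma fc_eval s x f c z : 0 <= s -> 0 < x -> fc (s + x) f c -> l1im z <= s ->
  f z = ser c z.
Proof.
move=> s0 x0 hc hz; have sx : s <= s + x by rewrite lerDl ltW.
have sx0 : 0 <= s + x := le_trans s0 sx.
have [B B0 hB] := ap_bnd (fc_ap hc).
have cB k := fc_bound k sx0 hc hB.
apply/eqP; rewrite -subr_eq0; apply/eqP/nc_small => e e0.
(* The two errors, in value and in coefficients, add up to the tolerance times this factor. *)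
pose D := 1 + Pz x (2 * n) * @Cn R n.
have D0 : 0 < D by rewrite addr_gt0 // mulr_gt0 ?Pz_gt0 ?Cn_gt0.
have e1 : 0 < e / D by rewrite divr_gt0.
have [p [hp pc]] := hc _ e1; have [tE [B' hB']] := tev_ser p z.
have h1 : nc (f z - tev p z) <= e / D by apply: hp; exact: le_trans sx.
have h2 : nc (ser c z - tev p z) <= e / D * Pz x (2 * n) * @Cn R n.
  rewrite tE /ser -(tsumB (ser_dom x0 hz cB) hB').
  rewrite (_ : (fun k => _) = (fun k => (c k - tco p k) * ek k z)); last first.
    by apply/funext => k; rewrite mulrBl.
  by apply: tsum_bound; exact: ser_dom x0 hz pc.
apply: le_trans (nc_dist _ (tev p z) _) _; rewrite [nc (tev p z - _)]ncC.
apply: le_trans (lerD h1 h2) _.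
rewrite le_eqVlt; apply/orP; left; apply/eqP.
by rewrite -mulrA -{1}[e / D]mulr1 -mulrDr divfK // gt_eqF.
Qed.

Lemma pw_le_Tl N k : (N < supn k)%N -> pw k <= @Tl R n N.
Proof.
move=> hk; rewrite /Tl; have := @le_pwbox R n (supn k).
rewrite /pwbox (box_split _ (ltnW hk)).
rewrite -[X in _ + X]big_filter [X in _ + X <= _](bigD1_seq k) /=;
  [|by rewrite mem_filter hk mem_box leqnn|by rewrite filter_uniq ?box_uniq].
rewrite big_filter_cond => h.
suff : 0 <= \sum_(i <- box (supn k) | (N < supn i)%N && (i != k)) pw i :> R by lra.
by apply: sumr_ge0 => i _; exact: pw_ge0.
Qed.

(** The truncations to boxes serve as approximations. Outside the box the coefficient must be small
    relative to [wt s k]: the margin [x] leaves a factor [pw k], which is below the tail [Tl N]. *)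
Lemma fc_ser s x B c : 0 <= s -> 0 < x -> (forall k, nc (c k) <= B * wt (s + x) k) ->
  fc s (ser c) c.
Proof.
move=> s0 x0 hc e e0.
have B0 : 0 <= B.
  by rewrite -(pmulr_lge0 _ (wt_gt0 (s + x) 0)); apply: le_trans (hc 0); exact: nc_ge0.
have [N hN] := @small_MTl R n (B * Pz x (2 * n)) _ e0.
have {}hN := hN _ (leqnn N).
exists [seq (k, c k) | k <- box N]; split => [z hz|k].
  have -> : tev [seq (k, c k) | k <- box N] z = Sbox N (fun k => c k * ek k z).
    by rewrite /tev big_map.
  by apply: le_trans (tsum_tail _ (ser_dom x0 hz hc)) hN.
rewrite /tco big_map /=; case: (leqP (supn k) N) => hk.
  rewrite -big_filter (_ : seq.filter _ _ = [:: k]).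
    by rewrite big_seq1 subrr nc0 mulr_ge0 ?wt_ge0 // ltW.
  apply: perm_small_eq => //; apply: uniq_perm; rewrite ?filter_uniq ?box_uniq // => l.
  by rewrite mem_filter inE mem_box; case: eqP => // ->.
rewrite big_seq_cond big1 => [|l /andP[]]; last first.
  by rewrite mem_box => hl /eqP lk; move: hl; rewrite lk leqNgt hk.
rewrite subr0; apply: le_trans (hc k) _; rewrite wtD mulrA.
rewrite [X in X <= _]mulrAC ler_wpM2r ?wt_ge0 //; apply: le_trans hN; rewrite -mulrA ler_wpM2l //.
have := wt_decay 0 k x0; rewrite expr0 mul1r addn0 => h; apply: le_trans h _.
by rewrite ler_wpM2l ?pw_le_Tl // ltW // Pz_gt0.
Qed.

End Fourier.

(** * Lipschitz and Taylor estimates for Fourier series *)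

Section Series.
Context {R : realType} {n : nat}.
Local Notation C := R[i].
Local Notation V := 'rV[C]_n.
Local Notation K := 'rV[int]_n.
Local Notation CN := (@Cn R n).
Implicit Types (k l : K) (z w : V) (s x b B : R).
Implicit Types (c d : K -> C) (j : 'I_n) (h : 'rV[R]_n).

Lemma pi2_ge0 : 0 <= 2 * pi :> R. Proof. by rewrite mulr_ge0 // pi_ge0. Qed.

Lemma ek_sub1 k w b : nc (lin k w) <= (supn k)%:R * b ->
  nc (ek k w - 1) <= 2 * (2 * pi * ((supn k)%:R * b)) * (wt b k)^-1.
Proof.
move=> h; apply: le_trans (nc_cexpB1 _) _; rewrite ncM nc_i (ger0_norm pi2_ge0).
have h2 : 2 * pi * nc (lin k w) <= 2 * pi * ((supn k)%:R * b) by rewrite ler_wpM2l ?pi2_ge0.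
apply: ler_pM; rewrite ?expR_ge0 ?mulr_ge0 ?pi_ge0 ?nc_ge0 //.
  by rewrite ler_pM2l.
by rewrite /wt expRN invrK ler_expR -[leRHS]mulrA [b * _]mulrC.
Qed.

(** Each term changes by a factor of order [|k| * b / wt b k]. The margin [b0 >= b] absorbs the
    exponential growth, and [x] pays for the factor [|k|] and for the summation. The displacement is
    measured through [lin] so that both a sup bound and a purely imaginary displacement are
    covered. *)
Lemma ser_lip s b b0 x B c z w : 0 < x -> l1im z <= s -> 0 <= b -> b <= b0 ->
  (forall k, nc (lin k w) <= (supn k)%:R * b) ->
  (forall k, nc (c k) <= B * wt (s + b0 + x) k) ->
  nc (ser c (z + w) - ser c z) <= 4 * pi * b * (B * Pz x (2 * n + 1)) * CN.
Proof.
move=> x0 hz b_ge0 bb hw hc.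
have B0 : 0 <= B.
  by rewrite -(pmulr_lge0 _ (wt_gt0 (s + b0 + x) (0 : K))); apply: le_trans (hc 0); exact: nc_ge0.
have hcx k : nc (c k) <= B * wt (s + (b0 + x)) k by rewrite addrA.
have d1 : dom (fun k => c k * ek k z) (B * Pz (b0 + x) (2 * n)).
  by apply: ser_dom hz hcx; rewrite ltr_wpDl // (le_trans b_ge0).
have d2 : dom (fun k => c k * ek k z * (ek k w - 1)) (4 * pi * b * (B * Pz x (2 * n + 1))).
  move=> k; rewrite ncM (ncM (c k)).
  have h1 := nc_ek_wt k hz.
  have h2 : nc (ek k w - 1) <= 4 * pi * b * ((1 + supn k)%:R * (wt b0 k)^-1).
    apply: le_trans (ek_sub1 (hw k)) _.
    have -> : 2 * (2 * pi * ((supn k)%:R * b)) / wt b k =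
       4 * pi * b * ((supn k)%:R / wt b k) by ring.
    rewrite ler_wpM2l ?mulr_ge0 ?pi_ge0 //; apply: ler_pM => //.
    - by rewrite invr_ge0 wt_ge0.
    - by rewrite ler_nat leq_addl.
    rewrite lef_pV2 ?posrE ?wt_gt0 // ler_expR lerN2 ler_wpM2r //.
    by rewrite ler_wpM2l ?pi2_ge0.
  apply: (@le_trans _ _ ((B * wt (s + b0 + x) k) * (wt s k)^-1 *
     (4 * pi * b * ((1 + supn k)%:R * (wt b0 k)^-1)))).
    apply: ler_pM; rewrite ?mulr_ge0 ?nc_ge0 //.
    by apply: ler_pM; rewrite ?nc_ge0 ?hc.
  have -> : B * wt (s + b0 + x) k / wt s k * (4 * pi * b * ((1 + supn k)%:R / wt b0 k)) =
     4 * pi * b * B * ((1 + supn k)%:R ^+ 1 * wt x k).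
    rewrite !wtD expr1; field.
    by rewrite !gt_eqF ?wt_gt0.
  have := wt_decay 1 k x0; move: (Pz x _) (pw k) (wt x k) => P q u h.
  by rewrite -!mulrA; do 4 (rewrite ler_wpM2l ?pi_ge0 //).
have -> : ser c (z + w) - ser c z = tsum (fun k => c k * ek k z * (ek k w - 1)).
  have -> : ser c (z + w) = tsum (fun k => c k * ek k z + c k * ek k z * (ek k w - 1)).
    by congr tsum; apply/funext => k; rewrite ekD; ring.
  by rewrite (tsumD d1 d2) addrC addKr.
exact: tsum_bound.
Qed.

Lemma ser_bound s x B c z : 0 < x -> l1im z <= s ->
  (forall k, nc (c k) <= B * wt (s + x) k) ->
  nc (ser c z) <= B * Pz x (2 * n) * CN.
Proof. by move=> x0 hz hc; apply: tsum_bound; exact: ser_dom x0 hz hc. Qed.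

(* Second order expansions on the real torus need only polynomial decay. *)
Definition pdec m c B := forall k, (1 + supn k)%:R ^+ m * nc (c k) <= B * pw k.

Lemma pdec_ge0 m c B : pdec m c B -> 0 <= B.
Proof.
move=> h; rewrite -(pmulr_lge0 B (@pw_gt0 R n 0)); apply: le_trans (h 0).
by rewrite mulr_ge0 ?exprn_ge0 ?nc_ge0.
Qed.

Lemma pdec_le m m' c B : (m <= m')%N -> pdec m' c B -> pdec m c B.
Proof.
move=> mm h k; apply: le_trans (h k); rewrite ler_wpM2r ?nc_ge0 //.
by rewrite ler_weXn2l // ler1n.
Qed.

Lemma pdec_dom c B z : pdec 0 c B -> l1im z <= 0 -> dom (fun k => c k * ek k z) B.
Proof.
move=> h hz k; have := h k; rewrite expr0 mul1r ncM; apply: le_trans.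
rewrite ler_piMr ?nc_ge0 //; apply: le_trans (nc_ek_wt k hz) _.
by rewrite /wt mulr0 mul0r oppr0 expR0 invr1.
Qed.

(** The Fourier coefficients of the [j]-th partial derivative. *)
Definition dc j c : K -> C := fun k => Complex 0 (2 * pi * (k 0 j)%:~R) * c k.

Lemma nc_dc j c k : nc (dc j c k) <= 2 * pi * ((supn k)%:R * nc (c k)).
Proof.
rewrite ncM nc_i normrM (ger0_norm pi2_ge0) -[leLHS]mulrA ler_wpM2l ?pi2_ge0 //.
by rewrite ler_wpM2r ?nc_ge0 // normr_intr_le.
Qed.

Lemma dc_wt s x B c j : 0 < x -> (forall k, nc (c k) <= B * wt (s + x) k) ->
  forall k, nc (dc j c k) <= 2 * pi * B * Pz x 1 * wt s k.
Proof.
move=> x0 hc k.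
have B0 : 0 <= B.
  by rewrite -(pmulr_lge0 _ (wt_gt0 (s + x) (0 : K))); apply: le_trans (hc 0); exact: nc_ge0.
apply: le_trans (nc_dc _ _ _) _; 
have -> : 2 * pi * B * Pz x 1 * wt s k = 2 * pi * (B * Pz x 1 * wt s k) by ring.
rewrite ler_wpM2l ?pi2_ge0 //.
apply: (@le_trans _ _ ((1 + supn k)%:R * (B * wt (s + x) k))).
  by apply: ler_pM; rewrite ?nc_ge0 ?ler_nat ?leq_addl.
rewrite wtD.
have -> : (1 + supn k)%:R * (B * (wt s k * wt x k)) =
  B * wt s k * ((1 + supn k)%:R * wt x k) by ring.
have -> : B * Pz x 1 * wt s k = B * wt s k * Pz x 1 by ring.
rewrite ler_wpM2l ?mulr_ge0 ?wt_ge0 //.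
apply: le_trans (poly_decay 1 (supn k) x0); rewrite expr1 ler_wpM2l //.
rewrite ler_expR lerN2 ler_wpM2r // ler_peMl ?(ltW x0) //.
have := @pi_ge2 R; lra.
Qed.

Lemma pdec_dc m j c B : pdec m.+1 c B -> pdec m (dc j c) (2 * pi * B).
Proof.
move=> h k; apply: (@le_trans _ _ (2 * pi * ((1 + supn k)%:R ^+ m.+1 * nc (c k)))).
  have -> : 2 * pi * ((1 + supn k)%:R ^+ m.+1 * nc (c k)) =
     (1 + supn k)%:R ^+ m * (2 * pi * ((1 + supn k)%:R * nc (c k))) by rewrite exprS; ring.
  rewrite ler_wpM2l ?exprn_ge0 //.
  apply: le_trans (nc_dc _ _ _) _; rewrite ler_wpM2l ?pi2_ge0 //.
  by rewrite ler_wpM2r ?nc_ge0 // ler_nat leq_addl.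
by rewrite -[leRHS]mulrA ler_wpM2l ?pi2_ge0.
Qed.

Lemma dc_lin c k h : \sum_j cR (h 0 j) * dc j c k = Complex 0 (2 * pi) * lin k (toC h) * c k.
Proof.
rewrite /lin mulr_sumr mulr_suml; apply: eq_bigr => j _.
rewrite mxE /dc mulrA; congr (_ * _).
by rewrite /cR; simpc; congr Complex; ring.
Qed.

Lemma normr_le_mx h j : `|h 0 j| <= `|h|.
Proof.
rewrite [leRHS]mx_normrE.
exact: (@le_bigmax _ _ _ 0 (fun ij : 'I_1 * 'I_n => `|h ij.1 ij.2|) (0, j)).
Qed.

Lemma mx_normr_le h b : 0 <= b -> (forall j, `|h 0 j| <= b) -> `|h| <= b.
Proof.
move=> b0 hb; rewrite [leLHS]mx_normrE; apply: bigmax_le => // -[i j] _ /=.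
by rewrite (ord1 i).
Qed.

Lemma nc_lin_toC k h : nc (lin k (toC h)) <= (supn k)%:R * (n%:R * `|h|).
Proof.
rewrite mulrCA; apply: nc_lin_le => i; rewrite mxE nc_cR; exact: normr_le_mx.
Qed.

Lemma dom_dc_lin B c y h : pdec 1 c B ->
  (forall j, dom (fun k => dc j c k * ek k (toC y)) (2 * pi * B)) /\
  tsum (fun k => Complex 0 (2 * pi) * lin k (toC h) * (c k * ek k (toC y))) =
  \sum_j cR (h 0 j) * ser (dc j c) (toC y).
Proof.
move=> hc.
have hd j : dom (fun k => dc j c k * ek k (toC y)) (2 * pi * B).
  by apply: pdec_dom; [exact: pdec_dc | rewrite l1im_toC].
split => //.
have hdz j : dom (fun k => cR (h 0 j) * (dc j c k * ek k (toC y))) (`|h| * (2 * pi * B)).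
  apply: dom_leB (domZ _ (hd j)) _; rewrite nc_cR ler_wpM2r ?normr_le_mx //.
  by rewrite mulr_ge0 ?pi2_ge0 // (pdec_ge0 hc).
have [_ E] := tsum_sum (index_enum 'I_n) hdz.
rewrite (eq_bigr (fun j => tsum (fun k => cR (h 0 j) * (dc j c k * ek k (toC y))))); last first.
  by move=> j _; rewrite (tsumZ _ (hd j)).
rewrite -E; congr tsum; apply/funext => k.
rewrite mulrA -dc_lin mulr_suml; apply: eq_bigr => j _.
by rewrite mulrA.
Qed.

(** Termwise, [expi u - 1 - i u] is at most [2 u^2] with [|u| <= 2 pi n |k| |h|]; the two powers of
    [|k|] are what the decay of order 2 pays for. *)
Lemma ser_taylor B c y h : pdec 2 c B ->
  nc (ser c (toC (y + h)) - ser c (toC y) - \sum_j cR (h 0 j) * ser (dc j c) (toC y))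
    <= 2 * (2 * pi * n%:R) ^+ 2 * B * CN * `|h| ^+ 2.
Proof.
move=> hc; have [hd <-] := dom_dc_lin y h (pdec_le (isT : (1 <= 2)%N) hc).
have h0 := pdec_le (isT : (0 <= 2)%N) hc.
have d1 : dom (fun k => c k * ek k (toC (y + h))) B by apply: pdec_dom; rewrite ?l1im_toC.
have d2 : dom (fun k => c k * ek k (toC y)) B by apply: pdec_dom; rewrite ?l1im_toC.
have tl k : nc (c k * ek k (toC (y + h)) - c k * ek k (toC y) -
     Complex 0 (2 * pi) * lin k (toC h) * (c k * ek k (toC y)))
   <= 2 * (2 * pi * n%:R) ^+ 2 * `|h| ^+ 2 * ((1 + supn k)%:R ^+ 2 * nc (c k)).
  have -> : c k * ek k (toC (y + h)) - c k * ek k (toC y) -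
     Complex 0 (2 * pi) * lin k (toC h) * (c k * ek k (toC y)) =
     c k * (ek k (toC y) * (ek k (toC h) - 1 - Complex 0 (2 * pi) * lin k (toC h))).
    by rewrite toCD ekD; ring.
  rewrite ncM (ncM (ek k _)) ek_toC nc_expi mul1r ek_toC lin_toC.
  have -> : Complex 0 (2 * pi) * cR (dotp (toR k) h) = Complex 0 (2 * pi * dotp (toR k) h).
    by rewrite /cR; simpc.
  set u := 2 * pi * _.
  have hu : `|u| <= 2 * pi * n%:R * `|h| * (1 + supn k)%:R.
    have -> : 2 * pi * n%:R * `|h| * (1 + supn k)%:R =
      2 * pi * ((1 + supn k)%:R * (n%:R * `|h|)) by ring.
    rewrite normrM (ger0_norm pi2_ge0) ler_wpM2l ?pi2_ge0 //.
    have := nc_lin_toC k h; rewrite lin_toC nc_cR => /le_trans; apply.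
    by rewrite ler_wpM2r ?mulr_ge0 // ler_nat leq_addl.
  have hu2 : u ^+ 2 <= (2 * pi * n%:R * `|h| * (1 + supn k)%:R) ^+ 2.
    rewrite -[u ^+ 2]real_normK ?num_real // lerXn2r ?nnegrE ?mulr_ge0 ?pi_ge0 //.
  rewrite mulrC; apply: (@le_trans _ _
     (2 * (2 * pi * n%:R * `|h| * (1 + supn k)%:R) ^+ 2 * nc (c k))).
    rewrite ler_wpM2r ?nc_ge0 //; apply: le_trans (nc_expiB1B u) _.
    by rewrite ler_pM2l.
  by rewrite !exprMn le_eqVlt; apply/orP; left; apply/eqP; ring.
pose A := 2 * (2 * pi * n%:R) ^+ 2 * `|h| ^+ 2.
have A0 : 0 <= A by rewrite /A !mulr_ge0 ?pi_ge0 ?sqr_ge0.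
have d3 : dom (fun k => c k * ek k (toC (y + h)) - c k * ek k (toC y) -
     Complex 0 (2 * pi) * lin k (toC h) * (c k * ek k (toC y))) (A * B).
  by move=> k; apply: le_trans (tl k) _; rewrite -[leRHS]mulrA ler_wpM2l //; exact: hc.
have d12 := domD d1 (domN d2).
(* The linear terms are dominated because they are the increments minus the remainders, both already
   dominated. *)
have d4 : dom (fun k => Complex 0 (2 * pi) * lin k (toC h) * (c k * ek k (toC y)))
    (A * B + (B + B)).
  move=> k; have := domD d3 d12 k; rewrite -(ncN (_ * (_ * _))); move: (d3 k) (d12 k) => e3 e12 _.
  have -> : - (Complex 0 (2 * pi) * lin k (toC h) * (c k * ek k (toC y))) =
    (c k * ek k (toC (y + h)) - c k * ek k (toC y) -
     Complex 0 (2 * pi) * lin k (toC h) * (c k * ek k (toC y))) -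
     (c k * ek k (toC (y + h)) - c k * ek k (toC y)) by ring.
  by apply: le_trans (ncB _ _) _; rewrite [leRHS]mulrDl; apply: lerD.
rewrite /ser -(tsumB d1 d2) -(tsumB d12 d4).
apply: le_trans (tsum_bound d3) _; rewrite /A.
by rewrite le_eqVlt; apply/orP; left; apply/eqP; ring.
Qed.

Lemma ser_lip_real B c y h : pdec 1 c B ->
  nc (ser c (toC (y + h)) - ser c (toC y)) <= 2 * pi * n%:R * B * CN * `|h|.
Proof.
move=> hc; have h0 := pdec_le (isT : (0 <= 1)%N) hc.
have d1 : dom (fun k => c k * ek k (toC (y + h))) B by apply: pdec_dom; rewrite ?l1im_toC.
have d2 : dom (fun k => c k * ek k (toC y)) B by apply: pdec_dom; rewrite ?l1im_toC.
pose A := 2 * pi * n%:R * `|h|.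
have A0 : 0 <= A by rewrite /A !mulr_ge0 ?pi_ge0.
have d3 : dom (fun k => c k * ek k (toC (y + h)) - c k * ek k (toC y)) (A * B).
  move=> k; rewrite -mulrBr toCD ekD -[X in _ - X]mulr1 -mulrBr.
  rewrite ncM (ncM (ek k _)) ek_toC nc_expi mul1r ek_toC.
  apply: (@le_trans _ _ (nc (c k) * (A * (1 + supn k)%:R))).
    rewrite ler_wpM2l ?nc_ge0 //; apply: le_trans (nc_expiB1 _) _.
    have -> : A * (1 + supn k)%:R = 2 * pi * ((1 + supn k)%:R * (n%:R * `|h|)).
      by rewrite /A; ring.
    rewrite normrM (ger0_norm pi2_ge0) ler_wpM2l ?pi2_ge0 //.
    have := nc_lin_toC k h; rewrite lin_toC nc_cR => /le_trans; apply.
    by rewrite ler_wpM2r ?mulr_ge0 // ler_nat leq_addl.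
  rewrite mulrCA -[leRHS]mulrA ler_wpM2l // mulrC.
  by have := hc k; rewrite expr1.
rewrite /ser -(tsumB d1 d2).
apply: le_trans (tsum_bound d3) _; rewrite /A.
by rewrite le_eqVlt; apply/orP; left; apply/eqP; ring.
Qed.

Lemma wt_pdec m x B c : 0 < x -> (forall k, nc (c k) <= B * wt x k) ->
  pdec m c (B * Pz x (2 * n + m)).
Proof.
move=> x0 hc k.
have B0 : 0 <= B.
  by rewrite -(pmulr_lge0 _ (wt_gt0 x (0 : K))); apply: le_trans (hc 0); exact: nc_ge0.
apply: (@le_trans _ _ ((1 + supn k)%:R ^+ m * (B * wt x k))).
  by rewrite ler_wpM2l ?exprn_ge0.
by rewrite mulrCA -mulrA ler_wpM2l // wt_decay.
Qed.

Lemma ser_conj c z B : dom (fun k => c k * ek k z) B ->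
  (forall k, c (- k) = conjc (c k)) -> ser c (vconj z) = conjc (ser c z).
Proof.
move=> d hc; rewrite -(tsum_conj d); congr tsum; apply/funext => k.
by rewrite conjcM -hc opprK conj_ek opprK.
Qed.

Lemma dc_real c j : (forall k, c (- k) = conjc (c k)) ->
  forall k, dc j c (- k) = conjc (dc j c k).
Proof.
move=> hc k; rewrite /dc conjcM -hc; congr (_ * _).
by rewrite mxE rmorphN /= mulrN.
Qed.

End Series.

(** * The linearized equation and the Newton step *)

Section Solve.
Context {R : realType} {n : nat}.
Local Notation C := R[i].
Local Notation V := 'rV[C]_n.
Local Notation K := 'rV[int]_n.
Implicit Types (k l : K) (z : V) (s E m : R).

Lemma fc_cst s (c : C) : fc s (fun=> c) (fun k : K => if k == 0 then c else 0).
Proof.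
move=> e e0; exists [:: (0, c)]; split => [z hz|k].
  by rewrite /tev big_seq1 /= ek0k mulr1 subrr nc0 ltW.
rewrite /tco big_cons big_nil /= [0 == k]eq_sym addr0.
by case: eqP => _; rewrite subrr nc0 mulr_ge0 ?wt_ge0 // ltW.
Qed.

Lemma fc_sum (I : Type) (r : seq I) s (f : I -> V -> C) (c : I -> K -> C) :
  (forall i, fc s (f i) (c i)) ->
  fc s (fun z => \sum_(i <- r) f i z) (fun k => \sum_(i <- r) c i k).
Proof.
move=> h; elim: r => [|i r IH].
  rewrite (_ : (fun k => _) = (fun k : K => if k == 0 then 0 else 0)); last first.
    by apply/funext => k; rewrite big_nil; case: eqP.
  by apply: fc_ext (fc_cst s 0) => z _; rewrite big_nil.
rewrite (_ : (fun k => _) = (fun k => c i k + \sum_(j <- r) c j k)); last first.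
  by apply/funext => k; rewrite big_cons.
by apply: fc_ext (fcD (h i) IH) => z _; rewrite big_cons.
Qed.

Lemma wt0 s : wt s (0 : K) = 1.
Proof. by rewrite /wt supn0 mulr0 oppr0 expR0. Qed.

Lemma conj_invmx (A : 'M[C]_n) : map_mx conjc (invmx A) = invmx (map_mx conjc A).
Proof. exact: (map_invmx (conjc : {rmorphism C -> C})). Qed.

Lemma conj_mulmx p q (A : 'M[C]_(p, n)) (B : 'M[C]_(n, q)) :
  map_mx conjc (A *m B) = map_mx conjc A *m map_mx conjc B.
Proof. exact: (map_mxM (conjc : {rmorphism C -> C})). Qed.

Lemma vconjN z : vconj (- z) = - vconj z.
Proof. by apply/rowP => i; rewrite !mxE conjcN. Qed.

(** The bound of [(e + dl) M^-1] relative to [E]: entries of the inverse are at most 2, there are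
    [n] terms, and [dl] adds [4 n^2 E] to the entries of [e]. *)
Definition cg : R := 2 * n%:R * (1 + 4 * n%:R ^+ 2).

Lemma cg_ge0 : 0 <= cg.
Proof. by rewrite /cg !mulr_ge0 // addr_ge0 // mulr_ge0 // sqr_ge0. Qed.

(* The constant [dl] is adjusted so that [(e + dl) M^-1] has zero mean. *)
Lemma solve_mean s E m (e : V -> V) (M : V -> 'M[C]_n) :
  0 <= s -> 0 <= E -> 0 <= m -> n%:R * m <= 1 / 4 ->
  (forall i, ap s (fun z => e z 0 i)) ->
  (forall i j, ap s (fun z => M z i j)) ->
  (forall z, l1im z <= s -> e (vconj z) = vconj (e z)) ->
  (forall z, l1im z <= s -> M (vconj z) = map_mx conjc (M z)) ->
  (forall z, l1im z <= s -> forall i, nc (e z 0 i) <= E) ->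
  (forall z, l1im z <= s -> forall i j, nc ((M z - 1%:M) i j) <= m) ->
  exists (dl : 'rV[R]_n) (g : 'I_n -> K -> C),
  [/\ forall i, `|dl 0 i| <= 4 * n%:R ^+ 2 * E,
      forall i k, nc (g i k) <= cg * E * wt s k,
      forall i, g i 0 = 0,
      forall i k, g i (- k) = conjc (g i k) &
      forall x z, 0 < x -> l1im z <= s - x -> 0 <= s - x ->
        (e z + toC dl) *m invmx (M z) = \row_i ser (g i) z].
Proof.
move=> s0 E0 m0 nm ape apM er Mr eE Mm.
have nm2 : n%:R * m <= 1 / 2 by lra.
have nm4 : n%:R * (2 * m) <= 1 / 2 by lra.
pose N z := invmx (M z).
have apN i j : ap s (fun z => N z i j) by exact: ap_invmx apM Mm nm2 i j.
have Nr z : l1im z <= s -> N (vconj z) = map_mx conjc (N z).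
  by move=> hz; rewrite /N Mr // conj_invmx.
have apeN i : ap s (fun z => (e z *m N z) 0 i).
  by apply: ap_mulmx => [i' j|//]; rewrite (ord1 i').
have /choice[v hv] : forall i, exists c, fc s (fun z => (e z *m N z) 0 i) c.
  by move=> i; exact: fc_ex.
have apN1 i j : ap s (fun z => (N z - 1%:M) i j).
  have H : ap s (fun z => N z i j - (1%:M : 'M[C]_n) i j).
    by apply: apB => //; exact: ap_cst.
  by apply: ap_ext H => z _; rewrite !mxE.
have /choice[Nd hNd] : forall ij : 'I_n * 'I_n, exists c,
    fc s (fun z => (N z - 1%:M) ij.1 ij.2) c.
  by move=> ij; exact: fc_ex.
(* [Nb] and [vb] are the means of [M^-1] and of [e M^-1]. Zero mean of [(e + dl) M^-1] reads
   [vb + dl Nb = 0], which is solvable because [Nb] inherits the closeness of [M^-1] to the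
   identity. *)
pose Nb : 'M[C]_n := 1%:M + \matrix_(i, j) Nd (i, j) 0.
pose vb : V := \row_i v i 0.
have real0 f c : fc s f c -> (forall z, l1im z <= s -> f (vconj z) = conjc (f z)) ->
    conjc (c 0) = c 0.
  by move=> h1 h2; rewrite -(fc_real 0 s0 h1 h2) oppr0.
have vbr : vconj vb = vb.
  apply/rowP => i; rewrite !mxE; apply: real0 (hv i) _ => z hz.
  by rewrite er // Nr // /vconj -conj_mulmx mxE.
have Nbr : map_mx conjc Nb = Nb.
  apply/matrixP => i j; rewrite !mxE conjcD; congr (_ + _).
    by case: (i == j); rewrite /= ?oppr0.
  apply: real0 (hNd (i, j)) _ => z hz /=.
  rewrite Nr // !mxE conjcD conjcN; congr (_ - _).
  by case: (i == j); rewrite /= ?oppr0.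
have Nbm i j : nc ((Nb - 1%:M) i j) <= 2 * m.
  have -> : (Nb - 1%:M) i j = Nd (i, j) 0 by rewrite /Nb addrC addKr mxE.
  have := @fc_bound _ _ s (2 * m) _ _ 0 s0 (hNd (i, j)); rewrite wt0 mulr1; apply.
  by move=> z hz; exact: nc_invB1 (Mm z hz) nm2 i j.
have Nbu := near1_unit Nbm nm4.
pose dlc : V := - (vb *m invmx Nb).
(* Both means are real by the symmetry of [e] and [M] under conjugation, so the adjustment is a
   genuine real vector. *)
have dlcr : vconj dlc = dlc.
  rewrite /dlc vconjN {1}/vconj conj_mulmx conj_invmx Nbr.
  by rewrite -[map_mx _ vb]/(vconj vb) vbr.
pose dl : 'rV[R]_n := \row_i complex.Re (dlc 0 i).
have dlE : toC dl = dlc.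
  apply/rowP => i; rewrite !mxE; apply/esym/conjc_fix.
  by have /rowP/(_ i) := dlcr; rewrite !mxE.
have eNb z i : l1im z <= s -> nc ((e z *m N z) 0 i) <= 2 * n%:R * E.
  move=> hz; apply: le_trans (@nc_mulmx _ _ _ _ _ 2 _ _ _) _; first by move=> k; exact: nc_inv (Mm z hz) nm2 k i.
  rewrite mulrC -mulrA ler_pM2l //; apply: rsum_le; exact: eE.
have vbb i : nc (vb 0 i) <= 2 * n%:R * E.
  rewrite mxE; have := @fc_bound _ _ s (2 * n%:R * E) _ _ 0 s0 (hv i).
  by rewrite wt0 mulr1; apply => z; exact: eNb.
have dlb i : nc (dlc 0 i) <= 4 * n%:R ^+ 2 * E.
  rewrite /dlc mxE ncN; apply: le_trans (@nc_mulmx _ _ _ _ _ 2 _ _ _) _.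
    by move=> k; exact: nc_inv Nbm nm4 k i.
  have := rsum_le vbb; rewrite /=; lra.
have apg i : ap s (fun z => ((e z + toC dl) *m N z) 0 i).
  apply: ap_mulmx => [i' j|//]; rewrite (ord1 i').
  have H : ap s (fun z => e z 0 j + (toC dl) 0 j) by apply: apD => //; exact: ap_cst.
  by apply: ap_ext H => z _; rewrite [RHS]mxE.
have /choice[g hg] : forall i, exists c, fc s (fun z => ((e z + toC dl) *m N z) 0 i) c.
  by move=> i; exact: fc_ex.
exists dl, g; split.
- by move=> i; rewrite mxE; apply: le_trans (nc_Re _) _.
- move=> i k; apply: fc_bound (hg i) _ => // z hz.
  apply: le_trans (@nc_mulmx _ _ _ _ _ 2 _ _ _) _; first by move=> j; exact: nc_inv (Mm z hz) nm2 j i.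
  have h : forall j, nc ((e z + toC dl) 0 j) <= (1 + 4 * n%:R ^+ 2) * E.
    move=> j; rewrite mxE dlE; apply: le_trans (ncD _ _) _.
    by have := eE z hz j; have := dlb j; lra.
  by have := rsum_le h; rewrite /cg; lra.
- move=> i.
  (* The coefficients of [(e + dl) M^-1] are computed a second time by linearity; uniqueness then
     evaluates the mean as the left side of [vb + dl Nb = 0]. *)
  have H := fcD (hv i) (fcD (fc_cst s (dlc 0 i))
    (fc_sum (index_enum 'I_n) (fun j => fcZ (dlc 0 j) (hNd (j, i))))).
  have {H} H : fc s (fun z => ((e z + toC dl) *m N z) 0 i) _ := fc_ext _ H.
  have -> := fc_uniq s0 (hg i) (H _).
    rewrite eqxx.
    have /rowP/(_ i) : vb + dlc *m Nb = 0.
      by rewrite /dlc mulNmx mulmxKV // subrr.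
    have gen (a b : V) (B : 'M[C]_n) : (a + (b + b *m B)) 0 i =
      a 0 i + (b 0 i + \sum_j b 0 j * B j i) by rewrite !mxE.
    rewrite /Nb mulmxDr mulmx1 gen [X in _ = X]mxE => E1; rewrite -[RHS]E1.
    rewrite [vb 0 i]mxE; congr (_ + (_ + _)).
    by apply: eq_bigr => j _; congr (_ * _); rewrite mxE.
  move=> z hz; rewrite mulmxDl dlE [RHS]mxE; congr (_ + _).
  have -> : dlc *m N z = dlc + dlc *m (N z - 1%:M) by rewrite mulmxBr mulmx1 addrC subrK.
  by rewrite [RHS]mxE; congr (_ + _); rewrite mxE.
- move=> i k; apply: fc_real (hg i) _ => // z hz.
  rewrite er // Nr // -{1}(vconj_toC dl) -vconjD /vconj -conj_mulmx.
  by rewrite mxE.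
move=> x z x0 hz sx; apply/rowP => i; rewrite [RHS]mxE.
have hg' : fc (s - x + x) (fun z => ((e z + toC dl) *m N z) 0 i) (g i) by rewrite subrK.
exact: fc_eval sx x0 hg' hz.
Qed.

End Solve.

(** * The linearized equation with small divisors *)

Section Homological.
Context {R : realType} {n : nat}.
Local Notation C := R[i].
Local Notation V := 'rV[C]_n.
Local Notation K := 'rV[int]_n.
Local Notation CN := (@Cn R n).
Variables (omega : 'rV[R]_n) (s x t B P D Gam : R) (g : 'I_n -> K -> C).
Hypotheses (s0 : 0 <= s) (x0 : 0 < x) (t0 : 0 <= t) (B0 : 0 <= B) (Gam0 : 0 <= Gam).
Hypothesis div : forall k : K, k != 0 -> dotp (toR k) omega != 0 /\
  `|2 * pi * dotp (toR k) omega|^-1 <= Gam * (wt t k)^-1.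
Hypothesis gB : forall i k, nc (g i k) <= B * wt (s + x + x + t) k.
Hypothesis g0 : forall i, g i 0 = 0.
Hypothesis gr : forall i k, g i (- k) = conjc (g i k).
Hypothesis P1 : 1 <= P.
Hypotheses (Px1 : Pz x 1 <= P) (Px2 : Pz x (2 * n) <= P) (Px3 : Pz x (2 * n + 1) <= P).
Hypothesis hD : 8 * pi * CN * P ^+ 2 * (Gam * B) <= D.

(** Coefficientwise solution of [omega . Dw = - g]. At frequency 0, where the divisor vanishes, the
    equation holds because [g] has zero mean, and the free coefficient is set to 0. *)
Definition wc i k : C :=
  if k == 0 then 0 else - g i k / Complex 0 (2 * pi * dotp (toR k) omega).

Definition wf (z : V) : V := \row_i ser (wc i) z.

Definition Dwf (z : V) : 'M[C]_n := \matrix_(j, i) ser (dc j (wc i)) z.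

(** The divisor contributes at most [Gam / wt t k], so the division consumes exactly the width [t].
    Of the remaining width, one [x] is kept for differentiating and one for summing. *)
Lemma wcB i k : nc (wc i k) <= Gam * B * wt (s + x + x) k.
Proof.
rewrite /wc; case: eqP => [_|/eqP k0]; first by rewrite nc0 !mulr_ge0 ?wt_ge0.
rewrite ncM ncV nc_i ncN.
have [_ h] := div k0; have := ler_pM (nc_ge0 _) _ (gB i k) h; rewrite invr_ge0 => /(_ (normr_ge0 _)).
move/le_trans; apply; rewrite wtD le_eqVlt; apply/orP; left; apply/eqP; field.
by rewrite gt_eqF ?wt_gt0.
Qed.

Lemma wcr i k : wc i (- k) = conjc (wc i k).
Proof.
rewrite /wc oppr_eq0; case: eqP => _; first by rewrite /= oppr0.
rewrite conjcM conjcN -gr fmorphV; congr (_ * _^-1).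
have -> : dotp (toR (- k)) omega = - dotp (toR k) omega :> R.
  by rewrite /dotp -sumrN; apply: eq_bigr => j _; rewrite !mxE rmorphN mulNr.
by rewrite mulrN.
Qed.

Let GB : 0 <= Gam * B. Proof. exact: mulr_ge0. Qed.
Let CN0 : 0 <= CN. Proof. exact/ltW/Cn_gt0. Qed.
Let P0 : 0 <= P. Proof. exact: le_trans P1. Qed.

Lemma wcB1 i k : nc (wc i k) <= Gam * B * wt (s + x) k.
Proof.
apply: le_trans (wcB i k) _; rewrite ler_wpM2l // ler_expR lerN2 ler_wpM2r //.
by rewrite ler_wpM2l ?pi2_ge0 // lerDl ltW.
Qed.

Lemma ap_wf i : ap s (fun z => wf z 0 i).
Proof.
have H := fc_ap (fc_ser s0 x0 (wcB1 i)).
by apply: ap_ext H => z _; rewrite mxE.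
Qed.

Lemma ap_Dwf j i : ap s (fun z => Dwf z j i).
Proof.
have H := fc_ap (fc_ser s0 x0 (dc_wt j x0 (wcB i))).
by apply: ap_ext H => z _; rewrite mxE.
Qed.

Lemma pi_ge1 : 1 <= pi :> R. Proof. have := @pi_ge2 R; lra. Qed.

(** A single [D] has to bound [w], [Dw] and the growth of the imaginary part of [w]; their factors
    differ, but all lie below [8 pi P^2]. *)
Lemma le_D a : a <= 8 * pi * P ^+ 2 -> Gam * B * CN * a <= D.
Proof.
move=> ha; apply: le_trans hD.
have -> : 8 * pi * CN * P ^+ 2 * (Gam * B) = Gam * B * CN * (8 * pi * P ^+ 2) by ring.
by rewrite ler_wpM2l // mulr_ge0.
Qed.

Let pi1 := pi_ge1.
Let PP : P <= P ^+ 2. Proof. by rewrite expr2 ler_peMl. Qed.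
Let pP : P ^+ 2 <= pi * P ^+ 2. Proof. by rewrite ler_peMl // sqr_ge0. Qed.

Lemma wf_bound z i : l1im z <= s -> nc (wf z 0 i) <= D.
Proof.
move=> hz; rewrite mxE; apply: le_trans (ser_bound x0 hz (wcB1 i)) _.
rewrite mulrAC; apply: le_D.
apply: (le_trans Px2); apply: (le_trans PP); apply: (le_trans pP).
by rewrite -[leRHS]mulrA ler_peMl ?mulr_ge0 ?pi_ge0 ?sqr_ge0 //; lra.
Qed.

Lemma Dwf_bound z j i : l1im z <= s -> nc (Dwf z j i) <= D.
Proof.
move=> hz; rewrite mxE; apply: le_trans (ser_bound x0 hz (dc_wt j x0 (wcB i))) _.
have -> : 2 * pi * (Gam * B) * Pz x 1 * Pz x (2 * n) * CN =
  Gam * B * CN * (2 * pi * (Pz x 1 * Pz x (2 * n))) by ring.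
apply: le_D; rewrite -mulrA -[leRHS]mulrA; apply: ler_pM => //.
- by rewrite mulr_ge0 ?pi_ge0 // mulr_ge0 // ltW // Pz_gt0.
- by lra.
rewrite ler_wpM2l ?pi_ge0 // expr2; apply: ler_pM => //; exact/ltW/Pz_gt0.
Qed.

Lemma wf_conj z : l1im z <= s -> wf (vconj z) = vconj (wf z).
Proof.
move=> hz; apply/rowP => i; rewrite !mxE.
by rewrite (ser_conj (ser_dom x0 hz (wcB1 i))) // => k; exact: wcr.
Qed.

Lemma Dwf_conj z : l1im z <= s -> Dwf (vconj z) = map_mx conjc (Dwf z).
Proof.
move=> hz; apply/matrixP => j i; rewrite !mxE.
rewrite (ser_conj (ser_dom x0 hz (dc_wt j x0 (wcB i)))) //.
by apply: dc_real => k; exact: wcr.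
Qed.

(** [w] is real at real points, so its imaginary part at [z] is that of [w z - w (Re z)], an
    increment in a purely imaginary direction. The strip is therefore dilated by a factor and not
    widened by a constant, which is essential since the widths tend to 0. *)
Lemma wf_Im z i : l1im z <= s -> `|complex.Im (wf z 0 i)| <= D * l1im z.
Proof.
move=> hz; pose y : 'rV[R]_n := \row_j complex.Re (z 0 j).
have hy : l1im (toC y) <= 0 by rewrite l1im_toC.
have hys : l1im (toC y) <= s by rewrite l1im_toC.
have yr : complex.Im (wf (toC y) 0 i) = 0.
  have /rowP/(_ i) := wf_conj hys; rewrite vconj_toC [X in _ = X]mxE => /esym/conjc_fix ->.
  by [].
have -> : complex.Im (wf z 0 i) = complex.Im (wf z 0 i - wf (toC y) 0 i).
  by rewrite ImD ImN yr subr0.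
apply: le_trans (nc_Im _) _; rewrite !mxE.
have zE : z = toC y + (z - toC y) by rewrite addrC subrK.
have hl k : nc (lin k (z - toC y)) <= (supn k)%:R * l1im z.
  have -> : l1im z = l1im (z - toC y).
    by apply: eq_bigr => j _; rewrite !mxE ImD ImN /= subr0.
  by apply: nc_lin_l1 => j; rewrite !mxE ReD ReN /= subrr.
have cB k : nc (wc i k) <= Gam * B * wt (0 + s + x) k by rewrite add0r; exact: wcB1.
rewrite {1}zE; apply: le_trans (ser_lip x0 hy (l1im_ge0 z) hz hl cB) _.
have -> : 4 * pi * l1im z * (Gam * B * Pz x (2 * n + 1)) * CN =
   Gam * B * CN * (4 * pi * Pz x (2 * n + 1)) * l1im z by ring.
rewrite ler_wpM2r ?l1im_ge0 //; apply: le_D.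
apply: (@le_trans _ _ (4 * pi * P)); first by rewrite ler_wpM2l ?mulr_ge0 ?pi_ge0.
rewrite -!mulrA; have : pi * P <= pi * P ^+ 2 by rewrite ler_wpM2l ?pi_ge0.
have : 0 <= pi * P by rewrite mulr_ge0 ?pi_ge0.
by move: (pi * P) (pi * P ^+ 2) => u v; lra.
Qed.

Lemma wf_hom z : l1im z <= s -> toC omega *m Dwf z = - \row_i ser (g i) z.
Proof.
move=> hz; apply/rowP => i; rewrite !mxE.
have hd j := ser_dom x0 hz (dc_wt j x0 (wcB i)).
have hdj j : dom (fun k => cR (omega 0 j) * (dc j (wc i) k * ek k z))
    (`|omega| * (2 * pi * (Gam * B) * Pz x 1 * Pz x (2 * n))).
  apply: dom_leB (domZ _ (hd j)) _; rewrite nc_cR ler_wpM2r ?normr_le_mx //.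
  exact: dom_ge0 (hd j).
have [_ E] := tsum_sum (index_enum 'I_n) hdj.
have hg : dom (fun k => g i k * ek k z) (B * Pz (x + x + t) (2 * n)).
  apply: ser_dom hz _ => [|k]; first by rewrite ltr_wpDr // addr_gt0.
  by rewrite !addrA.
rewrite /ser -(tsumN hg) (eq_bigr (fun j => tsum (fun k => cR (omega 0 j) * (dc j (wc i) k * ek k z)))).
  rewrite -E; congr tsum; apply/funext => k.
  rewrite (eq_bigr (fun j => cR (omega 0 j) * dc j (wc i) k * ek k z)); last by move=> j _; rewrite mulrA.
  rewrite -mulr_suml dc_lin lin_toC -mulNr; congr (_ * _).
  rewrite /wc; case: eqP => [->|/eqP k0]; first by rewrite g0 mulr0 oppr0.
  have [d0 _] := div k0.
  have -> : Complex 0 (2 * pi) * cR (dotp (toR k) omega) = Complex 0 (2 * pi * dotp (toR k) omega).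
    by rewrite /cR; simpc.
  rewrite mulrC divfK //; rewrite eq_complex /= eqxx /= !mulf_eq0 (negPf d0) orbF.
  by rewrite pnatr_eq0 /= gt_eqF ?pi_gt0.
move=> j _; rewrite (tsumZ _ (hd j)) !mxE; congr (_ * _).
Qed.

(** The constant is left unspecified: it only has to be finite at each stage, to propagate the
    relation between displacement and Jacobian. *)
Lemma wf_taylor : exists Q, 0 <= Q /\ forall (y h : 'rV[R]_n) i,
  nc ((wf (toC (y + h)) - wf (toC y)) 0 i) <= Q * `|h| /\
  nc ((wf (toC (y + h)) - wf (toC y) - toC h *m Dwf (toC y)) 0 i) <= Q * `|h| ^+ 2.
Proof.
have sx : 0 < s + x by rewrite ltr_wpDl.
pose A m := Gam * B * Pz (s + x) (2 * n + m).
have A0 m : 0 <= A m by rewrite mulr_ge0 // ltW // Pz_gt0.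
have p2 m i := wt_pdec m sx (wcB1 i).
exists (2 * pi * n%:R * A 1%N * CN + 2 * (2 * pi * n%:R) ^+ 2 * A 2%N * CN).
have q1 : 0 <= 2 * pi * n%:R * A 1%N * CN.
  by apply: mulr_ge0 => //; apply: mulr_ge0 => //; rewrite mulr_ge0 ?pi2_ge0.
have q2 : 0 <= 2 * (2 * pi * n%:R) ^+ 2 * A 2%N * CN.
  by apply: mulr_ge0 => //; apply: mulr_ge0 => //; rewrite mulr_ge0 ?sqr_ge0.
split; first by rewrite addr_ge0.
move=> y h i; split.
  rewrite !mxE; apply: le_trans (ser_lip_real y h (p2 1%N i)) _.
  by rewrite ler_wpM2r // lerDl.
have -> : (wf (toC (y + h)) - wf (toC y) - toC h *m Dwf (toC y)) 0 i =
   ser (wc i) (toC (y + h)) - ser (wc i) (toC y) -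
    \sum_j cR (h 0 j) * ser (dc j (wc i)) (toC y).
  rewrite !mxE; congr (_ - _); apply: eq_bigr => j _.
  by rewrite !mxE.
apply: le_trans (ser_taylor y h (p2 2%N i)) _.
by rewrite ler_wpM2r ?sqr_ge0 // lerDr.
Qed.

End Homological.

Record kstate (R : realType) (n : nat) := KState {
  su : 'rV[R[i]]_n -> 'rV[R[i]]_n;
  sM : 'rV[R[i]]_n -> 'M[R[i]]_n;
  sl : 'rV[R]_n }.

(** * One Newton step *)

Section KamStep.
Context {R : realType} {n : nat}.
Local Notation C := R[i].
Local Notation V := 'rV[C]_n.
Local Notation K := 'rV[int]_n.
Local Notation CN := (@Cn R n).
Local Notation cgn := (@cg R n).
Implicit Types (st : kstate R n) (F : V -> V) (omega : 'rV[R]_n).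

(* The conjugacy defect of [z + su z], with [sM] standing for its Jacobian and [sl] for [lambda]. *)
Definition err omega F st z : V :=
  toC omega *m sM st z - toC omega - F (z + su st z) + toC (sl st).

(** [good_d] is what makes [sM] the Jacobian of [z + su z], with an unspecified constant and at real
    points only. [good_im] is a dilation of imaginary parts, so that the bounds of successive steps
    multiply. *)
Record good (s m eta b : R) st : Prop := Good {
  good_apu : forall i, ap s (fun z => su st z 0 i);
  good_apM : forall i j, ap s (fun z => sM st z i j);
  good_ru : forall z, l1im z <= s -> su st (vconj z) = vconj (su st z);
  good_rM : forall z, l1im z <= s -> sM st (vconj z) = map_mx conjc (sM st z);
  good_m : forall z, l1im z <= s -> forall i j, nc ((sM st z - 1%:M) i j) <= m;
  good_im : forall z, l1im z <= s -> l1im (z + su st z) <= (1 + eta) * l1im z;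
  good_d : exists Q, 0 <= Q /\ forall (y h : 'rV[R]_n) i,
    nc ((su st (toC (y + h)) - su st (toC y) -
         (toC h *m sM st (toC y) - toC h)) 0 i) <= Q * `|h| ^+ 2;
  good_b : forall z, l1im z <= s -> forall i, nc (su st z 0 i) <= b }.

Record trig F : Prop := Trig {
  trig_tev : forall i, exists p, forall z, F z 0 i = tev p z;
  trig_r : forall z, F (vconj z) = vconj (F z) }.

Lemma err_ap s m eta b omega F st : good s m eta b st -> trig F ->
  forall i, ap s (fun z => err omega F st z 0 i).
Proof.
move=> gs tF i; have [p hp] := trig_tev tF i.
have H : ap s (fun z => (toC omega *m sM st z) 0 i - toC omega 0 i
    - tev p (z + su st z) + toC (sl st) 0 i).
  apply: apD; last exact: ap_cst.
  apply: apB; last by apply: ap_tev_comp; exact: good_apu gs.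
  apply: apB; last exact: ap_cst.
  by apply: ap_mulmx => [i' j|]; [exact: ap_cst | exact: good_apM gs].
apply: ap_ext H => z _; rewrite -hp /err.
move: (toC omega *m sM st z) (F (z + su st z)) => v1 v2.
by rewrite !mxE.
Qed.

Lemma vconjB (z w : V) : vconj (z - w) = vconj z - vconj w.
Proof. by rewrite vconjD vconjN. Qed.

Lemma err_r s m eta b omega F st : good s m eta b st -> trig F ->
  forall z, l1im z <= s -> err omega F st (vconj z) = vconj (err omega F st z).
Proof.
move=> gs tF z hz; rewrite /err (good_rM gs hz) (good_ru gs hz) -vconjD (trig_r tF).
rewrite vconjD !vconjB !vconj_toC.
have -> // : vconj (toC omega *m sM st z) = toC omega *m map_mx conjc (sM st z).
by rewrite {1}/vconj conj_mulmx; congr (_ *m _); exact: vconj_toC.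
Qed.

(** The constant of [ser_lip] for a displacement with entries at most [D], for which [b = n * D]. *)
Definition Lam P : R := 4 * pi * n%:R * P * CN.

(** The width drops by [x + x + t]: [t] for the divisors, one [x] for the derivative of [w], one [x]
    for the convergence of its series. The two margins [x] also accommodate the displacement by [w]
    when [g] is compared at [z] and [z + w]. *)
Theorem kam_step omega F F' st (s x t E P Gam D m eta b d : R) :
  0 <= s -> 0 < x -> 0 <= t -> 0 <= E -> 0 <= Gam ->
  good (s + x + x + t) m eta b st ->
  (forall z, l1im z <= s + x + x + t -> forall i, nc (err omega F st z 0 i) <= E) ->
  trig F -> trig F' ->
  0 <= m -> n%:R * m <= 1 / 4 -> m <= 1 -> 0 <= b -> 0 <= eta ->
  (forall k : K, k != 0 -> dotp (toR k) omega != 0 /\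
    `|2 * pi * dotp (toR k) omega|^-1 <= Gam * (wt t k)^-1) ->
  1 <= P -> Pz x 1 <= P -> Pz x (2 * n) <= P -> Pz x (2 * n + 1) <= P ->
  8 * pi * CN * P ^+ 2 * (Gam * (cgn * E)) <= D ->
  n%:R * D * (1 + s) <= x ->
  (forall z, l1im z <= (1 + eta) * (1 + n%:R * D) * s ->
    forall i, nc ((F' z - F z) 0 i) <= d) ->
  exists st',
  [/\ good s (m + 2 * n%:R * D) ((1 + eta) * (1 + n%:R * D) - 1) (b + D) st',
      forall z, l1im z <= s -> forall i,
        nc (err omega F' st' z 0 i) <= 2 * n%:R * Lam P * D * cgn * E + d,
      forall i, `|(sl st' - sl st) 0 i| <= 4 * n%:R ^+ 2 * E &
      forall z, l1im z <= s -> forall i,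
        nc ((su st' z - su st z) 0 i) <= D + Lam P * D * b].
Proof.
move=> s0 x0 t0 E0 Gam0 gs hE tF tF' m0 nm m1 b0 eta0 div P1 Px1 Px2 Px3 hD nDx hd.
set S := s + x + x + t.
have sxS : s + x <= S by rewrite /S; lra.
have S0 : 0 <= S by rewrite /S; lra.
have eap := err_ap omega gs tF; have er := err_r omega gs tF.
have [dl [g [dlE gE g0 gr gev]]] := solve_mean S0 E0 m0 nm eap (good_apM gs) er
  (good_rM gs) hE (good_m gs).
have B0 : 0 <= cgn * E by rewrite mulr_ge0 // cg_ge0.
have CN0 : 0 <= CN by exact/ltW/Cn_gt0.
have P0 : 0 <= P by exact: le_trans P1.
have D0 : 0 <= D.
  by apply: le_trans hD; rewrite !mulr_ge0 // pi_ge0.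
have nD0 : 0 <= n%:R * D by rewrite mulr_ge0.
have nDs0 := mulr_ge0 nD0 s0.
(* The hypothesis on [n * D * (1 + s)] is two conditions in one: the displacement fits in the
   Lipschitz margin, and the dilated strip [(1 + n D) s] fits in [s + x]. *)
have nDx' : n%:R * D <= x by move: nDx; rewrite mulrDr mulr1; lra.
have nDs : n%:R * D * s <= x by move: nDx; rewrite mulrDr mulr1; lra.
have nm2 : n%:R * m <= 1 / 2 by lra.
have L0 : 0 <= Lam P by rewrite /Lam !mulr_ge0 // pi_ge0.
pose w := wf omega g; pose Dw := Dwf omega g.
have apw i := ap_wf s0 x0 B0 Gam0 div gE i.
have apDw j i := ap_Dwf s0 x0 B0 Gam0 div gE j i.
have wb z i := wf_bound x0 B0 Gam0 div gE P1 Px2 hD (z := z) i.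
have Dwb z j i := Dwf_bound x0 B0 Gam0 div gE Px1 Px2 hD (z := z) j i.
have wi z i := wf_Im s0 x0 B0 Gam0 div gE gr P1 Px3 hD (z := z) i.
have wr z := wf_conj x0 B0 Gam0 div gE gr (z := z).
have Dwr z := Dwf_conj x0 B0 Gam0 div gE gr (z := z).
have wh z := wf_hom x0 t0 B0 Gam0 div gE g0 (z := z).
have [Qw [Qw0 wq]] := wf_taylor s0 x0 B0 Gam0 div gE.
have zw z : l1im z <= s -> l1im (z + w z) <= (1 + n%:R * D) * l1im z.
  move=> hz; apply: le_trans (l1imD _ _) _; rewrite mulrDl mul1r lerD2l.
  apply: (@le_trans _ _ (\sum_(i < n) D * l1im z)); first by apply: ler_sum => i _; exact: wi.
  by rewrite sumr_const card_ord -(mulr_natl (_ * _)) mulrA.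
have zws z : l1im z <= s -> l1im (z + w z) <= s + x.
  move=> hz; apply: le_trans (zw z hz) _; rewrite mulrDl mul1r; apply: lerD => //.
  by apply: le_trans nDs; rewrite ler_wpM2l.
have zwS z : l1im z <= s -> l1im (z + w z) <= S by move=> /zws/le_trans; apply.
have sS : s <= S by rewrite /S -!addrA lerDl !addr_ge0 // ltW.
have lips c B z : 0 <= B -> (forall k, nc (c k) <= B * wt S k) ->
    l1im z <= s -> nc (ser c (z + w z) - ser c z) <= Lam P * D * B.
  move=> Bge hB hz.
  have cB k : nc (c k) <= B * wt (s + x + x) k.
    apply: le_trans (hB k) _; rewrite ler_wpM2l // ler_expR lerN2 ler_wpM2r //.
    by rewrite ler_wpM2l ?pi2_ge0 // /S lerDl.
  have hl k : nc (lin k (w z)) <= (supn k)%:R * (n%:R * D).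
    by rewrite mulrCA; apply: nc_lin_le => i; exact: wb.
  apply: le_trans (ser_lip x0 hz nD0 nDx' hl cB) _.
  have -> : 4 * pi * (n%:R * D) * (B * Pz x (2 * n + 1)) * CN =
     4 * pi * n%:R * CN * D * B * Pz x (2 * n + 1) by ring.
  have -> : Lam P * D * B = 4 * pi * n%:R * CN * D * B * P by rewrite /Lam; ring.
  by rewrite ler_wpM2l // !mulr_ge0 // pi_ge0.
have lipw f c B z : 0 <= B -> fc S f c -> (forall k, nc (c k) <= B * wt S k) ->
    l1im z <= s -> nc (f (z + w z) - f z) <= Lam P * D * B.
  move=> Bge hc hB hz.
  have hS : fc (s + x + (x + t)) f c by rewrite !addrA.
  have sx0 : 0 <= s + x by rewrite addr_ge0 // ltW.
  have xt0 : 0 < x + t by rewrite ltr_wpDr.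
  rewrite (fc_eval sx0 xt0 hS (zws z hz)) (fc_eval sx0 xt0 hS (le_trans hz _)); last first.
    by rewrite lerDl ltW.
  exact: lips.
pose u' z := w z + su st (z + w z).
pose M' z := (1%:M + Dw z) *m sM st (z + w z).
pose st' := KState u' M' (sl st + dl).
have gser z : l1im z <= s + x -> (err omega F st z + toC dl) *m invmx (sM st z) = \row_i ser (g i) z.
  move=> hz; have E1 : S - (x + t) = s + x by rewrite /S -[s + x + x + t]addrA addrK.
  by apply: (gev (x + t)); rewrite ?E1 // ?addr_ge0 ?(ltW x0) // ltr_wpDr.
have gM z : l1im z <= s + x -> (\row_i ser (g i) z) *m sM st z = err omega F st z + toC dl.
  move=> hz; rewrite -gser // mulmxKV //.
  by apply: near1_unit (good_m gs _) nm2; exact: le_trans sxS.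
have phi' z : z + u' z = z + w z + su st (z + w z) by rewrite /u' addrA.
have Mb y i j : l1im y <= S -> nc (sM st y i j) <= 2.
  move=> hy; have := good_m gs hy i j; rewrite !mxE => h.
  have -> : sM st y i j = sM st y i j - (i == j)%:R + (i == j)%:R by rewrite subrK.
  apply: le_trans (ncD _ _) _; have : nc (((i == j)%:R : C)) <= 1.
    by case: (i == j); rewrite ?nc1 ?nc0.
  have -> : (2 : R) = 1 + 1 by ring.
  by move=> h1; apply: lerD => //; exact: le_trans h m1.
exists st'; split => /=.
- split => /=.
  + move=> i.
    have H : ap s (fun z => w z 0 i + su st (z + w z) 0 i).
      apply: apD; first exact: apw.
      exact: (ap_comp (good_apu gs i) apw zwS).
    by apply: ap_ext H => z _; rewrite [RHS]mxE.
  + move=> i j; apply: ap_mulmx => i' j'.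
      have H : ap s (fun z => (1%:M : 'M[C]_n) i' j' + Dw z i' j').
        by apply: apD; [exact: ap_cst | exact: apDw].
      by apply: ap_ext H => z _; rewrite [RHS]mxE.
    exact: (ap_comp (good_apM gs i' j') apw zwS).
  + move=> z hz; rewrite /u' [w (vconj z)](wr _ hz) -[vconj (wf _ _ _)]/(vconj (w z)).
    by rewrite -vconjD (good_ru gs (zwS z hz)) vconjD.
  + move=> z hz; rewrite /M' [w (vconj z)](wr _ hz) -[vconj (wf _ _ _)]/(vconj (w z)).
    rewrite -vconjD (good_rM gs (zwS z hz)) conj_mulmx; congr (_ *m _).
    rewrite [Dw _](Dwr _ hz) -[Dwf _ _ _]/(Dw z).
    apply/matrixP => i j; rewrite !mxE conjcD; congr (_ + _).
    by case: (i == j); rewrite /= ?oppr0.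
  + move=> z hz i j.
    have -> : M' z - 1%:M = (sM st (z + w z) - 1%:M) + Dw z *m sM st (z + w z).
      by rewrite /M' mulmxDl mul1mx addrAC.
    rewrite mxE; apply: le_trans (ncD _ _) _; apply: lerD.
      by apply: (good_m gs); exact: zwS.
    apply: le_trans (@nc_mulmx _ _ _ _ _ 2 _ _ _) _; first by move=> k; exact: Mb (zwS z hz).
    have h : forall j', nc (Dw z i j') <= D by move=> j'; exact: Dwb.
    by have := rsum_le h; move: (rsum _ _) => q; clear; lra.
  + move=> z hz; rewrite phi'; apply: le_trans (good_im gs (zwS z hz)) _.
    have -> : 1 + ((1 + eta) * (1 + n%:R * D) - 1) = (1 + eta) * (1 + n%:R * D) by ring.
    by rewrite -[leRHS]mulrA ler_wpM2l ?zw // addr_ge0.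
  + have [Q [Q0 hQ]] := good_d gs.
    (* The old expansion is applied at the real point [y + w y] with the real increment [h'] of
       [y + w y]. Up to the Taylor remainder [r] of [w], [h'] equals [h (1 + Dw)], which produces
       the product rule for the new Jacobian. *)
    pose wR (y : 'rV[R]_n) : 'rV[R]_n := \row_i complex.Re (w (toC y) 0 i).
    have wRE y : toC (wR y) = w (toC y).
      apply/rowP => i; rewrite [LHS]mxE [wR y 0 i]mxE; apply/esym/conjc_fix.
      have := wr (toC y); rewrite l1im_toC vconj_toC => /(_ s0)/rowP/(_ i).
      by rewrite [X in _ = X]mxE => h; exact: esym h.
    exists (Q * (1 + Qw) ^+ 2 + 2 * n%:R * Qw); split.
      apply: addr_ge0; last by rewrite mulr_ge0 // mulr_ge0.
      by apply: mulr_ge0 => //; exact: sqr_ge0.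
    move=> y h i.
    pose h' := h + (wR (y + h) - wR y).
    pose Y := y + wR y.
    have YE : toC Y = toC y + w (toC y) by rewrite toCD wRE.
    have Yh : toC (Y + h') = toC (y + h) + w (toC (y + h)).
      rewrite -wRE -toCD; congr toC; rewrite /Y /h'.
      by rewrite addrACA; congr (_ + _); rewrite addrC subrK.
    pose r := w (toC (y + h)) - w (toC y) - toC h *m Dw (toC y).
    have h'E : toC h' = toC h + toC h *m Dw (toC y) + r.
      by rewrite /h' toCD toCB !wRE /r -addrA; congr (_ + _); rewrite addrC subrK.
    have hr j : nc (r 0 j) <= Qw * `|h| ^+ 2 by have [] := wq y h j.
    have hh' : `|h'| <= (1 + Qw) * `|h|.
      rewrite mulrDl mul1r; apply: le_trans (ler_normD _ _) _; rewrite lerD2l.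
      apply: mx_normr_le => [|j]; first by rewrite mulr_ge0.
      rewrite -nc_cR; have [q1 _] := wq y h j; apply: le_trans q1.
      have -> : cR ((wR (y + h) - wR y) 0 j) = (toC (wR (y + h) - wR y)) 0 j by rewrite [RHS]mxE.
      by rewrite toCB !wRE.
    have -> : u' (toC (y + h)) - u' (toC y) - (toC h *m M' (toC y) - toC h) =
       (su st (toC (Y + h')) - su st (toC Y) - (toC h' *m sM st (toC Y) - toC h')) +
       r *m sM st (toC Y).
      rewrite /u' /M' -Yh -YE.
      have wE : w (toC (y + h)) = toC h *m Dw (toC y) + r + w (toC y).
        by rewrite /r addrCA subrr addr0 subrK.
      have E1 A : toC h *m ((1%:M + Dw (toC y)) *m A) = toC h *m A + toC h *m Dw (toC y) *m A.
        by rewrite mulmxA mulmxDr mulmx1 mulmxDl.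
      have E2 A : toC h' *m A = toC h *m A + toC h *m Dw (toC y) *m A + r *m A.
        by rewrite h'E !mulmxDl.
      rewrite E1 E2 h'E wE.
      move: (su st (toC (Y + h'))) (su st (toC Y)) (toC h *m Dw (toC y) *m sM st (toC Y)) => a1 a2 a3.
      move: (toC h *m sM st (toC Y)) (r *m sM st (toC Y)) (toC h *m Dw (toC y)) => a4 a5 a6.
      move: (w (toC y)) (toC h) r {wE hr h'E E2} => a7 a8 a9.
      by apply/rowP => j; rewrite !mxE; ring.
    rewrite mxE; apply: le_trans (ncD _ _) _; rewrite [leRHS]mulrDl; apply: lerD.
      apply: le_trans (hQ Y h' i) _; rewrite -mulrA ler_wpM2l // -exprMn.
      by rewrite lerXn2r ?nnegrE ?mulr_ge0 // addr_ge0.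
    apply: le_trans (@nc_mulmx _ _ _ _ _ 2 _ _ _) _.
      by move=> k; apply: Mb; rewrite l1im_toC.
    by have := rsum_le hr; move: (rsum _ _) => q; clear; lra.
  + move=> z hz i; rewrite mxE; apply: le_trans (ncD _ _) _; rewrite addrC.
    by apply: lerD; [by apply: (good_b gs); exact: zwS | exact: wb].
- move=> z hz i.
  have -> : err omega F' st' z =
    ((\row_j ser (g j) (z + w z)) - \row_j ser (g j) z) *m sM st (z + w z)
    - (F' (z + u' z) - F (z + u' z)).
    have E1 A : toC omega *m ((1%:M + Dw z) *m A) = toC omega *m A - (\row_j ser (g j) z) *m A.
      by rewrite mulmxA mulmxDr mulmx1 [toC omega *m Dw z](wh z hz) mulmxDl mulNmx.
    rewrite mulmxBl gM ?zws // /err /= /M' E1 phi' toCD.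
    move: (toC omega *m sM st (z + w z)) (_ *m sM st (z + w z)) => a1 a2.
    move: (F' _) (F _) => a3 a4.
    by apply/rowP => j; rewrite !mxE; ring.
  rewrite mxE; apply: le_trans (ncD _ _) _; apply: lerD; last first.
    rewrite mxE ncN; apply: hd; rewrite phi'.
    apply: le_trans (good_im gs _) _; first exact: zwS.
    rewrite -mulrA; apply: ler_wpM2l; first by rewrite addr_ge0.
    by apply: le_trans (zw z hz) _; apply: ler_wpM2l => //; rewrite addr_ge0.
  apply: le_trans (@nc_mulmx _ _ _ _ _ 2 _ _ _) _; first by move=> k; exact: Mb (zwS z hz).
  have h : forall j, nc ((\row_j0 ser (g j0) (z + w z) - \row_j0 ser (g j0) z) 0 j) <=
      Lam P * D * (cgn * E).
    by move=> j; rewrite !mxE; apply: lips.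
  by have := rsum_le h; move: (rsum _ _) => q; clear; lra.
- by move=> i; rewrite addrC addKr; exact: dlE.
- move=> z hz i.
  have -> : (u' z - su st z) 0 i = w z 0 i + (su st (z + w z) 0 i - su st z 0 i).
    by rewrite !mxE addrA.
  apply: le_trans (ncD _ _) _; apply: lerD; first exact: wb.
  (* The Lipschitz bound of the old displacement is obtained by expanding it in Fourier series on
     the old, wider strip, where it is bounded by [b]. *)
  have [c hc] := fc_ex S0 (good_apu gs i).
  have cb k : nc (c k) <= b * wt S k.
    by apply: (fc_bound k S0 hc) => y hy; apply: (good_b gs); exact: hy.
  exact: (lipw _ c b z b0 hc cb hz).
Qed.

End KamStep.

(** * Iteration and convergence *)

Section Iteration.
Context {R : realType} {n : nat}.
Local Notation C := R[i].
Local Notation V := 'rV[C]_n.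
Local Notation K := 'rV[int]_n.
Local Notation CN := (@Cn R n).
Local Notation cgn := (@cg R n).
Implicit Types (st : kstate R n) (omega : 'rV[R]_n).

Definition FN (Fc : 'I_n -> K -> C) (N : nat) (z : V) : V :=
  \row_i tev [seq (k, Fc i k) | k <- box N] z.

Lemma trig_FN Fc N : (forall i k, conjc (Fc i k) = Fc i (- k)) -> trig (FN Fc N).
Proof.
move=> hr; split => [i|z].
  by exists [seq (k, Fc i k) | k <- box N] => z; rewrite mxE.
apply/rowP => i; rewrite !mxE /tev conjc_sum [LHS]big_map [RHS]big_map /=.
transitivity (\sum_(k <- [seq - l | l <- box N]) Fc i k * ek k (vconj z)).
  apply: perm_big; apply: uniq_perm; rewrite ?box_uniq //.
    by rewrite map_inj_uniq ?box_uniq //; exact: oppr_inj.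
  move=> k; rewrite mem_box; apply/idP/mapP => [h|[l]].
    by exists (- k); rewrite ?opprK // mem_box supnN.
  by rewrite mem_box => hl ->; rewrite supnN.
rewrite [LHS]big_map; apply: eq_bigr => k _ /=.
by rewrite conjcM conj_ek hr.
Qed.

Lemma good_le s m m' eta eta' b b' st : 0 <= s -> m <= m' -> eta <= eta' -> b <= b' ->
  good s m eta b st -> good s m' eta' b' st.
Proof.
move=> s0 mm ee bb [h1 h2 h3 h4 h5 h6 h7 h8]; split => //.
- by move=> z hz i j; apply: le_trans mm; exact: h5.
- move=> z hz; apply: le_trans (h6 z hz) _.
  by rewrite ler_wpM2r ?l1im_ge0 // lerD2l.
- by move=> z hz i; apply: le_trans bb; exact: h8.
Qed.

Definition st0 : kstate R n := KState (fun=> 0) (fun=> 1%:M) 0.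

Lemma good_st0 s : good s 0 0 0 st0.
Proof.
split => /=.
- by move=> i; apply: ap_ext (ap_cst s 0) => z _; rewrite mxE.
- by move=> i j; exact: ap_cst.
- by move=> z _; apply/rowP => i; rewrite !mxE conjc0.
- move=> z _; apply/matrixP => i j; rewrite !mxE.
  by case: (i == j); rewrite /= ?oppr0.
- by move=> z _ i j; rewrite subrr mxE nc0.
- by move=> z _; rewrite !addr0 mul1r.
- exists 0; split=> // y h i.
  by rewrite !mulmx1 !subrr mxE nc0 mul0r.
- by move=> z _ i; rewrite mxE nc0.
Qed.

(** Choice is applied to all pairs of a stage and a state, with the invariant as a premise; a state
    that violates it is sent to itself. *)
Lemma dep_choice (T : Type) (Inv : nat -> T -> Prop) (Rel : nat -> T -> T -> Prop) x0 :
  Inv 0%N x0 ->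
  (forall j x, Inv j x -> exists y, Inv j.+1 y /\ Rel j x y) ->
  exists f : nat -> T, f 0%N = x0 /\ forall j, Inv j (f j) /\ Rel j (f j) (f j.+1).
Proof.
move=> i0 h.
have /choice[F hF] : forall p : nat * T, exists y,
    Inv p.1 p.2 -> Inv p.1.+1 y /\ Rel p.1 p.2 y.
  move=> [j x] /=; have [/h[y hy]|hn] := pselect (Inv j x); first by exists y.
  by exists x.
pose f := fix f j := if j is j'.+1 then F (j', f j') else x0.
exists f; split=> // j.
have iv : Inv j (f j) by elim: j => //= j IH; have [] := hF (j, f j) IH.
by split=> //; have [] := hF (j, f j) iv.
Qed.

(** The next truncation is evaluated at [z + u+ z], whose imaginary part has been dilated by all the
    factors [1 + n D_i] so far. Their product stays below [expR (n * mu)], whence the enlarged strip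
    in the hypothesis on [d]. *)
Lemma kam_iter omega Fc (s x t P Gam E d : nat -> R) (mu : R) :
  let D j := 8 * pi * CN * P j ^+ 2 * (Gam j * (cgn * E j)) in
  (forall i k, conjc (Fc i k) = Fc i (- k)) ->
  (forall j, [/\ 0 <= s j, 0 < x j & 0 <= t j]) ->
  (forall j, [/\ 0 <= E j, 0 <= Gam j & 1 <= P j]) ->
  (forall j, s j = s j.+1 + x j + x j + t j) ->
  (forall j (k : K), k != 0 -> dotp (toR k) omega != 0 /\
    `|2 * pi * dotp (toR k) omega|^-1 <= Gam j * (wt (t j) k)^-1) ->
  (forall j, [/\ Pz (x j) 1 <= P j, Pz (x j) (2 * n) <= P j & Pz (x j) (2 * n + 1) <= P j]) ->
  (forall j, D j <= mu * (1 / 2) ^+ j.+1) ->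
  (forall j, n%:R * D j * (1 + s j.+1) <= x j) ->
  0 <= mu -> mu <= 1 -> n%:R * (2 * n%:R * mu) <= 1 / 4 -> 2 * n%:R * mu <= 1 ->
  (forall j z, l1im z <= expR (n%:R * mu) * s j.+1 -> forall i,
     nc ((FN Fc (2 ^ j.+1) z - FN Fc (2 ^ j) z) 0 i) <= d j) ->
  (forall j, 2 * n%:R * @Lam R n (P j) * D j * cgn * E j + d j <= E j.+1) ->
  (forall z, l1im z <= s 0%N -> forall i, nc (FN Fc 1 z 0 i) <= E 0%N) ->
  exists st : nat -> kstate R n,
  [/\ st 0%N = st0,
      forall j, good (s j) (2 * n%:R * mu) (expR (n%:R * mu) - 1) mu (st j),
      forall j z, l1im z <= s j -> forall i,
        nc (err omega (FN Fc (2 ^ j)) (st j) z 0 i) <= E j,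
      forall j i, `|(sl (st j.+1) - sl (st j)) 0 i| <= 4 * n%:R ^+ 2 * E j &
      forall j z, l1im z <= s j.+1 -> forall i,
        nc ((su (st j.+1) z - su (st j) z) 0 i) <= D j + @Lam R n (P j) * D j].
Proof.
move=> D hr hs hE sE div hP hD hx mu0 mu1 nmu mu2 hd hE' hE0.
(* The partial sums of the bounds [mu / 2^(i+1)] of the [D i]: they control the accumulated
   displacement and Jacobian, and exponentiated the accumulated dilation. *)
pose S j := mu * (1 - (1 / 2) ^+ j).
have hf j : 0 < (1 / 2 : R) ^+ j by rewrite exprn_gt0.
have S0 j : 0 <= S j.
  by rewrite mulr_ge0 // subr_ge0 exprn_ile1 //; lra.
have Smu j : S j <= mu by rewrite ler_piMr // gerBl ltW.
have SS j : S j + mu * (1 / 2) ^+ j.+1 = S j.+1.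
  by rewrite /S !exprS; field.
have n0 : 0 <= n%:R :> R by [].
have nS j : n%:R * S j <= n%:R * mu by rewrite ler_wpM2l.
have D0 j : 0 <= D j.
  have [e0 g0 p1] := hE j; rewrite /D mulr_ge0 //.
    by rewrite mulr_ge0 ?sqr_ge0 // mulr_ge0 ?(ltW (@Cn_gt0 R n)) // mulr_ge0 ?pi_ge0.
  by rewrite mulr_ge0 // mulr_ge0 ?cg_ge0.
pose Inv j st := good (s j) (2 * n%:R * S j) (expR (n%:R * S j) - 1) (S j) st /\
  forall z, l1im z <= s j -> forall i, nc (err omega (FN Fc (2 ^ j)) st z 0 i) <= E j.
pose Rel j st st' := (forall i, `|(sl st' - sl st) 0 i| <= 4 * n%:R ^+ 2 * E j) /\
  forall z, l1im z <= s j.+1 -> forall i,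
        nc ((su st' z - su st z) 0 i) <= D j + @Lam R n (P j) * D j.
have [||st [st00 hst]] := @dep_choice (kstate R n) Inv Rel st0.
- split.
    rewrite /S expr0 subrr mulr0 !mulr0 expR0 subrr; exact: good_st0.
  move=> z hz i; rewrite /err /= mulmx1 subrr sub0r !addr0.
  have -> : (- FN Fc (2 ^ 0) z + toC 0) 0 i = - (FN Fc 1 z 0 i).
    by rewrite !mxE cR0 addr0.
  by rewrite ncN; exact: hE0.
- move=> j st [gd he].
  have [s0 x0 t0] := hs j.+1; have [s0j x0j t0j] := hs j.
  have [E0 G0 P1] := hE j; have [p1 p2 p3] := hP j.
  rewrite (sE j) in gd he.
  have eta0 : 0 <= expR (n%:R * S j) - 1.
    by rewrite subr_ge0 -expR0 ler_expR mulr_ge0.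
  have nSm : n%:R * (2 * n%:R * S j) <= 1 / 4.
    apply: le_trans nmu; rewrite ler_wpM2l // ler_wpM2l // mulr_ge0 //.
  have S2 : 2 * n%:R * S j <= 1.
    by apply: le_trans mu2; rewrite ler_wpM2l // mulr_ge0.
  have nD : 1 + n%:R * D j <= expR (n%:R * (mu * (1 / 2) ^+ j.+1)).
    apply: le_trans (expR_ge1Dx _); rewrite lerD2l ler_wpM2l //; exact: hD.
  have e1 : expR (n%:R * S j) * (1 + n%:R * D j) <= expR (n%:R * S j.+1).
    by rewrite -SS [n%:R * (_ + _)]mulrDr expRD ler_wpM2l ?expR_ge0.
  have etaE : 1 + (expR (n%:R * S j) - 1) = expR (n%:R * S j) by rewrite addrC subrK.
  have hdj z : l1im z <= (1 + (expR (n%:R * S j) - 1)) * (1 + n%:R * D j) * s j.+1 ->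
      forall i, nc ((FN Fc (2 ^ j.+1) z - FN Fc (2 ^ j) z) 0 i) <= d j.
    move=> hz; apply: hd; apply: le_trans hz _; rewrite ler_wpM2r // etaE.
    by apply: le_trans e1 _; rewrite ler_expR.
  have mS0 : 0 <= 2 * n%:R * S j by rewrite mulr_ge0 // mulr_ge0.
  have [st' [g1 g2 g3 g4]] := kam_step s0 x0j t0j E0 G0 gd he (trig_FN _ hr) (trig_FN _ hr)
    mS0 nSm S2 (S0 j) eta0 (div j) P1 p1 p2 p3 (lexx _) (hx j) hdj.
  exists st'; split; split.
  + apply: good_le g1 => //.
    * by rewrite -SS [2 * n%:R * (S j + _)]mulrDr lerD2l; apply: ler_wpM2l;
        [exact: mulr_ge0 | exact: hD].
    * by rewrite etaE lerD2r.
    * by rewrite -SS lerD2l; exact: hD.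
  + by move=> z hz i; apply: le_trans (hE' j); exact: g2.
  + exact: g3.
  + move=> z hz i; apply: le_trans (g4 z hz i) _; rewrite lerD2l ler_piMr //.
      have P0 : 0 <= P j by exact: le_trans P1.
      apply: mulr_ge0; last exact: D0.
      apply: mulr_ge0; last exact/ltW/Cn_gt0.
      by apply: mulr_ge0 => //; apply: mulr_ge0 => //; rewrite mulr_ge0 ?pi_ge0.
    exact: le_trans (Smu j) mu1.
exists st; split => //.
- move=> j; have [[gd _] _] := hst j; have [s0j _ _] := hs j.
  apply: good_le gd => //.
    by rewrite ler_wpM2l // mulr_ge0.
  by rewrite lerD2r ler_expR.
- by move=> j; have [[_ he] _] := hst j.
- by move=> j; have [_ []] := hst j.
- by move=> j; have [_ []] := hst j.
Qed.

End Iteration.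

(** * Passage to the limit on the real torus *)

Section Limit.
Context {R : realType} {n : nat}.
Local Notation C := R[i].
Local Notation V := 'rV[C]_n.
Local Notation K := 'rV[int]_n.
Local Notation CN := (@Cn R n).
Implicit Types (st : kstate R n) (omega y h : 'rV[R]_n) (k : K).

Lemma half_gt0 j : 0 < (1 / 2 : R) ^+ j. Proof. by rewrite exprn_gt0. Qed.

Lemma half_small (B e : R) : 0 < e -> exists j0, forall j, (j0 <= j)%N -> B * (1 / 2) ^+ j <= e.
Proof.
move=> e0; have B1 : 0 < `|B| + 1 by rewrite ltr_wpDl.
exists (Num.bound (`|B| / e)) => j hj.
have h1 : `|B| / e < j%:R.
  by apply: lt_le_trans (archi_boundP _) _; rewrite ?divr_ge0 ?ler_nat // ltW.
have h2 : j%:R <= 2 ^+ j :> R by rewrite -natrX ler_nat ltnW // ltn_expl.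
apply: le_trans (ler_wpM2r (ltW (half_gt0 j)) (ler_norm B)) _.
rewrite expr_div_n expr1n mul1r ler_pdivrMr ?exprn_gt0 // -ler_pdivrMl // mulrC.
exact: ltW (lt_le_trans h1 h2).
Qed.

Lemma geo_dist (u : nat -> C) b : (forall j, nc (u j.+1 - u j) <= b * (1 / 2) ^+ j) ->
  forall j i, nc (u (j + i)%N - u j) <= 2 * b * ((1 / 2) ^+ j - (1 / 2) ^+ (j + i)).
Proof.
move=> hu j; elim=> [|i IH]; first by rewrite addn0 !subrr nc0 mulr0.
rewrite addnS; apply: le_trans (nc_dist _ (u (j + i)%N) _) _.
apply: le_trans (lerD (hu _) IH) _; rewrite le_eqVlt; apply/orP; left; apply/eqP.
by rewrite exprS; field.
Qed.

Lemma geo_lim (u : nat -> C) b : 0 <= b -> (forall j, nc (u j.+1 - u j) <= b * (1 / 2) ^+ j) ->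
  exists l, forall j, nc (l - u j) <= 2 * b * (1 / 2) ^+ j.
Proof.
move=> b0 hu; have gd := geo_dist hu.
have gd' j i : (j <= i)%N -> nc (u i - u j) <= 2 * b * (1 / 2) ^+ j.
  move=> ji; rewrite -(subnKC ji); apply: le_trans (gd j _) _.
  by rewrite ler_wpM2l ?mulr_ge0 // gerBl ltW // half_gt0.
have b20 j : 0 <= 2 * b * (1 / 2) ^+ j by rewrite mulr_ge0 ?mulr_ge0 // ltW // half_gt0.
have [||l hl] := @squeeze_exC R (fun e x => exists j, x = u j /\ e = 2 * b * (1 / 2) ^+ j
     \/ x = u j /\ 2 * b * (1 / 2) ^+ j <= e).
- move=> e /(half_small (2 * b))[j0 hj]; exists (u j0), j0; right; split=> //; exact: hj.
- have H e e' j i : 2 * b * (1 / 2) ^+ j <= e -> 2 * b * (1 / 2) ^+ i <= e' ->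
      nc (u j - u i) <= e + e'.
    move=> h1 h2; case: (leqP j i) => [/gd'|/ltnW/gd'] h3.
      rewrite ncC; apply: le_trans h3 _; apply: le_trans h1 _; rewrite lerDl.
      exact: le_trans (b20 i) h2.
    apply: le_trans h3 _; apply: le_trans h2 _; rewrite lerDr.
    exact: le_trans (b20 j) h1.
  move=> e e' x x' [j hj] [i hi].
  have [-> hj'] : x = u j /\ 2 * b * (1 / 2) ^+ j <= e by case: hj => -[-> // ->].
  have [-> hi'] : x' = u i /\ 2 * b * (1 / 2) ^+ i <= e' by case: hi => -[-> // ->].
  exact: H.
by exists l => j; apply: hl; exists j; left.
Qed.

(** Two linear terms with quadratic remainders differ by [O(t)] after division by [t]. This lets the
    carried Jacobian be identified, in the direction [omega], with the termwise derivative of a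
    Fourier series. *)
Lemma deriv_uniq (f : 'rV[R]_n -> C) y (v : 'rV[R]_n) (a b : C) Q Q' : 0 <= Q -> 0 <= Q' ->
  (forall t : R, 0 < t -> nc (f (y + t *: v) - f y - cR t * a) <= Q * t ^+ 2) ->
  (forall t : R, 0 < t -> nc (f (y + t *: v) - f y - cR t * b) <= Q' * t ^+ 2) ->
  a = b.
Proof.
move=> Q0 Q0' ha hb; apply/eqP; rewrite -subr_eq0; apply/eqP/nc_small => e e0.
have q1 : 0 < Q + Q' + 1 by rewrite ltr_wpDl // addr_ge0.
pose t := e / (Q + Q' + 1); have t0 : 0 < t by rewrite divr_gt0.
have : nc (cR t * (a - b)) <= (Q + Q') * t ^+ 2.
  have -> : cR t * (a - b) = (f (y + t *: v) - f y - cR t * b) - (f (y + t *: v) - f y - cR t * a).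
    by ring.
  by apply: le_trans (ncB _ _) _; rewrite mulrDl addrC; exact: lerD (ha _ t0) (hb _ t0).
rewrite ncM nc_cR gtr0_norm // expr2 mulrCA ler_pM2l // => h; apply: le_trans h _.
by rewrite /t mulrCA ler_piMr ?(ltW e0) // ler_pdivrMr // mul1r lerDl.
Qed.

Definition uR (G : 'I_n -> K -> C) y : 'rV[R]_n := \row_i complex.Re (ser (G i) (toC y)).

Lemma ser_real (c : K -> C) B y : pdec 0 c B -> (forall k, c (- k) = conjc (c k)) ->
  ser c (toC y) = cR (complex.Re (ser c (toC y))).
Proof.
move=> hc hr; apply: conjc_fix.
have hy : l1im (toC y) <= 0 by rewrite l1im_toC.
by rewrite -(ser_conj (pdec_dom hc hy) hr) vconj_toC.
Qed.

Lemma serB (c d : K -> C) B B' y : pdec 0 c B -> pdec 0 d B' ->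
  ser (fun k => c k - d k) (toC y) = ser c (toC y) - ser d (toC y).
Proof.
move=> hc hd; have hy : l1im (toC y) <= 0 by rewrite l1im_toC.
rewrite /ser -(tsumB (pdec_dom hc hy) (pdec_dom hd hy)); congr tsum.
by apply/funext => k; rewrite mulrBl.
Qed.

Lemma ser_pbound (c : K -> C) B y : pdec 0 c B -> nc (ser c (toC y)) <= B * CN.
Proof. by move=> hc; apply: tsum_bound; apply: pdec_dom; rewrite ?l1im_toC. Qed.

Lemma dcB j (c d : K -> C) : dc j (fun k => c k - d k) = (fun k => dc j c k - dc j d k).
Proof. by apply/funext => k; rewrite /dc mulrBr. Qed.

Lemma add_bounds (x1 x2 x3 x4 x5 x6 x7 c1 c2 c3 c4 t e : R) :
  x1 <= c1 -> x2 <= c2 -> x3 <= c3 -> x4 <= t -> x7 <= c4 ->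
  c1 + c2 + c3 + c4 <= e / 2 -> t <= e / 2 -> x5 <= x2 + x3 -> x6 <= x5 + x4 ->
  x1 + (x6 + x7) <= e.
Proof. lra. Qed.

(** The limit is taken coefficient by coefficient, so no common strip is required: it is enough that
    the increments have coefficients bounded by [2^-j] times one weight [W]. The decay of [W] of
    order 2 makes first derivatives and quadratic expansions pass to the limit on real points. *)
Lemma kam_limit omega (Fc : 'I_n -> K -> C) (st : nat -> kstate R n) (s E Del : nat -> R)
    (m eta b kap CW Eb FB : R) (W : K -> R) :
  st 0%N = st0 -> (forall j, 0 < s j) -> (forall j, s j.+1 <= s j) ->
  (forall j, good (s j) m eta b (st j)) ->
  (forall j z, l1im z <= s j -> forall i,
        nc (err omega (FN Fc (2 ^ j)) (st j) z 0 i) <= E j) ->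
  (forall j i, `|(sl (st j.+1) - sl (st j)) 0 i| <= 4 * n%:R ^+ 2 * E j) ->
  (forall j z, l1im z <= s j.+1 -> forall i,
        nc ((su (st j.+1) z - su (st j) z) 0 i) <= Del j) ->
  (forall j, E j <= Eb * (1 / 2) ^+ j) ->
  (forall j k, Del j * wt (s j.+1) k <= kap * (1 / 2) ^+ j * W k) ->
  0 <= kap -> 0 <= CW -> 0 <= Eb -> (forall k, 0 <= W k) ->
  (forall k, (1 + supn k)%:R ^+ 2 * W k <= CW * pw k) ->
  (forall i, pdec 1 (Fc i) FB) ->
  exists (G : 'I_n -> K -> C) (lam : 'rV[R]_n),
  [/\ forall i k, nc (G i k) <= 2 * kap * W k,
      forall i k, G i (- k) = conjc (G i k),
      forall i, `|lam 0 i| <= 8 * n%:R ^+ 2 * Eb &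
      forall y i, \sum_l cR (omega 0 l) * ser (dc l (G i)) (toC y) =
        ser (Fc i) (toC (y + uR G y)) - cR (lam 0 i)].
Proof.
move=> st00 s0 sS gd he hl hD hE hW kap0 CW0 Eb0 W0 WC hF.
have ap1 j i : ap (s j.+1) (fun z => (su (st j.+1) z - su (st j) z) 0 i).
  have H := apB (good_apu (gd j.+1) i) (ap_mono (sS j) (good_apu (gd j) i)).
  by apply: ap_ext H => z _; rewrite !mxE.
have /choice[c hc] : forall p : nat * 'I_n, exists c,
    fc (s p.1.+1) (fun z => (su (st p.1.+1) z - su (st p.1) z) 0 p.2) c.
  by move=> [j i]; apply: fc_ex => //; exact/ltW/s0.
have cb j i k : nc (c (j, i) k) <= kap * (1 / 2) ^+ j * W k.
  apply: le_trans (hW j k); apply: (fc_bound k (ltW (s0 j.+1)) (hc (j, i))) => z hz.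
  exact: hD.
have cr j i k : c (j, i) (- k) = conjc (c (j, i) k).
  apply: (fc_real k (ltW (s0 j.+1)) (hc (j, i))) => z hz /=.
  rewrite (good_ru (gd _) hz) (good_ru (gd j) (le_trans hz (sS j))).
  by rewrite -vconjB mxE.
(* The increments telescope from a zero displacement, so these partial sums are the coefficients of
   the [J]-th displacement. *)
pose gs J i k : C := \sum_(l < J) c (l : nat, i) k.
have gsS J i k : gs J.+1 i k - gs J i k = c (J, i) k by rewrite /gs big_ord_recr /= [LHS]addrC addKr.
have gsr J i k : gs J i (- k) = conjc (gs J i k).
  by rewrite /gs conjc_sum; apply: eq_bigr => l _; exact: cr.
have /choice[G0 hG0] : forall p : 'I_n * K, exists l, forall J,
    nc (l - gs J p.1 p.2) <= 2 * (kap * W p.2) * (1 / 2) ^+ J.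
  move=> [i k] /=; apply: (@geo_lim (fun J => gs J i k)) => [|J]; first exact: mulr_ge0.
  by rewrite gsS; apply: le_trans (cb J i k) _; rewrite mulrAC.
pose G i k := G0 (i, k).
have hG i k J : nc (G i k - gs J i k) <= 2 * (kap * W k) * (1 / 2) ^+ J := hG0 (i, k) J.
have Gb i k : nc (G i k) <= 2 * kap * W k.
  by have := hG i k 0%N; rewrite /gs big_ord0 subr0 expr0 mulr1 mulrA.
have Gr i k : G i (- k) = conjc (G i k).
  apply/eqP; rewrite -subr_eq0; apply/eqP/nc_small => e e0.
  have [J hJ] := half_small (2 * (kap * W k) + 2 * (kap * W (- k))) e0.
  apply: le_trans (hJ J (leqnn J)); apply: le_trans (nc_dist _ (gs J i (- k)) _) _.
  rewrite [leRHS]mulrDl addrC; apply: lerD; last exact: hG.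
  by rewrite gsr -conjcN -conjcD nc_conj ncC; exact: hG.
have gsb J i k : nc (gs J i k) <= 2 * kap * W k.
  have := @geo_dist (fun J => gs J i k) (kap * W k) _ 0%N J.
  rewrite /gs big_ord0 subr0 add0n expr0 => h.
  apply: le_trans (h _) _ => [j|]; first by rewrite gsS; apply: le_trans (cb j i k) _; rewrite mulrAC.
  rewrite mulrA ler_piMr ?mulr_ge0 // gerBl ltW // half_gt0.
have pd (f : K -> C) B : 0 <= B -> (forall k, nc (f k) <= B * W k) -> pdec 2 f (B * CW).
  move=> B0 hf k; apply: (@le_trans _ _ ((1 + supn k)%:R ^+ 2 * (B * W k))).
    by rewrite ler_wpM2l ?exprn_ge0.
  by rewrite mulrCA -[leRHS]mulrA ler_wpM2l.
have k20 : 0 <= 2 * kap by rewrite mulr_ge0.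
have pG i := pd _ _ k20 (Gb i).
have pgs J i := pd _ _ k20 (gsb J i).
have pdf J i : pdec 2 (fun k => G i k - gs J i k) (2 * kap * (1 / 2) ^+ J * CW).
  apply: pd => [|k]; first by rewrite mulr_ge0 // ltW // half_gt0.
  by apply: le_trans (hG i k J) _; rewrite mulrA mulrAC.
have l2 : (0 <= 2)%N by []. have l12 : (1 <= 2)%N by []. have l01 : (0 <= 1)%N by [].
have suE J y i : su (st J) (toC y) 0 i = ser (gs J i) (toC y).
  elim: J => [|J IH].
    rewrite st00 /= mxE /ser.
    rewrite (_ : (fun k => _) = (fun=> 0)); last first.
      by apply/funext => k; rewrite /gs big_ord0 mul0r.
    have [_ ->] := @tsum_fin R n (fun=> 0) 0%N (fun _ _ => erefl).
    by rewrite /Sbox big1.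
  have H : (su (st J.+1) (toC y) - su (st J) (toC y)) 0 i = ser (c (J, i)) (toC y).
    have hf : fc (0 + s J.+1) (fun z => (su (st J.+1) z - su (st J) z) 0 i) (c (J, i)).
      by rewrite add0r; exact: (hc (J, i)).
    by apply: (fc_eval (lexx 0) (s0 J.+1) hf); rewrite l1im_toC.
  have : ser (c (J, i)) (toC y) = ser (gs J.+1 i) (toC y) - ser (gs J i) (toC y).
    rewrite -(serB y (pdec_le l2 (pgs J.+1 i)) (pdec_le l2 (pgs J i))).
    by congr ser; apply/funext => k; rewrite gsS.
  rewrite -H -IH mxE [X in _ + X]mxE.
  by move=> /(congr1 (fun v => v + su (st J) (toC y) 0 i)); rewrite !subrK.
have suR J y : su (st J) (toC y) = toC (uR (gs J) y).
  apply/rowP => i; rewrite suE !mxE; apply: ser_real (pdec_le l2 (pgs J i)) _ => k.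
  exact: gsr.
(* Both [sM - 1] and the termwise derivative give quadratic expansions of the same displacement
   along [t *: omega]. *)
have dE J y i : (toC omega *m sM (st J) (toC y) - toC omega) 0 i =
    \sum_l cR (omega 0 l) * ser (dc l (gs J i)) (toC y).
  have [Q [Q0 hQ]] := good_d (gd J).
  pose A := 2 * (2 * pi * n%:R) ^+ 2 * (2 * kap * CW) * CN.
  have A0 : 0 <= A.
    apply: mulr_ge0; last exact/ltW/Cn_gt0.
    apply: mulr_ge0; last exact: mulr_ge0.
    by apply: mulr_ge0 => //; exact: sqr_ge0.
  have toCZ t : toC (t *: omega) = cR t *: toC omega by apply/rowP => l; rewrite !mxE cRM.
  have nE t : `|t *: omega| ^+ 2 = t ^+ 2 * `|omega| ^+ 2.
    by rewrite normrZ exprMn real_normK ?num_real.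
  apply: (@deriv_uniq (fun y => su (st J) (toC y) 0 i) y omega _ _
     (Q * `|omega| ^+ 2) (A * `|omega| ^+ 2)).
  - by rewrite mulr_ge0 ?sqr_ge0.
  - by rewrite mulr_ge0 ?sqr_ge0.
  - move=> t t0; have := hQ y (t *: omega) i; rewrite nE => H.
    have -> : Q * `|omega| ^+ 2 * t ^+ 2 = Q * (t ^+ 2 * `|omega| ^+ 2) by ring.
    move: H; apply: le_trans.
    rewrite toCZ -scalemxAl -scalerBr.
    move: (toC omega *m _ - toC omega) (su _ _) (su _ _) => v1 v2 v3.
    by rewrite !mxE.
  - move=> t t0; have := ser_taylor y (t *: omega) (pgs J i).
    rewrite nE -/A => H.
    have -> : A * `|omega| ^+ 2 * t ^+ 2 = A * (t ^+ 2 * `|omega| ^+ 2) by ring.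
    move: H; apply: le_trans; rewrite !suE mulr_sumr.
    rewrite (eq_bigr (fun l => cR ((t *: omega) 0 l) * ser (dc l (gs J i)) (toC y))) // => l _.
    by rewrite mxE cRM mulrA.
have /choice[lam0 hlam] : forall i, exists l, forall J,
    nc (l - cR (sl (st J) 0 i)) <= 2 * (4 * n%:R ^+ 2 * Eb) * (1 / 2) ^+ J.
  move=> i; apply: (@geo_lim (fun J => cR (sl (st J) 0 i))) => [|J].
    by rewrite mulr_ge0 // mulr_ge0 // sqr_ge0.
  rewrite -cRB nc_cR; have := hl J i; rewrite !mxE => /le_trans; apply.
  by rewrite -[leRHS]mulrA ler_wpM2l // mulr_ge0 // sqr_ge0.
pose lam : 'rV[R]_n := \row_i complex.Re (lam0 i).
have lamJ i J : `|lam 0 i - sl (st J) 0 i| <= 2 * (4 * n%:R ^+ 2 * Eb) * (1 / 2) ^+ J.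
  apply: le_trans (hlam i J); rewrite mxE.
  by have := nc_Re (lam0 i - cR (sl (st J) 0 i)); rewrite ReD ReN.
exists G, lam; split => //.
  move=> i; have := lamJ i 0%N; rewrite st00 /= [X in _ - X]mxE subr0 expr0 mulr1.
  by move/le_trans; apply; rewrite le_eqVlt; apply/orP; left; apply/eqP; ring.
move=> y i; apply/eqP; rewrite -subr_eq0; apply/eqP/nc_small => e e0.
(* Sizes, relative to [2^-J], of the errors at stage [J]: [B1] for the derivative along [omega],
   [B2] for moving the argument of [F], [B3] for [lambda]. The truncation of [F] at [2^J] is
   controlled separately by the tail [Tl]. *)
pose B1 := n%:R * `|omega| * (2 * pi * (2 * kap * CW) * CN).
pose B2 := 2 * pi * n%:R * FB * CN * (2 * kap * CW * CN).
pose B3 := 2 * (4 * n%:R ^+ 2 * Eb).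
have e20 : 0 < e / 2 by rewrite divr_gt0.
have [J1 hJ1] := half_small (B1 + Eb + B2 + B3) e20.
have [J2 hJ2] := @small_MTl R n FB _ e20.
pose J := maxn J1 J2.
have {}hJ1 := hJ1 _ (leq_maxl J1 J2).
have {}hJ2 : FB * @Tl R n (2 ^ J) <= e / 2.
  apply: hJ2; apply: leq_trans (leq_maxr J1 J2) _; exact/ltnW/ltn_expl.
have hy : l1im (toC y) <= s J by rewrite l1im_toC ltW.
have eE := he J _ hy i.
have := dE J y i; set aJ := \sum_l _ => daJ.
have EJ : aJ = err omega (FN Fc (2 ^ J)) (st J) (toC y) 0 i +
    FN Fc (2 ^ J) (toC (y + uR (gs J) y)) 0 i - cR (sl (st J) 0 i).
  rewrite -daJ /err suR -toCD.
  move: (toC omega *m _) (FN _ _ _) => v1 v2.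
  by rewrite !mxE; ring.
have d1 : nc (\sum_l cR (omega 0 l) * ser (dc l (G i)) (toC y) - aJ) <= B1 * (1 / 2) ^+ J.
  rewrite /aJ -sumrB; apply: le_trans (nc_sum _ _ _) _.
  apply: (@le_trans _ _ (\sum_(l < n) `|omega| * (2 * pi * (2 * kap * (1 / 2) ^+ J * CW) * CN))).
    apply: ler_sum => l _; rewrite -mulrBr ncM nc_cR; apply: ler_pM; rewrite ?nc_ge0 ?normr_le_mx //.
    rewrite -(serB y (pdec_dc l (pdec_le l12 (pG i))) (pdec_dc l (pdec_le l12 (pgs J i)))).
    rewrite -dcB; apply: ser_pbound; apply: pdec_dc; exact: pdec_le l12 (pdf J i).
  rewrite sumr_const card_ord -(mulr_natl (_ * _)) le_eqVlt /B1; apply/orP; left; apply/eqP; ring.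
have d2 : `|uR G y - uR (gs J) y| <= 2 * kap * CW * CN * (1 / 2) ^+ J.
  apply: mx_normr_le => [|l].
    by rewrite mulr_ge0 ?(ltW (half_gt0 _)) // mulr_ge0 ?(ltW (@Cn_gt0 R n)) // mulr_ge0.
  rewrite !mxE -ReN -ReD -(serB y (pdec_le l2 (pG l)) (pdec_le l2 (pgs J l))).
  apply: le_trans (nc_Re _) _; apply: le_trans (ser_pbound y (pdec_le l2 (pdf J l))) _.
  by rewrite le_eqVlt; apply/orP; left; apply/eqP; ring.
pose YJ := y + uR (gs J) y.
have d3 : nc (ser (Fc i) (toC (y + uR G y)) - ser (Fc i) (toC YJ)) <= B2 * (1 / 2) ^+ J.
  have -> : y + uR G y = YJ + (uR G y - uR (gs J) y).
    by rewrite /YJ -addrA; congr (_ + _); rewrite addrC subrK.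
  apply: le_trans (ser_lip_real YJ _ (hF i)) _; rewrite /B2 -[leRHS]mulrA.
  apply: ler_wpM2l => //.
  by rewrite !mulr_ge0 ?pi_ge0 ?(pdec_ge0 (hF i)) ?(ltW (@Cn_gt0 R n)).
have d4 : nc (ser (Fc i) (toC YJ) - FN Fc (2 ^ J) (toC YJ) 0 i) <= FB * @Tl R n (2 ^ J).
  have -> : FN Fc (2 ^ J) (toC YJ) 0 i = Sbox (2 ^ J) (fun k => Fc i k * ek k (toC YJ)).
    by rewrite mxE /tev big_map.
  by apply: tsum_tail; apply: pdec_dom (pdec_le l01 (hF i)) _; rewrite l1im_toC.
have d5 : nc (cR (lam 0 i) - cR (sl (st J) 0 i)) <= B3 * (1 / 2) ^+ J.
  by rewrite -cRB nc_cR; exact: lamJ.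
have d6 : nc (err omega (FN Fc (2 ^ J)) (st J) (toC y) 0 i) <= Eb * (1 / 2) ^+ J.
  exact: le_trans eE (hE J).
set a := \sum_l _ in d1 *.
set f1 := ser (Fc i) _ in d3 *; set f2 := ser (Fc i) _ in d3 d4.
set f3 := FN Fc _ _ _ _ in d4 EJ; set er := err _ _ _ _ _ _ in d6 EJ.
have -> : a - (f1 - cR (lam 0 i)) =
  (a - aJ) + (er - (f1 - f2) - (f2 - f3) + (cR (lam 0 i) - cR (sl (st J) 0 i))).
  by rewrite EJ; ring.
apply: le_trans (ncD _ _) _; apply: le_trans (lerD (lexx _) (ncD _ _)) _.
rewrite !mulrDl in hJ1.
exact: add_bounds d1 d6 d3 d4 d5 hJ1 hJ2 (ncB er (f1 - f2)) (ncB (er - (f1 - f2)) (f2 - f3)).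
Qed.

End Limit.

(** * Gevrey weights and the choice of constants *)

Section Constants.
Context {R : realType}.
Implicit Types (a r tau kappa x t K k : R).

Lemma powRB1 x (b : R) : 0 < x -> x `^ (b - 1) * x = x `^ b.
Proof.
move=> x0; rewrite powRB; last by rewrite (gt_eqF x0) implybT.
by rewrite powRr1 ?ltW // divfK // gt_eqF.
Qed.

Lemma powRBp x (b c : R) : 0 < x -> x `^ (b - c) = x `^ b / x `^ c.
Proof. by move=> x0; rewrite powRB // (gt_eqF x0) implybT. Qed.

(** The graph of [t^a] lies below its tangent at [x]. With [t = x * expR v] this is
    [expR (a v) <= 1 - a + a * expR v]; the lower bounds of [expR] at [- a v] and [(1 - a) v],
    weighted by [1 - a] and [a], make the terms in [v] cancel. *)
Lemma powR_tangent a x t : 0 < a -> a < 1 -> 0 < x -> 0 <= t ->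
  t `^ a <= (1 - a) * x `^ a + a * x `^ (a - 1) * t.
Proof.
move=> a0 a1 x0; rewrite le_eqVlt => /orP[/eqP <-|t0].
  by rewrite powR0 ?gt_eqF // mulr0 addr0 mulr_ge0 ?powR_ge0 // subr_ge0 ltW.
pose v := ln t - ln x.
have xE : x `^ (a - 1) * t = x `^ a * expR v.
  rewrite powRBp // powRr1 ?ltW // /v expRB !lnK ?posrE //.
  by field; rewrite gt_eqF.
have tE : t `^ a = x `^ a * expR (a * v).
  rewrite /powR !gt_eqF // -expRD; congr expR; rewrite /v; ring.
rewrite -mulrA xE tE.
have -> : (1 - a) * x `^ a + a * (x `^ a * expR v) = x `^ a * (1 - a + a * expR v) by ring.
rewrite ler_wpM2l ?powR_ge0 //.
have e1 := expR_ge1Dx ((1 - a) * v); have e2 := expR_ge1Dx (- (a * v)).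
have -> : expR v = expR (a * v) * expR ((1 - a) * v) by rewrite -expRD; congr expR; ring.
have p := expR_gt0 (a * v).
have e3 : expR (a * v) * (1 - a * v) <= 1.
  by rewrite -ler_pdivlMl // mulr1 -expRN.
have e4 : expR (a * v) * (1 + (1 - a) * v) <= expR (a * v) * expR ((1 - a) * v).
  by rewrite ler_wpM2l // ltW.
have := ler_wpM2l (ltW a0) e4; have : 0 <= 1 - a by lra.
move=> a10; have := ler_wpM2l a10 e3.
move: (expR (a * v)) (expR ((1 - a) * v)) {e1 e2 e3 e4 p xE tE} => X Y; nra.
Qed.

(** Choosing [M] with [a * M >= m], the polynomial is at most a multiple of the [M]-th power of
    [d * phi a], and [y^M <= M! * expR y]. *)
Lemma phi_decay a (d : R) m : 0 < a -> 0 < d ->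
  exists2 Cd : R, 0 < Cd & forall j : nat, (1 + j)%:R ^+ m * expR (- (d * phi a j%:R)) <= Cd.
Proof.
move=> a0 d0.
pose M := Num.bound (m%:R / a).
have aM : m%:R <= a * M%:R.
  rewrite mulrC -ler_pdivrMr //; apply: ltW; apply: archi_boundP.
  by rewrite divr_ge0 // ltW.
pose Cd := 2 ^+ m * (M`!%:R * (a / d) ^+ M) + 1.
have C0 : 0 <= 2 ^+ m * (M`!%:R * (a / d) ^+ M).
  by rewrite !mulr_ge0 ?exprn_ge0 // divr_ge0 // ltW.
exists Cd; first by rewrite ltr_wpDl.
case=> [|j].
  rewrite addn0 expr1n mul1r /phi powR0 ?gt_eqF // mul0r mulr0 oppr0 expR0.
  by rewrite lerDr.
set T : R := j.+1%:R; have T1 : 1 <= T by rewrite ler1n.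
have T0 : 0 < T by lra.
have y0 : 0 <= d * phi a T by rewrite mulr_ge0 ?(ltW d0) // divr_ge0 ?powR_ge0 // ltW.
apply: (@le_trans _ _ (2 ^+ m * (M`!%:R * (a / d) ^+ M))); last by rewrite lerDl.
rewrite expRN ler_pdivrMr ?expR_gt0 //.
apply: (@le_trans _ _ (2 ^+ m * T ^+ m)).
  rewrite -exprMn lerXn2r ?nnegrE ?mulr_ge0 ?(ltW T0) //.
  by rewrite natrD -/T; lra.
rewrite -[leRHS]mulrA ler_wpM2l ?exprn_ge0 //.
have h := exprn_le_expR M y0.
have TM : T ^+ m <= T `^ a ^+ M.
  have -> : T `^ a ^+ M = T `^ (a * M%:R) by rewrite powRrM powR_mulrn ?powR_ge0.
  by rewrite -powR_mulrn ?(ltW T0) // ler_powR.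
apply: le_trans TM _.
have -> : T `^ a ^+ M = (a / d) ^+ M * (d * phi a T) ^+ M.
  rewrite -exprMn; congr (_ ^+ _); rewrite /phi; field.
  by rewrite !gt_eqF.
have -> : M`!%:R * (a / d) ^+ M * expR (d * phi a T) = (a / d) ^+ M * (M`!%:R * expR (d * phi a T)).
  by ring.
by rewrite ler_wpM2l // exprn_ge0 // divr_ge0 // ltW.
Qed.

(** This and the next bound are the tangent inequality for [t^a]: at 1 evaluated at 2, and at 2
    evaluated at 1. *)
Lemma pow2a_le a : 0 < a -> a < 1 -> 2 `^ a <= 1 + a :> R.
Proof.
move=> a0 a1; have := @powR_tangent a 1 2 a0 a1 ltr01 (ler0n _ 2).
rewrite !powR1; lra.
Qed.

Lemma pow2a_ge a : 0 < a -> a < 1 -> 1 <= 2 `^ a * (1 - a / 2) :> R.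
Proof.
move=> a0 a1; have := @powR_tangent a 2 1 a0 a1 (ltr0n _ 2) (ltW ltr01).
rewrite !powR1 powRBp // powRr1 //; lra.
Qed.

(* On the strip used at the scale K, the frequencies k between K and 2K contribute to the error at
   the scale 2K; this is the exponent of that contribution. *)
Lemma freq_piece a r K k : 0 < a -> a < 1 -> 0 <= r -> 0 < K -> K <= k -> k <= 2 * K ->
  r * (2 `^ (- a) * (1 - a / 2)) * phi a (2 * K) <= r * phi a k - r / 2 * K `^ (a - 1) * k.
Proof.
move=> a0 a1 r0 K0 Kk kK.
have k0 : 0 < k by lra.
have h := powR_tangent a0 a1 k0 (ltW K0).
have kE : k `^ (a - 1) * k = k `^ a by exact: powRB1.
have KE : K `^ (a - 1) * K = K `^ a by exact: powRB1.
have k1 : 2^-1 * K `^ (a - 1) <= k `^ (a - 1).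
  have h1 : (2 * K) `^ (a - 1) <= k `^ (a - 1).
    rewrite /powR !gt_eqF ?mulr_gt0 // ler_expR ler_wnM2l ?subr_le0 ?(ltW a1) //.
    by rewrite ler_ln ?posrE ?mulr_gt0.
  apply: le_trans h1; rewrite powRM ?(ltW K0) // ler_wpM2r ?powR_ge0 //.
  rewrite powRBp // powRr1 // -[leLHS]mul1r ler_wpM2r ?invr_ge0 //.
  by rewrite -[leLHS](powRr0 2) ler_powR // ?ler1n // ltW.
(* The tangent at [k] evaluated at [K]; since [k <= 2 K], its slope is at least half of the slope at
   [K]. *)
have E : k `^ a - K `^ a >= a / 2 * K `^ (a - 1) * (k - K).
  have e1 : a * (k `^ (a - 1) * (k - K)) <= k `^ a - K `^ a.
    by move: h; rewrite mulrBr kE -mulrA; lra.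
  apply: le_trans e1; rewrite -!mulrA ler_pM2l // mulrA ler_wpM2r //; lra.
have -> : r * (2 `^ (- a) * (1 - a / 2)) * phi a (2 * K) = r * (1 - a / 2) * K `^ a / a.
  rewrite /phi powRM ?(ltW K0) // powRN; field.
  by rewrite gt_eqF //= gt_eqF // powR_gt0.
rewrite /phi.
have -> : r * (k `^ a / a) - r / 2 * K `^ (a - 1) * k =
  r / a * (k `^ a - a / 2 * K `^ (a - 1) * k) by field; rewrite gt_eqF.
have -> : r * (1 - a / 2) * K `^ a / a = r / a * ((1 - a / 2) * K `^ a) by ring.
rewrite ler_wpM2l ?divr_ge0 ?(ltW a0) //.
by move: E; rewrite mulrBr -[a / 2 * _ * K]mulrA KE; lra.
Qed.

(** The tangent of [tau * phi a] taken at the point where its slope is [xi * K^(a-1)]. That point is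
    [mu * K] with [mu = (tau / xi)^(1/(1-a))], and the value of the tangent at 0 gives the multiple
    of [phi a K]. *)
Lemma young_phi a tau xi K k : 0 < a -> a < 1 -> 0 < tau -> 0 < xi -> 0 < K -> 0 <= k ->
  tau * phi a k <= xi * K `^ (a - 1) * k + (1 - a) * tau * (tau / xi) `^ (a / (1 - a)) * phi a K.
Proof.
move=> a0 a1 tau0 xi0 K0 k0.
have a10 : 0 < 1 - a by lra.
have tx : 0 < tau / xi by rewrite divr_gt0.
pose mu := (tau / xi) `^ (1 - a)^-1.
have mu0 : 0 < mu by rewrite powR_gt0.
have h := powR_tangent a0 a1 (mulr_gt0 mu0 K0) k0.
have muA : mu `^ a = (tau / xi) `^ (a / (1 - a)) by rewrite /mu -powRrM [_^-1 * a]mulrC.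
have muB : mu `^ (a - 1) = xi / tau.
  rewrite /mu -powRrM (_ : (1 - a)^-1 * (a - 1) = -1); last by field; rewrite gt_eqF.
  by rewrite powRN powRr1 ?(ltW tx) // invf_div.
rewrite !powRM ?(ltW mu0) ?(ltW K0) // in h.
rewrite muA muB in h; rewrite /phi.
have -> : xi * K `^ (a - 1) * k + (1 - a) * tau * (tau / xi) `^ (a / (1 - a)) * (K `^ a / a) =
  tau / a * ((1 - a) * ((tau / xi) `^ (a / (1 - a)) * K `^ a) + a * (xi / tau * K `^ (a - 1)) * k).
  by field; rewrite !gt_eqF.
by rewrite mulrA [tau * _ / a]mulrAC ler_wpM2l ?divr_ge0 ?(ltW a0) ?(ltW tau0).
Qed.

Lemma powR_gt1 x (b : R) : 1 < x -> 0 < b -> 1 < x `^ b.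
Proof.
move=> x1 b0; rewrite /powR gt_eqF ?(lt_trans ltr01) //.
by rewrite -expR0 ltr_expR mulr_gt0 // ln_gt0.
Qed.

Lemma powR_le1 x (b : R) : 0 <= x -> x <= 1 -> 0 <= b -> x `^ b <= 1.
Proof.
move=> x0 x1 b0; have -> : 1 = 1 `^ b :> R by rewrite powR1.
by apply: ge0_ler_powR; rewrite ?nnegrE.
Qed.

Lemma pow2n (m : nat) (b : R) : (2 ^+ m) `^ b = (2 `^ b) ^+ m.
Proof. by rewrite -powR_mulrn // -powRrM mulrC powRrM powR_mulrn // powR_ge0. Qed.

(** [L < beta * (2 - 2^a)] makes the quadratic error smaller than the next target,
    [nu * (1 - a) < beta - L] makes the increments summable with weight [nu], and [nu <= r / 2] lets
    the width cover the slope of [nu * phi a]. With [p = a / (1 - a)], [u = 2^p] and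
    [h = kappa^(1-a) - 1], one has [32^p = u^5], [8^(-p) = u^(-3)] and
    [c = u^5 (kappa - 1) / (h * h^p)]. *)
Lemma const_facts a r tau kappa : 0 < a -> a < 1 -> 0 < r -> 0 < tau ->
  1 < kappa -> kappa < 2 -> c_ak a kappa * tau < r ->
  let nu := 8 `^ (- (a / (1 - a))) * (r - c_ak a kappa * tau) / 2 in
  let beta := r * (2 `^ (- a) * (1 - a / 2)) in
  let xi := (1 - 2 `^ (a - 1)) * (2 `^ (- a) * r) in
  let L := (1 - a) * tau * (tau / xi) `^ (a / (1 - a)) in
  [/\ 0 < xi, 0 <= L, L < beta * (2 - 2 `^ a), nu * (1 - a) < beta - L &
      (0 < nu) && (nu <= r / 2)].
Proof.
move=> a0 a1 r0 tau0 k1 k2 hc nu beta xi L.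
have a10 : 0 < 1 - a by lra.
pose p := a / (1 - a); have p0 : 0 < p by rewrite divr_gt0.
have pa : a <= p by rewrite ler_pdivlMr //; nra.
pose h := kappa `^ (1 - a) - 1.
have h0 : 0 < h by rewrite subr_gt0 powR_gt1.
have k0 : 0 < kappa by lra.
have hk : h <= kappa - 1.
  rewrite lerD2r -[leRHS](powRr1 (ltW k0)); apply: ler_powR; lra.
have h2 : h <= 2 `^ (1 - a) - 1.
  by rewrite lerD2r; apply: ge0_ler_powR; rewrite ?nnegrE ?(ltW a10) ?(ltW k0) ?(ltW k2).
have h1 : h <= 1 by lra.
pose u := 2 `^ p; pose v := 2 `^ a :> R; pose H := h `^ p.
have v1 : 1 < v by rewrite powR_gt1 // ltr1n.
have uv : v <= u by rewrite ler_powR // ler1n.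
have H0 : 0 < H by rewrite powR_gt0.
have H1 : H <= 1 by rewrite powR_le1 // ltW.
have cE : c_ak a kappa = u ^+ 5 * (kappa - 1) / (h * H).
  rewrite /c_ak -/p -/h powRN; have -> : 1 / (1 - a) = 1 + p by rewrite /p; field; rewrite gt_eqF.
  have -> : h `^ (1 + p) = h * H by rewrite powRD ?powRr1 ?(ltW h0) // (gt_eqF h0) implybT.
  by have -> : 32 = 2 ^+ 5 :> R by [rewrite -natrX]; rewrite pow2n.
have u0 : 0 < u := lt_trans ltr01 (lt_le_trans v1 uv).
have u50 : 0 < u ^+ 5 by rewrite exprn_gt0.
have c0 : 0 < c_ak a kappa by rewrite cE divr_gt0 ?mulr_gt0 // subr_gt0.
pose t := c_ak a kappa * tau / r.
have t0 : 0 < t by rewrite divr_gt0 // mulr_gt0.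
have t1 : t < 1 by rewrite ltr_pdivrMr // mul1r.
(* The factor [kappa - 1] of [c] cancels against [h], as [h <= kappa - 1]. *)
have tauE : tau * u ^+ 5 <= t * r * H.
  have E : tau * u ^+ 5 * (kappa - 1) = t * r * H * h.
    by rewrite /t cE; field; rewrite !gt_eqF.
  have km : 0 < kappa - 1 by lra.
  rewrite -(ler_pM2r km) E; apply: ler_wpM2l => //.
  by apply: mulr_ge0; [apply: mulr_ge0|]; exact: ltW.
have v0 : 0 < v := lt_trans ltr01 v1.
have v2 : v <= 1 + a := pow2a_le a0 a1.
have va : 1 <= v * (1 - a / 2) := pow2a_ge a0 a1.
have q2 : 2 `^ (a - 1) = v / 2 by rewrite powRBp // powRr1.
have q3 : 2 `^ (1 - a) = 2 / v by rewrite powRBp // powRr1.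
have q4 : 2 `^ (- a) = v^-1 by rewrite powRN.
have xiE : xi = (1 - v / 2) / v * r by rewrite /xi q2 q4; ring.
have hv : h * v <= 2 - v.
  move: h2; rewrite q3 -(ler_pM2r v0) => /le_trans; apply.
  by rewrite (_ : (2 / v - 1) * v = 2 - v) //; field; rewrite gt_eqF.
have xih : h * r / 2 <= xi.
  rewrite xiE -(ler_pM2r v0).
  have -> : (1 - v / 2) / v * r * v = (2 - v) * r / 2 by field; rewrite gt_eqF.
  have -> : h * r / 2 * v = h * v * r / 2 by ring.
  by rewrite ler_pM2r // ler_pM2r.
have xi0 : 0 < xi by apply: lt_le_trans xih; rewrite divr_gt0 // mulr_gt0.
have tx : tau / xi <= 2 * H / h.
  rewrite ler_pdivrMr //.
  apply: (@le_trans _ _ (2 * H / h * (h * r / 2))); last first.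
    by rewrite ler_wpM2l // divr_ge0 ?mulr_ge0 // ltW.
  have -> : 2 * H / h * (h * r / 2) = r * H by field; rewrite gt_eqF.
  apply: (@le_trans _ _ (tau * u ^+ 5)).
    by rewrite ler_peMr ?(ltW tau0) // exprn_ege1 //; lra.
  apply: le_trans tauE _; rewrite -[leLHS]mulrA.
  by apply: ler_piMl; [apply: mulr_ge0; exact: ltW | exact: ltW].
have txp : (tau / xi) `^ p <= u / H.
  apply: (@le_trans _ _ ((2 * H / h) `^ p)).
    apply: ge0_ler_powR; rewrite ?nnegrE ?(ltW p0) //.
    - by rewrite divr_ge0 ?ltW.
    - by rewrite divr_ge0 ?mulr_ge0 // ltW.
  rewrite powRM ?mulr_ge0 ?invr_ge0 ?(ltW H0) ?(ltW h0) // powRM ?(ltW H0) //.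
  rewrite -powR_inv1 ?(ltW h0) // -powRrM mulN1r powRN -/u -/H.
  rewrite ler_wpM2r ?invr_ge0 ?(ltW H0) // ler_piMr ?(ltW u0) //.
  by rewrite powR_le1 ?(ltW H0) // ltW.
have L0 : 0 <= L by rewrite mulr_ge0 ?powR_ge0 // mulr_ge0 // ltW.
have betaE : beta = r * ((1 - a / 2) / v) by rewrite /beta q4; ring.
have w2 : (u ^+ 2)^-1 <= (1 - a / 2) / v.
  apply: (@le_trans _ _ (v ^+ 2)^-1).
    by rewrite lef_pV2 ?posrE ?exprn_gt0 // lerXn2r ?nnegrE ?(ltW v0) ?(ltW u0).
  rewrite expr2 invfM ler_wpM2r ?invr_ge0 ?(ltW v0) //.
  by rewrite -[leLHS]mul1r ler_pdivrMr // mulrC.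
have u1 : 1 <= u := le_trans (ltW v1) uv.
have um m : (2 <= m)%N -> (u ^+ m)^-1 <= (u ^+ 2)^-1.
  by move=> m2; rewrite lef_pV2 ?posrE ?exprn_gt0 // ler_weXn2l.
(* Of the five powers of [u] in [c], one is lost to [(tau / xi)^p <= u / H]; the remaining [u^(-4)]
   is below [u^(-2)], hence below [beta / r]. *)
have Lb : L <= t * (1 - a) * beta.
  apply: (@le_trans _ _ ((1 - a) * (t * r * (u ^+ 4)^-1))).
    rewrite /L -mulrA ler_wpM2l ?(ltW a10) //.
    apply: (@le_trans _ _ (tau * (u / H))); first by rewrite ler_wpM2l // ltW.
    have -> : tau * (u / H) = tau * u ^+ 5 * (H^-1 * (u ^+ 4)^-1).
      by field; rewrite !gt_eqF.
    have -> : t * r * (u ^+ 4)^-1 = t * r * H * (H^-1 * (u ^+ 4)^-1).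
      by field; rewrite !gt_eqF.
    by rewrite ler_wpM2r // mulr_ge0 // invr_ge0 ?exprn_ge0 // ltW.
  have -> : t * (1 - a) * beta = (1 - a) * (t * r * ((1 - a / 2) / v)) by rewrite betaE; ring.
  rewrite ler_wpM2l ?(ltW a10) //; apply: (ler_wpM2l (mulr_ge0 (ltW t0) (ltW r0))).
  exact: le_trans (um 4%N isT) w2.
have beta0 : 0 < beta.
  rewrite betaE mulr_gt0 // divr_gt0 //; move: a1; clear; lra.
have nuE : nu = r * (1 - t) * (u ^+ 3)^-1 / 2.
  rewrite /nu powRN -/p (_ : 8 = 2 ^+ 3 :> R); last by rewrite -natrX.
  rewrite pow2n -/u /t; field.
  by rewrite !gt_eqF // exprn_gt0.
have t10 : 0 < 1 - t by rewrite subr_gt0.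
have nub : nu <= beta * (1 - t) / 2.
  rewrite nuE betaE ler_pM2r // -mulrA -[leRHS]mulrA ler_wpM2l ?(ltW r0) // mulrC ler_wpM2r ?(ltW t10) //.
  exact: le_trans (um 3%N isT) w2.
have nu0 : 0 < nu by rewrite nuE divr_gt0 // mulr_gt0 ?invr_gt0 ?exprn_gt0 // mulr_gt0.
have bt : t * (1 - a) * beta <= t * beta by rewrite -mulrA ler_wpM2l ?(ltW t0) // ler_piMl ?(ltW beta0) // gerBl ltW.
split => //.
- apply: le_lt_trans Lb _; apply: (@lt_le_trans _ _ (beta * (1 - a))).
    have -> : t * (1 - a) * beta = t * (beta * (1 - a)) by ring.
    by rewrite gtr_pMl // (mulr_gt0 beta0 a10).
  rewrite ler_pM2l // -/v; move: v2; clear; lra.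
- apply: (@le_lt_trans _ _ nu); first by rewrite ler_piMr ?(ltW nu0) // gerBl ltW.
  apply: le_lt_trans nub _; have := mulr_gt0 beta0 t10; move: Lb bt.
  by rewrite mulrBr mulr1; lra.
rewrite nu0 /= nuE ler_pM2r // -mulrA ler_piMr ?(ltW r0) //.
apply: mulr_ile1; rewrite ?(ltW t10) ?invr_ge0 ?exprn_ge0 ?(ltW u0) //; first by rewrite gerBl ltW.
by rewrite invf_le1 ?exprn_gt0 // exprn_ege1.
Qed.

End Constants.

(** * The scheme for Gevrey data *)

Section Main.
Context {R : realType} {n : nat}.
Local Notation C := R[i].
Local Notation V := 'rV[C]_n.
Local Notation K := 'rV[int]_n.
Local Notation CN := (@Cn R n).
Local Notation cgn := (@cg R n).

Lemma phi_ge0 (a t : R) : 0 < a -> 0 <= phi a t.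
Proof. by move=> a0; rewrite divr_ge0 ?powR_ge0 // ltW. Qed.

Lemma phi_pw (a d : R) m : 0 < a -> 0 < d -> exists2 Cd : R, 0 < Cd &
  forall k : K, (1 + supn k)%:R ^+ m * expR (- (d * phi a (supn k)%:R)) <= Cd * pw k.
Proof.
move=> a0 d0; have [Cd Cd0 h] := phi_decay (2 * n + m) a0 d0; exists Cd => // k.
rewrite /pw ler_pdivlMr ?exprn_gt0 ?ltr0n // mulrC mulrA -exprD.
exact: h.
Qed.

(** Absorbs the polynomial losses in [2^j] of one step and still leaves a geometric factor for the
    summation over [j]. *)
Lemma seq_decay (a d : R) m : 0 < a -> 0 < d -> exists2 Cd : R, 0 < Cd &
  forall j, (2 ^+ j) ^+ m * expR (- (d * phi a (2 ^+ j))) <= Cd * (1 / 2) ^+ j.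
Proof.
move=> a0 d0; have [Cd Cd0 h] := phi_decay m.+1 a0 d0; exists Cd => // j.
rewrite expr_div_n expr1n mul1r ler_pdivlMr ?exprn_gt0 //.
have := h (2 ^ j)%N; rewrite natrX; apply: le_trans.
rewrite [leLHS]mulrAC -exprSr ler_wpM2r ?expR_ge0 // lerXn2r ?nnegrE ?exprn_ge0 //.
by rewrite natrD natrX lerDr.
Qed.

(** Every smallness condition of the proof is linear in [eps / gamma]; written as pairs, finitely
    many of them hold below a common threshold. *)
Lemma eps_ex (l : seq (R * R)) : (forall p, p \in l -> 0 < p.2) ->
  exists2 e : R, 0 < e & forall dl, 0 <= dl -> dl <= e -> forall p, p \in l -> dl * p.1 <= p.2.
Proof.
elim: l => [|q l IH] h; first by exists 1.
have [p pl|e e0 he] := IH; first by apply: h; rewrite inE pl orbT.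
have q0 : 0 < q.2 by apply: h; rewrite inE eqxx.
exists (Num.min e (q.2 / (`|q.1| + 1))); first by rewrite lt_min e0 divr_gt0 // ltr_wpDl.
move=> dl d0; rewrite le_min => /andP[d1 d2] p; rewrite inE => /orP[/eqP ->|/he]; last exact.
apply: le_trans (ler_wpM2l d0 (ler_norm q.1)) _.
move: d2; rewrite ler_pdivlMr ?ltr_wpDl // => /(le_trans _); apply.
by rewrite ler_wpM2l // lerDl.
Qed.

Lemma nc_FN_diff (Fc : 'I_n -> K -> C) N M z i B s : (N <= M)%N ->
  l1im z <= s -> 0 <= B ->
  (forall k, (N < supn k)%N -> (supn k <= M)%N -> nc (Fc i k) * (wt s k)^-1 <= B * pw k) ->
  nc ((FN Fc M z - FN Fc N z) 0 i) <= B * CN.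
Proof.
move=> NM hz B0 hF.
have FE L : FN Fc L z 0 i = \sum_(k <- @box n L) Fc i k * ek k z by rewrite mxE /tev big_map.
rewrite mxE [X in _ + X]mxE !FE (box_split _ NM) addrC addKr.
apply: le_trans (nc_sum _ _ _) _.
apply: (@le_trans _ _ (\sum_(k <- @box n M | (N < supn k)%N) B * pw k)).
  have E (f : K -> R) : \sum_(k <- @box n M | (N < supn k)%N) f k =
    \sum_(k <- @box n M | (k \in box M) && (N < supn k)%N) f k by rewrite big_seq_cond.
  rewrite E [leRHS](E (fun k => B * pw k)); apply: ler_sum => k /andP[kM kN].
  rewrite mem_box in kM; apply: le_trans (hF k kN kM); rewrite ncM.
  by rewrite ler_wpM2l ?nc_ge0 // nc_ek_wt.
rewrite -mulr_sumr ler_wpM2l //.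
apply: le_trans (@le_pwbox R n M).
have -> : @pwbox R n M = @pwbox R n N + \sum_(k <- @box n M | (N < supn k)%N) pw k.
  exact: box_split.
have h : 0 <= @pwbox R n N by apply: sumr_ge0 => k _; exact: pw_ge0.
by rewrite -[leLHS]add0r; apply: lerD.
Qed.

Lemma nc_FN1 (Fc : 'I_n -> K -> C) z i B s : l1im z <= s -> 0 <= B ->
  (forall k, (supn k <= 1)%N -> nc (Fc i k) * (wt s k)^-1 <= B * pw k) ->
  nc (FN Fc 1 z 0 i) <= B * CN.
Proof.
move=> hz B0 hF.
have -> : FN Fc 1 z 0 i = \sum_(k <- @box n 1) Fc i k * ek k z by rewrite mxE /tev big_map.
apply: le_trans (nc_sum _ _ _) _.
apply: (@le_trans _ _ (\sum_(k <- @box n 1) B * pw k)).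
  have E (f : K -> R) : \sum_(k <- @box n 1) f k = \sum_(k <- @box n 1 | k \in box 1) f k.
    by rewrite big_seq.
  rewrite E [leRHS](E (fun k => B * pw k)); apply: ler_sum => k kM.
  rewrite mem_box in kM; apply: le_trans (hF k kM); rewrite ncM.
  by rewrite ler_wpM2l ?nc_ge0 // nc_ek_wt.
by rewrite -mulr_sumr ler_wpM2l // (@le_pwbox R n 1).
Qed.

(** Everything is stated on Fourier coefficients, and the conjugacy is the equation
    [omega . DG = F (y + G y) - lambda]; whether [y + G y] is a diffeomorphism is settled
    separately. *)
Theorem kam_main (a r0 r tau tau0 kappa : R) :
  0 < a -> a < 1 -> 0 < r -> r < r0 -> 0 < tau0 -> tau0 < tau ->
  1 < kappa -> kappa < 2 -> c_ak a kappa * tau < r ->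
  let nu := 8 `^ (- (a / (1 - a))) * (r - c_ak a kappa * tau) / 2 in
  exists epsstar Cm : R, 0 < epsstar /\ 0 < Cm /\
  forall (omega : 'rV[R]_n) (Fc : 'I_n -> K -> C) (eps gam : R),
  0 < gam -> 0 <= eps ->
  (forall k : K, k != 0 -> dotp (toR k) omega != 0 /\
     `|2 * pi * dotp (toR k) omega|^-1 <= gam^-1 * expR (tau0 * phi a (supn k)%:R)) ->
  (forall i k, conjc (Fc i k) = Fc i (- k)) ->
  (forall i k, nc (Fc i k) <= eps * expR (- (r0 * phi a (supn k)%:R))) ->
  eps / gam <= epsstar ->
  exists (G : 'I_n -> K -> C) (lam : 'rV[R]_n),
  [/\ forall i k, nc (G i k) <= Cm * (eps / gam) * expR (- (nu * phi a (supn k)%:R)),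
      forall i k, G i (- k) = conjc (G i k),
      forall i, `|lam 0 i| <= Cm * eps &
      forall y i, \sum_l cR (omega 0 l) * ser (dc l (G i)) (toC y) =
        ser (Fc i) (toC (y + uR G y)) - cR (lam 0 i)].
Proof.
move=> a0 a1 rp rr0 tau00 tau0t k1 k2 hc nu.
have half0 : 0 <= 1 / 2 :> R by rewrite divr_ge0.
have half1 j : (1 / 2 : R) ^+ j <= 1 by apply: exprn_ile1; lra.
have taup : 0 < tau := lt_trans tau00 tau0t.
have [xi0 L0 Lb nuL /andP[nu0 nur]] := const_facts a0 a1 rp taup k1 k2 hc.
rewrite -/nu in nuL nu0 nur.
set beta := r * (2 `^ (- a) * (1 - a / 2)) in Lb nuL.
set xi := (1 - 2 `^ (a - 1)) * (2 `^ (- a) * r) in xi0 L0 Lb nuL.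
set L := (1 - a) * tau * (tau / xi) `^ (a / (1 - a)) in L0 Lb nuL.
pose k (j : nat) : R := 2 ^+ j.
pose pj j := phi a (k j).
have kp j : 0 < k j by rewrite exprn_gt0.
have k1' j : 1 <= k j by rewrite exprn_ege1 // ler1n.
have kS j : k j.+1 = 2 * k j by rewrite /k exprS.
have pjS j : pj j.+1 = 2 `^ a * pj j by rewrite /pj kS /phi powRM // ?ltW // mulrA.
have pj0 j : 0 <= pj j := phi_ge0 _ a0.
have pi0 : 0 < 2 * pi :> R by rewrite mulr_gt0 // pi_gt0.
pose kb j := k j `^ (a - 1).
have kb0 j : 0 < kb j by rewrite powR_gt0.
have kb1 j : kb j <= 1.
  by rewrite -[leRHS](powRr0 (k j)); apply: ler_powR => //; rewrite subr_le0 ltW.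
have kbk j : (k j)^-1 <= kb j.
  by rewrite -(powR_inv1 (ltW (kp j))); apply: ler_powR => //; lra.
have kbS j : kb j.+1 = 2 `^ (a - 1) * kb j by rewrite /kb kS powRM // ltW.
pose v := 2 `^ (- a) : R.
have v0 : 0 < v by rewrite powR_gt0.
have vq : v * 2 `^ (a - 1) = 1 / 2.
  rewrite /v powRN powRBp // powRr1 //; field.
  by rewrite gt_eqF // powR_gt0.
pose Q : R := 1 - 2 `^ (a - 1).
have Q0 : 0 < Q by have := xi0; rewrite /xi -/Q pmulr_lgt0 // mulr_gt0.
(* Normalised so that [2 pi s_(j+1)] is half the slope of [r * phi a] at [k j], the width demanded
   by [freq_piece]. *)
pose s j := v * r * kb j / (2 * pi).
have s0 j : 0 < s j by rewrite divr_gt0 // mulr_gt0 // mulr_gt0.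
have sS2 j : 2 * pi * s j.+1 = r / 2 * kb j.
  rewrite /s kbS mulrCA mulfV ?gt_eqF // mulr1.
  have -> : v * r * (2 `^ (a - 1) * kb j) = (v * 2 `^ (a - 1)) * r * kb j by ring.
  by rewrite vq; lra.
have s2 j : 2 * pi * s j = v * r * kb j by rewrite /s mulrCA mulfV ?gt_eqF // mulr1.
have sQ j : s j - s j.+1 = Q * s j.
  by rewrite /s kbS /Q; ring.
(* The available loss [Q * s j] is split using the gap [tau0 < tau]: the fraction [th] goes to the
   divisors, the rest is shared by the two margins [x j]. *)
pose th := tau0 / tau.
have th0 : 0 < th by rewrite divr_gt0.
have th1 : th < 1 by rewrite ltr_pdivrMr // mul1r.
pose x j := (1 - th) / 2 * Q * s j.
pose t j := th * Q * s j.
have hth : 0 < (1 - th) / 2 by lra.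
have x0 j : 0 < x j by rewrite mulr_gt0 // mulr_gt0.
have t0 j : 0 <= t j by rewrite ltW // mulr_gt0 // mulr_gt0.
have sE j : s j = s j.+1 + x j + x j + t j.
  have := sQ j; rewrite /x /t => h.
  have -> : s j.+1 = s j - Q * s j by rewrite -h; ring.
  by field.
have sle j : s j.+1 <= s j by have := mulr_ge0 (ltW Q0) (ltW (s0 j)); rewrite -sQ subr_ge0.
pose X := (1 - th) / 2 * Q * (v * r / (2 * pi)).
have X0 : 0 < X.
  by apply: mulr_gt0; [exact: mulr_gt0 | apply: divr_gt0 => //; exact: mulr_gt0].
have xE j : x j = X * kb j by rewrite /x /s /X; ring.
have xX j : x j <= X by rewrite xE ler_piMr // ltW.
have Xx j : X / k j <= x j by rewrite xE ler_wpM2l // ltW.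
pose P0 : R := 1 + Pz X 1 + Pz X (2 * n) + Pz X (2 * n + 1).
have Pp m : 0 < Pz X m by exact: Pz_gt0.
have P01 : 1 <= P0.
  by rewrite /P0 -!addrA lerDl !addr_ge0 // ltW.
(* As [x j >= X / k j], the margins degenerate only polynomially, and so do the summation
   constants. *)
pose P j := P0 * k j ^+ (2 * n + 1).
have kn1 j m : 1 <= k j ^+ m by rewrite exprn_ege1.
have P1 j : 1 <= P j by rewrite -[leLHS]mulr1 ler_pM.
have PzP j m : (m <= 2 * n + 1)%N -> Pz X m <= P0 -> Pz (x j) m <= P j.
  move=> hm hP; apply: (@le_trans _ _ (Pz X m * k j ^+ m)).
    have -> : Pz X m * k j ^+ m = m`!%:R * expR X * (X / k j)^-1 ^+ m.
      by rewrite /Pz invf_div expr_div_n; ring.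
    apply: ler_pM.
    - by rewrite mulr_ge0 // expR_ge0.
    - by rewrite invr_ge0 exprn_ge0 // ltW.
    - by rewrite ler_wpM2l // ler_expR.
    have Xk : 0 < X / k j by rewrite divr_gt0.
    rewrite exprVn lef_pV2 ?posrE ?exprn_gt0 //.
    by rewrite lerXn2r ?nnegrE ?(ltW (x0 j)) ?(ltW Xk).
  apply: ler_pM => //; first by rewrite ltW.
    by rewrite exprn_ge0 // ltW.
  by rewrite ler_weXn2l.
have hP j : [/\ Pz (x j) 1 <= P j, Pz (x j) (2 * n) <= P j & Pz (x j) (2 * n + 1) <= P j].
  have := ltW (Pp 1%N); have := ltW (Pp (2 * n)%N); have := ltW (Pp (2 * n + 1)%N) => q1 q2 q3.
  split; apply: PzP; rewrite ?leq_addl ?leq_addr //; rewrite /P0;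
    move: (Pz X 1) (Pz X (2 * n)) (Pz X (2 * n + 1)) q1 q2 q3 => z1 z2 z3; clear; lra.
(* The room between [r] and [r0] is used twice: [r1 / r > 1] pays for the dilation of the strips,
   and [r0 - r1] for summing the new frequencies. *)
pose r1 := (r + r0) / 2.
have rr1 : r < r1 by rewrite /r1; lra.
have r1r0 : r1 < r0 by rewrite /r1; lra.
have r01 : 0 < r0 - r1 by rewrite subr_gt0.
have [Cd Cd0 hCd] := phi_pw 0 a0 r01.
pose C2 := Cd * CN.
have CN0 : 0 < CN := Cn_gt0.
have C20 : 0 < C2 by rewrite mulr_gt0.
pose C0 : R := expR r * 2 ^+ (2 * n) * CN.
have C00 : 0 < C0 by rewrite !mulr_gt0 ?expR_gt0 ?exprn_gt0.
(* The term [2 * C2] keeps the new frequencies below half of the next error; the other one covers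
   the initial error. *)
pose A := 2 * C2 + C0 * expR (beta * pj 0%N).
have A0 : 0 < A by rewrite addr_gt0 // mulr_gt0 // expR_gt0.
(* Rates in [phi a (k j)]: [al] for [D j], [ch] for [D j * E j] relative to [E j.+1], [an] for the
   increments relative to the weight [nu]. Their positivity is the content of [const_facts]. *)
pose al := beta - L.
have beta0 : 0 < beta.
  have p2 : 2 `^ a <= 1 + a :> R := pow2a_le a0 a1.
  by rewrite mulr_gt0 // mulr_gt0 //; lra.
have al1 : 0 < al.
  have : nu * (1 - a) < al by [].
  by apply: le_lt_trans; rewrite mulr_ge0 ?ltW //; lra.
pose ch := al + beta - 2 `^ a * beta.
have ch0 : 0 < ch.
  have -> : ch = beta * (2 - 2 `^ a) - L by rewrite /ch /al; ring.
  by rewrite subr_gt0.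
pose an := al - nu * (1 - a).
have an0 : 0 < an by rewrite subr_gt0.
pose cD := 8 * pi * CN * P0 ^+ 2 * (cgn * A).
have cg0 := @cg_ge0 R n.
have P00 : 0 <= P0 := le_trans ler01 P01.
have cD0 : 0 <= cD.
  apply: mulr_ge0; last exact: mulr_ge0 cg0 (ltW A0).
  apply: mulr_ge0; last exact: sqr_ge0.
  by apply: mulr_ge0; [rewrite mulr_ge0 ?pi_ge0 | exact: ltW].
pose N1 := ((2 * n + 1) * 2)%N.
have [C4 C40 hC4] := seq_decay N1 a0 al1.
have [C4' C4'0 hC4'] := seq_decay N1.+1 a0 al1.
have [C3 C30 hC3] := seq_decay (2 * n + 1 + N1)%N a0 ch0.
have [C7 C70 hC7] := seq_decay (2 * n + 1 + N1)%N a0 an0.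
have [C8 C80 hC8] := seq_decay 0 a0 beta0.
have [CW CW0 hCW] := phi_pw 2 a0 nu0.
have [CF CF0 hCF] := phi_pw 1 a0 (lt_trans rp rr0).
pose cL := 4 * pi * n%:R * P0 * CN.
have cL0 : 0 <= cL.
  by rewrite mulr_ge0 ?(ltW CN0) // mulr_ge0 // mulr_ge0 // mulr_ge0 ?pi_ge0.
pose c6 := 2 * n%:R * cL * cD * cgn * 2.
have c60 : 0 <= c6.
  rewrite /c6; apply: mulr_ge0 => //; apply: mulr_ge0 cg0; apply: mulr_ge0 cD0.
  by apply: mulr_ge0 cL0; exact: mulr_ge0.
pose c7 := cD * (1 + cL) * C7.
have c70 : 0 <= c7 by rewrite mulr_ge0 ?(ltW C70) // mulr_ge0 // addr_ge0.
pose n1 : R := n%:R.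
have n10 : 0 <= n1 by [].
pose m0 := 2 * cD * C4.
have m00 : 0 <= m0 by rewrite mulr_ge0 ?(ltW C40) // mulr_ge0.
have lr : 0 < ln (r1 / r) by rewrite ln_gt0 // ltr_pdivlMr // mul1r.
(* In order: [mu <= 1], the two closeness conditions on the Jacobian, the dilation at most [r1 / r],
   the displacement within the margin [x j], and the quadratic term at most half of the next
   error. *)
pose cs : seq (R * R) := [:: (m0, 1); (n1 * (2 * n1 * m0), 1 / 4); (2 * n1 * m0, 1);
   (n1 * m0, ln (r1 / r)); (n1 * cD * C4' * (1 + s 0%N), X); (c6 * C3, 1)].
have cs0 p : p \in cs -> 0 < p.2.
  rewrite !inE; case/orP=> [/eqP -> //|]; do 4 (case/orP=> [/eqP -> //=|]).
  by move/eqP => ->.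
have [es es0 hes] := eps_ex cs0.
pose Cm := 2 * c7 + 8 * n1 ^+ 2 * A * C8 + 1.
have Cm0 : 0 <= 8 * n1 ^+ 2 * A * C8.
  by rewrite mulr_ge0 ?(ltW C80) // mulr_ge0 ?(ltW A0) // mulr_ge0 ?sqr_ge0.
exists es, Cm; split=> //; split.
  by rewrite ltr_wpDl // addr_ge0 // mulr_ge0.
move=> omega Fc eps gam gam0 eps0 hdiv hr hF hes'.
pose dl := eps / gam.
have dl0 : 0 <= dl by rewrite divr_ge0 // ltW.
have {}hes p : p \in cs -> dl * p.1 <= p.2 := hes dl dl0 hes' p.
have e1 : dl * m0 <= 1 by apply: (hes (m0, 1)); rewrite !inE eqxx.
have e2 : dl * (n1 * (2 * n1 * m0)) <= 1 / 4.
  by apply: (hes (n1 * (2 * n1 * m0), 1 / 4)); rewrite !inE eqxx ?orbT.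
have e3 : dl * (2 * n1 * m0) <= 1 by apply: (hes (2 * n1 * m0, 1)); rewrite !inE eqxx ?orbT.
have e4 : dl * (n1 * m0) <= ln (r1 / r) by apply: (hes (n1 * m0, ln (r1 / r))); rewrite !inE eqxx ?orbT.
have e5 : dl * (n1 * cD * C4' * (1 + s 0%N)) <= X.
  by apply: (hes (n1 * cD * C4' * (1 + s 0%N), X)); rewrite !inE eqxx ?orbT.
have e6 : dl * (c6 * C3) <= 1 by apply: (hes (c6 * C3, 1)); rewrite !inE eqxx ?orbT.
pose Gam j := gam^-1 * expR (L * pj j).
pose E j := eps * A * expR (- (beta * pj j)).
pose d j := eps * C2 * expR (- (beta * pj j.+1)).
pose mu := dl * m0.
pose D j := 8 * pi * CN * P j ^+ 2 * (Gam j * (cgn * E j)).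
have dcD0 : 0 <= dl * cD := mulr_ge0 dl0 cD0.
have DE j : D j = dl * cD * (k j ^+ N1 * expR (- (al * pj j))).
  rewrite /D /P /Gam /E /cD /al /dl.
  have -> : expR (- ((beta - L) * pj j)) = expR (L * pj j) * expR (- (beta * pj j)).
    by rewrite -expRD; congr expR; ring.
  have -> : k j ^+ N1 = (k j ^+ (2 * n + 1)) ^+ 2 by rewrite exprM.
  by move: (k j ^+ _) (expR _) (expR _) => y1 y2 y3; ring.
have D1 j : D j <= mu * (1 / 2) ^+ j.+1.
  rewrite DE; apply: (@le_trans _ _ (dl * cD * (C4 * (1 / 2) ^+ j))).
    exact: (ler_wpM2l dcD0 (hC4 j)).
  by rewrite le_eqVlt /mu /m0 exprS; apply/orP; left; apply/eqP; field.
have D2 j : D j <= dl * cD * C4' / k j.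
  rewrite DE -[leRHS]mulrA; apply: (ler_wpM2l dcD0); rewrite ler_pdivlMr //.
  have := hC4' j; rewrite -/(k j) -/(pj j) exprSr mulrAC => h.
  by apply: le_trans h _; rewrite ler_piMr ?(ltW C4'0).
have D0 j : 0 <= D j.
  rewrite DE; apply: (mulr_ge0 dcD0); apply: mulr_ge0; last exact: expR_ge0.
  by rewrite exprn_ge0 // ltW.
have ss0 j : s j <= s 0%N.
  by elim: j => // j IH; apply: le_trans (sle j) IH.
have E0 j : 0 <= E j by rewrite !mulr_ge0 ?expR_ge0 // ltW.
have bnd_wt j (l : K) : (wt (s j) l)^-1 = expR (v * r * kb j * (supn l)%:R).
  by rewrite /wt expRN invrK s2.
have hkam := @kam_iter R n omega Fc s x t P Gam E d mu hr.
have [||||||||||||||st [st00 gd he hl hDl]] := hkam.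
- by move=> j; rewrite (ltW (s0 j)) x0 t0.
- by move=> j; rewrite E0 P1 mulr_ge0 ?invr_ge0 ?expR_ge0 // ltW.
- exact: sE.
- move=> j l l0; have [h1 h2] := hdiv l l0; split=> //; apply: le_trans h2 _.
  rewrite /Gam /wt expRN invrK -[leRHS]mulrA -expRD ler_wpM2l ?invr_ge0 ?(ltW gam0) // ler_expR.
  (* Multiplied by [th], the linear part becomes exactly [2 pi t_j |l|], because
     [xi * kb j = 2 pi Q s_j]. *)
  have Y := young_phi a0 a1 taup xi0 (kp j) (ler0n _ (supn l)).
  rewrite -/L -/(kb j) -/(pj j) in Y.
  have -> : tau0 * phi a (supn l)%:R = th * (tau * phi a (supn l)%:R).
    by rewrite /th; field; rewrite gt_eqF.
  apply: le_trans (ler_wpM2l (ltW th0) Y) _.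
  rewrite mulrDr addrC; apply: lerD.
    by rewrite ler_piMl ?(ltW th1) // mulr_ge0.
  rewrite le_eqVlt; apply/orP; left; apply/eqP.
  have -> : 2 * pi * t j = th * Q * (2 * pi * s j) by rewrite /t; ring.
  by rewrite s2 /xi -/Q -/v; ring.
- exact: hP.
- exact: D1.
- move=> j; rewrite -/(D j); apply: le_trans (Xx j).
  apply: (@le_trans _ _ (n1 * (dl * cD * C4' / k j) * (1 + s 0%N))).
    apply: ler_pM.
    - exact: mulr_ge0.
    - by rewrite addr_ge0 // ltW.
    - by rewrite ler_wpM2l.
    by rewrite lerD2l.
  rewrite ler_pdivlMr //; apply: le_trans e5; rewrite le_eqVlt; apply/orP; left; apply/eqP.
  by field; rewrite gt_eqF.
- exact: mulr_ge0.
- exact: e1.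
- by apply: le_trans e2; rewrite le_eqVlt; apply/orP; left; apply/eqP; rewrite /mu; ring.
- by apply: le_trans e3; rewrite le_eqVlt; apply/orP; left; apply/eqP; rewrite /mu; ring.
- move=> j z hz i.
  have en : expR (n1 * mu) <= r1 / r.
    have r1r : 0 < r1 / r by rewrite divr_gt0 // (lt_trans rp).
    have -> : r1 / r = expR (ln (r1 / r)) by rewrite lnK ?posrE.
    rewrite ler_expR.
    by apply: le_trans e4; rewrite /mu le_eqVlt; apply/orP; left; apply/eqP; ring.
  have B0 : 0 <= eps * Cd * expR (- (beta * pj j.+1)).
    by rewrite mulr_ge0 ?expR_ge0 // mulr_ge0 // ltW.
  have -> : d j = eps * Cd * expR (- (beta * pj j.+1)) * CN by rewrite /d /C2; ring.
  have NM : (2 ^ j <= 2 ^ j.+1)%N by rewrite leq_exp2l.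
  apply: nc_FN_diff NM hz B0 _ => l lN lM.
  have Kl : k j <= (supn l)%:R by rewrite /k -natrX ler_nat ltnW.
  have lK : (supn l)%:R <= 2 * k j by rewrite -kS /k -natrX ler_nat.
  (* Taken with [r = 1] and multiplied by [r1] afterwards, since the dilated strip has slope up to
     [r1 / 2]. *)
  have FP := freq_piece a0 a1 (ler01 : 0 <= 1 :> R) (kp j) Kl lK.
  rewrite -kS -/(pj j.+1) !mul1r -/(kb j) in FP.
  set ph := phi a (supn l)%:R in FP *.
  have w1 : (wt (expR (n1 * mu) * s j.+1) l)^-1 <= expR (r1 / 2 * kb j * (supn l)%:R).
    rewrite /wt expRN invrK ler_expR ler_wpM2r //.
    have -> : 2 * pi * (expR (n1 * mu) * s j.+1) = expR (n1 * mu) * (2 * pi * s j.+1) by ring.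
    rewrite sS2; apply: le_trans (ler_wpM2r _ en) _.
      by apply: mulr_ge0; [rewrite divr_ge0 ?ltW | exact: ltW].
    by rewrite le_eqVlt; apply/orP; left; apply/eqP; field; rewrite gt_eqF.
  apply: (@le_trans _ _ (eps * expR (- (r0 * ph)) * expR (r1 / 2 * kb j * (supn l)%:R))).
    by apply: ler_pM; rewrite ?nc_ge0 ?invr_ge0 ?wt_ge0 ?hF.
  have hl := hCd l; rewrite expr0 mul1r -/ph in hl.
  rewrite -(mulrA eps (expR _)) -(mulrA eps Cd) -(mulrA eps (Cd * _)) (mulrAC Cd).
  apply: (ler_wpM2l eps0).
  rewrite -expRD.
  apply: (@le_trans _ _ (expR (- ((r0 - r1) * ph)) * expR (- (beta * pj j.+1)))); last first.
    by rewrite ler_wpM2r // expR_ge0.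
  rewrite -expRD ler_expR.
  have h1 : beta * pj j.+1 <= r1 * (ph - 2^-1 * kb j * (supn l)%:R).
    apply: (le_trans _ (ler_wpM2l (ltW (lt_trans rp rr1)) FP)).
    rewrite /beta -mulrA ler_wpM2r ?(ltW rr1) //.
    rewrite mulr_ge0 // mulr_ge0 ?(ltW v0) //; move: a1; clear; lra.
  have -> : - (r0 * ph) + r1 / 2 * kb j * (supn l)%:R =
     - ((r0 - r1) * ph) - r1 * (ph - 2^-1 * kb j * (supn l)%:R) by field.
  by rewrite lerD2l lerN2.
- move=> j; rewrite -/(D j).
  have LamE : @Lam R n (P j) = cL * k j ^+ (2 * n + 1) by rewrite /Lam /P /cL; ring.
  (* Since [pj j.+1 = 2^a * pj j], the product of the rates of [D j] and [E j] is rewritten as that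
     of [E j.+1] times a gain [ch]. *)
  have eE : expR (- (al * pj j)) * expR (- (beta * pj j)) =
      expR (- (ch * pj j)) * expR (- (beta * pj j.+1)).
    by rewrite -!expRD pjS /ch; congr expR; ring.
  have T1 : 2 * n%:R * @Lam R n (P j) * D j * cgn * E j <=
      1 / 2 * (eps * A * expR (- (beta * pj j.+1))).
    have -> : 2 * n%:R * @Lam R n (P j) * D j * cgn * E j =
      1 / 2 * (dl * (c6 * (k j ^+ (2 * n + 1 + N1) * expR (- (ch * pj j))))) *
       (eps * A * expR (- (beta * pj j.+1))).
      rewrite LamE DE /E (exprD _ (2 * n + 1) N1) /c6.
      transitivity (2 * n%:R * cL * cD * cgn * dl * eps * A * k j ^+ (2 * n + 1) * k j ^+ N1 *
        (expR (- (al * pj j)) * expR (- (beta * pj j)))); first by ring.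
      by rewrite eE; move: (expR _) (expR _) (k j ^+ _) (k j ^+ _) => y1 y2 y3 y4; field.
    apply: ler_wpM2r; first exact: mulr_ge0 (mulr_ge0 eps0 (ltW A0)) (expR_ge0 _).
    rewrite -[X in _ <= X]mulr1; apply: ler_wpM2l; first exact: half0.
    apply: le_trans e6; apply: (ler_wpM2l dl0); apply: (ler_wpM2l c60).
    apply: le_trans (hC3 j) _; rewrite -[X in _ <= X]mulr1.
    exact: (ler_wpM2l (ltW C30) (half1 j)).
  have T2 : d j <= 1 / 2 * (eps * A * expR (- (beta * pj j.+1))).
    have -> : 1 / 2 * (eps * A * expR (- (beta * pj j.+1))) =
       eps * (A / 2) * expR (- (beta * pj j.+1)) by ring.
    rewrite /d; apply: ler_wpM2r; first exact: expR_ge0.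
    apply: (ler_wpM2l eps0); rewrite /A.
    have := mulr_ge0 (ltW C00) (expR_ge0 (beta * pj 0%N)).
    by move: (C0 * expR _) => y; clear; lra.
  apply: le_trans (lerD T1 T2) _; rewrite /E; move: (eps * A * _) => y; clear; lra.
- move=> z hz i.
  have B0 : 0 <= eps * (expR r * 2 ^+ (2 * n)).
    by rewrite mulr_ge0 // mulr_ge0 ?expR_ge0 // exprn_ge0.
  apply: (@le_trans _ _ (eps * (expR r * 2 ^+ (2 * n)) * CN)).
    apply: nc_FN1 hz B0 _ => l l1.
    rewrite -mulrA.
    have l1R : (supn l)%:R <= 1 :> R by rewrite lern1.
    have h1 : nc (Fc i l) <= eps.
      apply: le_trans (hF i l) _; rewrite ler_piMr // -expR0 ler_expR oppr_le0.
      by rewrite mulr_ge0 ?phi_ge0 // ltW // (lt_trans rp).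
    have h2 : (wt (s 0%N) l)^-1 <= expR r * 2 ^+ (2 * n) * pw l.
      have b1 : (wt (s 0%N) l)^-1 <= expR r.
        rewrite bnd_wt ler_expR; apply: (@le_trans _ _ (1 * r * 1 * 1)); last by rewrite !mulr1 mul1r.
        have v1 : v <= 1.
          by rewrite -[leRHS](powRr0 2) /v; apply: ler_powR; rewrite ?ler1n // oppr_le0 ltW.
        apply: ler_pM => //.
          by rewrite mulr_ge0 ?(ltW (kb0 _)) // mulr_ge0 ?(ltW v0) // ltW.
        apply: ler_pM => //; first by rewrite mulr_ge0 ?(ltW v0) // ltW.
          exact: ltW.
        by apply: ler_wpM2r v1; exact: ltW.
      have b2 : 1 <= 2 ^+ (2 * n) * pw l :> R; last first.
        rewrite -[leLHS]mulr1 -mulrA; apply: ler_pM => //.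
        by rewrite invr_ge0 wt_ge0.
      rewrite /pw ler_pdivlMr ?exprn_gt0 ?ltr0n // mul1r lerXn2r ?nnegrE //.
      by rewrite natrD; move: l1R; clear; lra.
    apply: ler_pM => //; rewrite ?nc_ge0 ?invr_ge0 ?wt_ge0 //.
  have -> : eps * (expR r * 2 ^+ (2 * n)) * CN = eps * C0 by rewrite /C0; ring.
  rewrite /E -mulrA ler_wpM2l // expRN ler_pdivlMr ?expR_gt0 // /A lerDr.
  by rewrite mulr_ge0 // ltW.
have hW0 (l : K) : 0 <= expR (- (nu * phi a (supn l)%:R)) by exact: expR_ge0.
have sS j : s j.+1 <= s j := sle j.
have Eb1 j : E j <= eps * A * C8 * (1 / 2) ^+ j.
  rewrite /E -[leRHS]mulrA ler_wpM2l ?mulr_ge0 ?(ltW A0) //.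
  by have := hC8 j; rewrite expr0 mul1r.
have Del1 j (l : K) : (D j + @Lam R n (P j) * D j) * wt (s j.+1) l <=
    dl * c7 * (1 / 2) ^+ j * expR (- (nu * phi a (supn l)%:R)).
  have LamE : @Lam R n (P j) = cL * k j ^+ (2 * n + 1) by rewrite /Lam /P /cL; ring.
  (* The tangent of [phi a] at [k j] bounds [nu * phi a] by a constant plus a slope [nu * kb j], and
     [nu <= r / 2] puts this slope below [2 pi s_(j+1)]. The constant is the loss [nu * (1 - a)] in
     the rate [an]. *)
  have w1 : wt (s j.+1) l <= expR (nu * (1 - a) * pj j) * expR (- (nu * phi a (supn l)%:R)).
    rewrite -expRD ler_expR sS2.
    have := powR_tangent a0 a1 (kp j) (ler0n _ (supn l)) => T.
    have {}T : phi a (supn l)%:R <= (1 - a) * pj j + kb j * (supn l)%:R.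
      rewrite /pj /phi ler_pdivrMr //; apply: le_trans T _.
      by rewrite le_eqVlt -/(kb j); apply/orP; left; apply/eqP; field; rewrite gt_eqF.
    have t1 := ler_wpM2l (ltW nu0) T; rewrite mulrDr (mulrA nu (1 - a)) in t1.
    have t2 : nu * (kb j * (supn l)%:R) <= r / 2 * kb j * (supn l)%:R.
      by rewrite -mulrA; apply: ler_wpM2r nur; exact: mulr_ge0 (ltW (kb0 j)) (ler0n R (supn l)).
    rewrite lerNl opprD opprK addrC lerBlDl.
    exact: le_trans t1 (lerD (lexx _) t2).
  have D3 : D j + @Lam R n (P j) * D j <= dl * cD * (1 + cL) *
      (k j ^+ (2 * n + 1 + N1) * expR (- (al * pj j))).
    have -> : dl * cD * (1 + cL) * (k j ^+ (2 * n + 1 + N1) * expR (- (al * pj j))) =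
       (1 + cL) * k j ^+ (2 * n + 1) * D j by rewrite DE exprD; ring.
    rewrite LamE -[X in X + _ <= _]mul1r -mulrDl ler_wpM2r // mulrDl mul1r lerD2r.
    exact: kn1.
  apply: (@le_trans _ _ (dl * cD * (1 + cL) *
      (k j ^+ (2 * n + 1 + N1) * expR (- (al * pj j))) *
      (expR (nu * (1 - a) * pj j) * expR (- (nu * phi a (supn l)%:R))))).
    apply: ler_pM => //; last exact: wt_ge0.
    rewrite addr_ge0 // mulr_ge0 // LamE mulr_ge0 //.
    exact: le_trans ler01 (kn1 _ _).
  rewrite mulrA ler_wpM2r //.
  have -> : dl * cD * (1 + cL) * (k j ^+ (2 * n + 1 + N1) * expR (- (al * pj j))) *
     expR (nu * (1 - a) * pj j) = dl * (cD * (1 + cL)) * (k j ^+ (2 * n + 1 + N1) *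
       (expR (- (al * pj j)) * expR (nu * (1 - a) * pj j))) by ring.
  have -> : expR (- (al * pj j)) * expR (nu * (1 - a) * pj j) = expR (- (an * pj j)).
    by rewrite -expRD /an; congr expR; ring.
  have -> : dl * c7 * (1 / 2) ^+ j = dl * (cD * (1 + cL)) * (C7 * (1 / 2) ^+ j) by rewrite /c7; ring.
  apply: ler_wpM2l (hC7 j).
  by apply: mulr_ge0 => //; apply: mulr_ge0 => //; rewrite addr_ge0.
have hFb i : pdec 1 (Fc i) (eps * CF).
  move=> l; apply: (@le_trans _ _ ((1 + supn l)%:R ^+ 1 * (eps * expR (- (r0 * phi a (supn l)%:R))))).
    by rewrite ler_wpM2l ?hF // exprn_ge0.
  by rewrite mulrCA -mulrA ler_wpM2l.
have kap0 : 0 <= dl * c7 by exact: mulr_ge0.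
have Eb0 : 0 <= eps * A * C8 by apply: mulr_ge0; [apply: mulr_ge0 => //|]; exact: ltW.
have [G [lam [g1 g2 g3 g4]]] := @kam_limit R n omega Fc st s E
  (fun j => D j + @Lam R n (P j) * D j) _ _ _ _ _ _ _
  (fun l => expR (- (nu * phi a (supn l)%:R))) st00 s0 sS gd he hl hDl Eb1 Del1
  kap0 (ltW CW0) Eb0 hW0 hCW hFb.
have n8 : 0 <= 8 * n1 ^+ 2 * A * C8 by [].
exists G, lam; split => //.
- move=> i l; apply: le_trans (g1 i l) _; rewrite ler_wpM2r // -/dl.
  have -> : 2 * (dl * c7) = 2 * c7 * dl by ring.
  rewrite ler_wpM2r // /Cm; move: Cm0 (2 * c7); move: (8 * n1 ^+ 2 * A * C8) => y1 h y2.
  by move: h; clear; lra.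
- move=> i; apply: le_trans (g3 i) _.
  have -> : 8 * n%:R ^+ 2 * (eps * A * C8) = 8 * n1 ^+ 2 * A * C8 * eps by rewrite /n1; ring.
  by rewrite ler_wpM2r // /Cm addrAC lerDr addr_ge0 // mulr_ge0.
Qed.

End Main.

(** * Smoothness of near-identity maps and of their inverses *)

Section Calculus.
Context {R : realType} {n : nat}.
Local Notation U := 'rV[R]_n.
Implicit Types (x y h v : U) (M : 'M[R]_n) (B : R).

Lemma le_mulmx_norm h M B : 0 <= B -> (forall i j, `|M i j| <= B) ->
  `|h *m M| <= n%:R * B * `|h|.
Proof.
move=> B0 hM; apply: mx_normr_le => [|j]; first by rewrite !mulr_ge0.
rewrite mxE; apply: le_trans (ler_norm_sum _ _ _) _.
apply: (@le_trans _ _ (\sum_(i < n) B * `|h|)).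
  by apply: ler_sum => i _; rewrite normrM mulrC ler_pM // normr_le_mx.
by rewrite sumr_const card_ord -[leRHS]mulrA mulr_natl.
Qed.

Lemma mx_entries_bound M : exists2 B, 0 <= B & forall i j, `|M i j| <= B.
Proof.
exists (\sum_i \sum_j `|M i j|); first by apply: sumr_ge0 => i _; exact: sumr_ge0.
move=> i j; rewrite (bigD1 i) //= (bigD1 j) //= -addrA lerDl addr_ge0 //.
  exact: sumr_ge0.
by apply: sumr_ge0 => i' _; exact: sumr_ge0.
Qed.

Section Quadratic.
Variables (f : U -> U) (x : U) (M : 'M[R]_n) (B : R).
Hypothesis hf : forall h, `|f (x + h) - f x - h *m M| <= B * `|h| ^+ 2.

Lemma quad_small (e : R) : 0 < e -> exists2 d, 0 < d & forall h, `|h| < d ->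
  `|f (x + h) - f x - h *m M| <= e * `|h|.
Proof.
move=> e0; have B1 : 0 < `|B| + 1 by rewrite ltr_wpDl.
exists (e / (`|B| + 1)); first by rewrite divr_gt0.
move=> h; rewrite ltr_pdivlMr // => hd; apply: le_trans (hf h) _.
rewrite expr2 mulrA ler_wpM2r //; apply: le_trans (ltW hd); rewrite mulrC ler_wpM2l //.
by apply: le_trans (ler_norm _) _; rewrite lerDl.
Qed.

Lemma quad_continuous : (f @ x --> f x)%classic.
Proof.
have [C C0 hC] := mx_entries_bound M.
apply/(@cvgrPdist_le _ _ _ (nbhs x) (nbhs_filter x)) => e e0.
have [d d0 hd] := quad_small ltr01.
pose C' := n%:R * C + 1; have C'0 : 0 < C' by rewrite ltr_wpDl // mulr_ge0.
apply/(@nbhs_normP _ _ x); exists (Num.min d (e / C')); first by rewrite /= lt_min d0 divr_gt0.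
move=> y; rewrite /ball_ /= lt_min distrC => /andP[yx /ltW yx'].
have := hd _ yx; rewrite mul1r [x + _]addrC subrK => h1.
rewrite distrC.
rewrite -(subrK ((y - x) *m M) (f y - f x)); apply: le_trans (ler_normD _ _) _.
apply: (@le_trans _ _ (C' * `|y - x|)); last by rewrite mulrC -ler_pdivlMr.
rewrite /C' mulrDl mul1r addrC; apply: lerD; first exact: le_mulmx_norm.
exact: h1.
Qed.

Lemma quad_derive_cvg v :
  ((fun t => t^-1 *: ((f \o shift x) (t *: v) - f x)) @ (0 : R)^' --> v *m M)%classic.
Proof.
apply/cvgrPdist_le => e e0.
have v1 : 0 < `|v| + 1 by rewrite ltr_wpDl.
have [d d0 hd] := quad_small (divr_gt0 e0 v1).
near=> t.
have t0 : t != 0 by near: t; exact: nbhs_dnbhs_neq.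
have tn : 0 < `|t| by rewrite normr_gt0.
have td : `|t| <= d / 2 / (`|v| + 1).
  near: t; apply: dnbhs0_le; first by rewrite !divr_gt0.
have tv : `|t *: v| < d.
  rewrite normrZ; apply: (@le_lt_trans _ _ (d / 2)); last by rewrite gtr_pMr // invf_lt1 // ltr1n.
  rewrite ler_pdivlMr // in td; apply: le_trans td.
  by rewrite ler_wpM2l // lerDl.
have h1 := hd _ tv; rewrite -scalemxAl distrC [x + _]addrC in h1.
rewrite /= -[v *m M](scalerK t0) -scalerBr normrZ normfV ler_pdivrMl //.
apply: le_trans h1 _; rewrite normrZ mulrCA ler_wpM2l // mulrAC ler_pdivrMr //.
by rewrite ler_wpM2l ?(ltW e0) // lerDl.
Unshelve. all: by end_near.
Qed.

Lemma quad_derive v : derivable f x v /\ 'D_v f x = v *m M.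
Proof.
have H := @quad_derive_cvg v.
split; first by apply/cvg_ex; exists (v *m M).
exact: cvg_lim.
Qed.

(** The quadratic bound is in particular a little-o, so uniqueness of the differential applies once
    right multiplication by [M] is known to be continuous. *)
Lemma quad_jacobian : jacobian f x = M.
Proof.
have [C C0 hC] := mx_entries_bound M.
have cM : continuous (mulmxr M : U -> U).
  move=> y; change (mulmxr M @ y --> mulmxr M y)%classic.
  apply/(@cvgrPdist_le _ _ _ (nbhs y) (nbhs_filter y)) => e e0.
  have c0 : 0 < n%:R * C + 1 by rewrite ltr_wpDl // mulr_ge0.
  apply/(@nbhs_normP _ _ y); exists (e / (n%:R * C + 1)); first by rewrite /= divr_gt0.
  move=> z; rewrite /ball_ /= => /ltW yz.
  have := le_mulmx_norm (y - z) C0 hC; rewrite mulmxBl => h; apply: le_trans h _.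
  apply: (@le_trans _ _ ((n%:R * C + 1) * `|y - z|)); first by rewrite ler_wpM2r // lerDl.
  by rewrite mulrC -ler_pdivlMr.
have E : 'd f x = mulmxr M :> (U -> U).
  apply: diff_unique => //; apply/eqaddoP => e e0 /=.
  have [d d0 hd] := quad_small e0.
  have : (\forall h \near nbhs (0 : U), `|f (h + x) - (f x + h *m M)| <= e * `|h|)%classic.
    apply/(@nbhs_normP _ _ (0 : U)); exists d => //= h; rewrite /ball_ /= sub0r normrN => hh.
    by have := hd h hh; rewrite [h + x]addrC opprD addrA.
  exact.
apply/row_matrixP => i; rewrite !rowE /jacobian mul_rV_lin1.
by rewrite E.
Qed.

End Quadratic.
End Calculus.

(** * An algebra of functions closed under differentiation *)

Section SmoothClass.
Context {R : realType} {n : nat}.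
Local Notation U := 'rV[R]_n.
Implicit Types (x y h : U) (f g : U -> R) (df dg : 'I_n -> U -> R).

(** The three uniform bounds are kept together because they are only jointly stable: the
    second-order remainder of a product involves the sizes and the increments of both factors. *)
Definition qd f df := exists2 B, 0 <= B & [/\ forall x, `|f x| <= B,
  forall x h, `|f (x + h) - f x| <= B * `|h| &
  forall x h, `|f (x + h) - f x - \sum_j h 0 j * df j x| <= B * `|h| ^+ 2].

Lemma qd_cst (c : R) : qd (fun=> c) (fun _ _ => 0).
Proof.
exists `|c| => //; split=> [x|x h|x h]; rewrite ?subrr ?normr0 ?mulr_ge0 //.
rewrite big1 ?subrr ?normr0 ?mulr_ge0 ?exprn_ge0 // => j _; exact: mulr0.
Qed.

Lemma qdD f g df dg : qd f df -> qd g dg ->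
  qd (fun x => f x + g x) (fun j x => df j x + dg j x).
Proof.
move=> [B B0 [f0 f1 f2]] [B' B'0 [g0 g1 g2]]; exists (B + B'); rewrite ?addr_ge0 //.
split=> [x|x h|x h]; rewrite ?mulrDl.
- by apply: le_trans (ler_normD _ _) _; exact: lerD.
- rewrite (_ : _ - _ = (f (x + h) - f x) + (g (x + h) - g x)); last by ring.
  by apply: le_trans (ler_normD _ _) _; exact: lerD.
rewrite (eq_bigr (fun j => h 0 j * df j x + h 0 j * dg j x)); last by move=> j _; rewrite mulrDr.
rewrite big_split /=.
move: (f2 x h) (g2 x h); move: (\sum_j _) => s; move: (\sum_j _) => t fs gs.
rewrite (_ : _ - _ = (f (x + h) - f x - s) + (g (x + h) - g x - t)); last by ring.
by apply: le_trans (ler_normD _ _) _; exact: lerD.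
Qed.

Lemma qdM f g df dg : qd f df -> qd g dg ->
  qd (fun x => f x * g x) (fun j x => df j x * g x + f x * dg j x).
Proof.
move=> [B B0 [f0 f1 f2]] [B' B'0 [g0 g1 g2]]; have BB := mulr_ge0 B0 B'0.
exists (3 * (B * B')); first by rewrite mulr_ge0.
split=> [x|x h|x h].
- by rewrite normrM; apply: le_trans (ler_pM _ _ (f0 x) (g0 x)) _ => //; rewrite ler_peMl // ler1n.
- rewrite (_ : _ - _ = (f (x + h) - f x) * g (x + h) + f x * (g (x + h) - g x)); last by ring.
  apply: le_trans (ler_normD _ _) _; rewrite !normrM.
  apply: le_trans (lerD (ler_pM _ _ (f1 x h) (g0 _)) (ler_pM _ _ (f0 x) (g1 x h))) _ => //.
  have := mulr_ge0 BB (normr_ge0 h); move: `|h| => t.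
  by rewrite (_ : 3 * (B * B') * t = B * t * B' + B * (B' * t) + B * B' * t); [rewrite lerDl|ring].
rewrite (eq_bigr (fun j => h 0 j * df j x * g x + f x * (h 0 j * dg j x))); last first.
  by move=> j _; ring.
rewrite big_split /= -mulr_suml -mulr_sumr.
move: (f2 x h) (g2 x h) (f1 x h) (g1 x h); move: (\sum_j _) => s; move: (\sum_j _) => t fs gs f1' g1'.
rewrite (_ : _ - _ = (f (x + h) - f x - s) * g x + f x * (g (x + h) - g x - t) +
    (f (x + h) - f x) * (g (x + h) - g x)); last by ring.
apply: le_trans (ler_normD _ _) _; apply: le_trans (lerD (ler_normD _ _) (lexx _)) _.
rewrite !normrM; apply: le_trans (lerD (lerD (ler_pM _ _ fs (g0 x)) (ler_pM _ _ (f0 x) gs))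
   (ler_pM _ _ f1' g1')) _ => //.
by rewrite le_eqVlt; apply/orP; left; apply/eqP; ring.
Qed.

(** The derivative of the inverse is written with constants and products only, so that it visibly
    belongs to the class [cls]. *)
Lemma qdV f df (b : R) : qd f df -> (forall x, f x != 0) -> (forall x, `|(f x)^-1| <= b) ->
  qd (fun x => (f x)^-1) (fun j x => - 1 * ((f x)^-1 * (f x)^-1 * df j x)).
Proof.
move=> [B B0 [f0 f1 f2]] fn hb; have b0 : 0 <= b := le_trans (normr_ge0 _) (hb 0).
have b1 x y : `|(f x)^-1 * (f y)^-1| <= b ^+ 2 by rewrite normrM expr2 ler_pM.
have BB := mulr_ge0 B0 (sqr_ge0 b); have BBB := mulr_ge0 (mulr_ge0 B0 B0) (exprn_ge0 3 b0).
exists (b + B * b ^+ 2 + B * B * b ^+ 3); first by rewrite !addr_ge0.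
split=> [x|x h|x h].
- by apply: le_trans (hb x) _; rewrite -addrA lerDl addr_ge0.
- rewrite (_ : _ - _ = - ((f (x + h) - f x) * ((f x)^-1 * (f (x + h))^-1))); last first.
    by field; rewrite !fn.
  rewrite normrN normrM; apply: le_trans (ler_pM _ _ (f1 x h) (b1 _ _)) _ => //.
  rewrite mulrAC ler_wpM2r // addrAC lerDr addr_ge0 //.
rewrite (eq_bigr (fun j => h 0 j * df j x * (- ((f x)^-1 * (f x)^-1)))); last first.
  by move=> j _; ring.
rewrite -mulr_suml.
move: (f2 x h) (f1 x h) (f1 x h); move: (\sum_j _) => s fs f1' f1''.
rewrite (_ : _ - _ = - ((f (x + h) - f x - s) * ((f x)^-1 * (f x)^-1)) +
    (f (x + h) - f x) * (f (x + h) - f x) * ((f x)^-1 * (f x)^-1 * (f (x + h))^-1)); last first.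
  by field; rewrite !fn.
apply: le_trans (ler_normD _ _) _; rewrite normrN (normrM (_ - _ - _)) !(normrM (_ * _)).
have b3 : `|(f x)^-1 * (f x)^-1| * `|(f (x + h))^-1| <= b ^+ 3.
  by rewrite [b ^+ 3]exprSr ler_pM.
rewrite (normrM (_ - _)).
apply: le_trans (lerD (ler_pM _ _ fs (b1 _ _)) (ler_pM _ _ (ler_pM _ _ f1' f1'') b3)) _ => //.
rewrite (_ : _ + _ = (B * b ^+ 2 + B * B * b ^+ 3) * `|h| ^+ 2); last by ring.
by rewrite ler_wpM2r ?exprn_ge0 // -addrA lerDr.
Qed.

(* If S is closed under partial derivatives then so is [cls S]. It also contains the entries of the
   inverse of a Jacobian with entries in S, through Cramer's formula; hence the derivatives of the
   inverse map Psi of Phi are compositions of functions of the class with Psi. *)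
Inductive cls (S : (U -> R) -> Prop) : (U -> R) -> Prop :=
| cls_base f : S f -> cls S f
| cls_cst c : cls S (fun=> c)
| cls_add f g : cls S f -> cls S g -> cls S (fun x => f x + g x)
| cls_mul f g : cls S f -> cls S g -> cls S (fun x => f x * g x)
| cls_inv f b : cls S f -> (forall x, f x != 0) -> (forall x, `|(f x)^-1| <= b) ->
    cls S (fun x => (f x)^-1).

Variable S : (U -> R) -> Prop.
Hypothesis HS : forall f, S f -> exists df, qd f df /\ forall j, S (df j).

Lemma cls_qd f : cls S f -> exists df, qd f df /\ forall j, cls S (df j).
Proof.
elim=> {f} [f /HS[df [h hd]]|c|f g _ [df [hf cf]] _ [dg [hg cg]]|f g sf [df [hf cf]] sg [dg [hg cg]]
   |f b sf [df [hf cf]] f0 fb].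
- by exists df; split=> // j; exact: cls_base.
- by exists (fun _ _ => 0); split; [exact: qd_cst|move=> j; exact: cls_cst].
- exists (fun j x => df j x + dg j x); split; first exact: qdD.
  by move=> j; exact: cls_add.
- exists (fun j x => df j x * g x + f x * dg j x); split; first exact: qdM.
  by move=> j; apply: cls_add; exact: cls_mul.
exists (fun j x => - 1 * ((f x)^-1 * (f x)^-1 * df j x)); split; first exact: (qdV (b := b)).
move=> j; apply: cls_mul; first exact: cls_cst.
by apply: cls_mul => //; apply: cls_mul; exact: (cls_inv (b := b)).
Qed.

Lemma cls_ext f g : f =1 g -> cls S f -> cls S g.
Proof. by move=> /funext ->. Qed.

Lemma cls_sum (I : Type) (r : seq I) (P : pred I) (F : I -> U -> R) :
  (forall i, P i -> cls S (F i)) -> cls S (fun x => \sum_(i <- r | P i) F i x).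
Proof.
move=> h; elim: r => [|i r IH].
  by apply: cls_ext (cls_cst S 0) => x; rewrite big_nil.
apply: (@cls_ext (fun x => (if P i then F i x else 0) + \sum_(j <- r | P j) F j x)).
  by move=> x; rewrite big_cons; case: (P i); rewrite ?add0r.
by apply: cls_add => //; case E: (P i); [exact: h | exact: cls_cst].
Qed.

Lemma cls_prod (I : Type) (r : seq I) (F : I -> U -> R) :
  (forall i, cls S (F i)) -> cls S (fun x => \prod_(i <- r) F i x).
Proof.
move=> h; elim: r => [|i r IH].
  by apply: cls_ext (cls_cst S 1) => x; rewrite big_nil.
apply: (@cls_ext (fun x => F i x * \prod_(j <- r) F j x)); first by move=> x; rewrite big_cons.
exact: cls_mul.
Qed.

Lemma cls_det m (A : U -> 'M[R]_m) : (forall i j, cls S (fun x => A x i j)) ->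
  cls S (fun x => \det (A x)).
Proof.
move=> h; apply: cls_sum => s _; apply: cls_mul; first exact: cls_cst.
exact: cls_prod.
Qed.

Lemma det_bound m (A : 'M[R]_m) b : (forall i j, `|A i j| <= b) ->
  `|\det A| <= \sum_(s : 'S_m) \prod_(i < m) b.
Proof.
move=> h; apply: le_trans (ler_norm_sum _ _ _) _; apply: ler_sum => s _.
rewrite normrM normrX normrN1 expr1n mul1r normr_prod.
by apply: ler_prod => i _; rewrite normr_ge0 h.
Qed.

Lemma cls_invmx m (A : U -> 'M[R]_m) b : (forall i j, cls S (fun x => A x i j)) ->
  (forall x, A x \in unitmx) -> (forall x i j, `|invmx (A x) i j| <= b) ->
  forall i j, cls S (fun x => invmx (A x) i j).
Proof.
move=> hA uA hb i j.
have -> : (fun x => invmx (A x) i j) = (fun x => (\det (A x))^-1 * cofactor (A x) j i).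
  by apply/funext => x; rewrite /invmx uA !mxE.
apply: cls_mul.
  (* The determinant is uniformly away from 0 because its inverse is the determinant of the inverse
     matrix, whose entries are bounded. *)
  apply: (cls_inv (b := \sum_(s : 'S_m) \prod_(i < m) b)); first exact: cls_det.
    by move=> x; have := uA x; rewrite unitmxE unitfE.
  by move=> x; rewrite -det_inv; exact: det_bound.
apply: cls_mul; first exact: cls_cst.
by apply: cls_det => i' j'; apply: cls_ext (hA (lift j i') (lift i j')) => x; rewrite !mxE.
Qed.

Lemma fin_bound (P : 'I_n -> R -> Prop) : (forall j b b', b <= b' -> P j b -> P j b') ->
  (forall j, exists b, P j b) -> exists2 b, 0 <= b & forall j, P j b.
Proof.
move=> mono /choice[b hb]; exists (\sum_j `|b j|); first exact: sumr_ge0.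
move=> j; apply: mono (hb j); rewrite (bigD1 j) //=.
by apply: le_trans (ler_norm _) _; rewrite lerDl sumr_ge0.
Qed.

Section Composition.
Variables (Psi : U -> U) (M : U -> 'M[R]_n) (B : R).
Hypothesis B0 : 0 <= B.
Hypothesis Psi1 : forall y h, `|Psi (y + h) - Psi y| <= B * `|h|.
Hypothesis Psi2 : forall y h, `|Psi (y + h) - Psi y - h *m M (Psi y)| <= B * `|h| ^+ 2.
Hypothesis hM : forall i j, cls S (fun x => M x i j).

(** The chain rule in autonomous form: the derivative of [Psi] is itself a class function of
    [Psi y], so differentiating [f (Psi y)] yields again class functions evaluated at [Psi y]. *)
Lemma cls_comp f : cls S f -> exists df, (forall i, cls S (df i)) /\
  exists b, forall y h, `|f (Psi (y + h)) - f (Psi y) - \sum_i h 0 i * df i (Psi y)| <= b * `|h| ^+ 2.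
Proof.
move=> /cls_qd[df [[Bf Bf0 [_ _ f2]] hdf]].
exists (fun i x => \sum_j M x i j * df j x); split.
  by move=> i; apply: cls_sum => j _; exact: cls_mul.
have [C C0 hC] : exists2 C, 0 <= C & forall j x, `|df j x| <= C.
  apply: (@fin_bound (fun j b => forall x, `|df j x| <= b)).
    by move=> j b b' bb h x; exact: le_trans (h x) bb.
  by move=> j; have [ddf [[b _ [h _ _]] _]] := cls_qd (hdf j); exists b.
exists (Bf * B ^+ 2 + n%:R * (B * C)) => y h.
pose de := Psi (y + h) - Psi y.
have -> : \sum_i h 0 i * (\sum_j M (Psi y) i j * df j (Psi y)) =
    \sum_j (h *m M (Psi y)) 0 j * df j (Psi y).
  rewrite (eq_bigr (fun i => \sum_j h 0 i * M (Psi y) i j * df j (Psi y))); last first.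
    by move=> i _; rewrite mulr_sumr; apply: eq_bigr => j _; rewrite mulrA.
  by rewrite exchange_big /=; apply: eq_bigr => j _; rewrite mxE mulr_suml.
have -> : Psi (y + h) = Psi y + de by rewrite /de [RHS]addrC subrK.
have -> : f (Psi y + de) - f (Psi y) - \sum_j (h *m M (Psi y)) 0 j * df j (Psi y) =
  (f (Psi y + de) - f (Psi y) - \sum_j de 0 j * df j (Psi y)) +
  \sum_j (de - h *m M (Psi y)) 0 j * df j (Psi y).
  rewrite [X in _ = _ + X](eq_bigr (fun j => de 0 j * df j (Psi y) -
     (h *m M (Psi y)) 0 j * df j (Psi y))); last by move=> j _; rewrite mxE [X in _ + X]mxE mulrBl.
  by rewrite sumrB; ring.
apply: le_trans (ler_normD _ _) _; rewrite mulrDl; apply: lerD.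
  apply: le_trans (f2 _ _) _; rewrite -mulrA ler_wpM2l // -exprMn lerXn2r ?nnegrE ?mulr_ge0 //.
  exact: Psi1.
apply: le_trans (ler_norm_sum _ _ _) _.
apply: (@le_trans _ _ (\sum_(j < n) B * `|h| ^+ 2 * C)).
  apply: ler_sum => j _; rewrite normrM ler_pM //.
  exact: le_trans (normr_le_mx _ _) (Psi2 _ _).
rewrite sumr_const card_ord -mulr_natl le_eqVlt; apply/orP; left; apply/eqP; ring.
Qed.

(** Lifts of torus maps are unbounded, whereas class functions are bounded; the linear part [c]
    makes up for this and disappears after one differentiation. *)
Definition affcls (F : U -> U) := forall i, exists (c : U) f,
  cls S f /\ forall y, F y 0 i = dotp c y + f (Psi y).

Lemma affcls_deriv F : affcls F -> exists M' : U -> 'M[R]_n, exists b,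
  (forall y h, `|F (y + h) - F y - h *m M' y| <= b * `|h| ^+ 2) /\
  forall i, affcls (fun y => row i (M' y)).
Proof.
move=> /choice[c /choice[f hf]].
have /choice[df hdf] : forall i, exists df, (forall j, cls S (df j)) /\ exists b, forall y h,
   `|f i (Psi (y + h)) - f i (Psi y) - \sum_j h 0 j * df j (Psi y)| <= b * `|h| ^+ 2.
  by move=> i; apply: cls_comp; case: (hf i).
pose M' y : 'M[R]_n := \matrix_(j, i) (c i 0 j + df i j (Psi y)).
have [b b0 hb] : exists2 b, 0 <= b & forall i y h,
   `|f i (Psi (y + h)) - f i (Psi y) - \sum_j h 0 j * df i j (Psi y)| <= b * `|h| ^+ 2.
  apply: (@fin_bound (fun i b => forall y h,
   `|f i (Psi (y + h)) - f i (Psi y) - \sum_j h 0 j * df i j (Psi y)| <= b * `|h| ^+ 2)).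
    by move=> i b b' bb h y k; apply: le_trans (h y k) _; rewrite ler_wpM2r ?exprn_ge0.
  by move=> i; case: (hdf i).
exists M', b; split.
  move=> y h; apply: mx_normr_le => [|i]; first by rewrite mulr_ge0 ?exprn_ge0.
  apply: le_trans (hb i y h); rewrite le_eqVlt; apply/orP; left; apply/eqP; congr `|_|.
  rewrite !mxE !(hf i).2 /dotp.
  under [X in _ - X = _]eq_bigr do rewrite mxE mulrDr.
  under [X in X + _ - _ - _]eq_bigr do rewrite mxE mulrDr.
  rewrite !big_split /=.
  have -> : \sum_(j < n) h 0 j * c i 0 j = \sum_(j < n) c i 0 j * h 0 j.
    by apply: eq_bigr => j _; rewrite mulrC.
  by ring.
move=> j i; exists 0, (fun x => c i 0 j + df i j x); split.
  by apply: cls_add; [exact: cls_cst | exact: (hdf i).1].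
by move=> y; rewrite !mxE /dotp big1 ?add0r // => l _; rewrite mxE mul0r.
Qed.

Lemma affcls_smooth F : affcls F -> smooth F.
Proof.
move=> hF m; elim: m F hF => [|m IH] F /[dup] hF /affcls_deriv[M' [b [hq hr]]].
  by move=> y; exact: (quad_continuous (hq y)).
split; first by move=> y; exact: (quad_continuous (hq y)).
move=> i; split; first by move=> y; case: (quad_derive (hq y) (delta_mx 0 i)).
have -> : (fun y => 'D_(delta_mx 0 i) F y) = (fun y => row i (M' y)).
  by apply/funext => y; case: (quad_derive (hq y) (delta_mx 0 i)) => _ ->; rewrite rowE.
exact: IH.
Qed.

End Composition.
End SmoothClass.

(** * Inversion of near-identity maps *)

Section NearIdentity.
Context {R : realType} {n : nat}.
Local Notation U := 'rV[R]_n.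
Local Notation C := R[i].
Implicit Types (x y h : U).

Lemma near1_real (A : 'M[R]_n) (m : R) : n%:R * m <= 1 / 2 ->
  (forall i j, `|(A - 1%:M) i j| <= m) ->
  A \in unitmx /\ forall i j, `|invmx A i j| <= 2.
Proof.
move=> nm hA; pose AC := map_mx (real_complex R) A.
have hAC i j : nc ((AC - 1%:M) i j) <= m.
  have -> : AC - 1%:M = map_mx (real_complex R) (A - 1%:M) by rewrite map_mxB map_mx1.
  by rewrite mxE nc_cR.
have uA : AC \in unitmx := near1_unit hAC nm.
split; first by rewrite -(map_unitmx (real_complex R)).
move=> i j; rewrite -nc_cR; have := nc_inv hAC nm i j.
by rewrite -map_invmx mxE.
Qed.

Variables (S : (U -> R) -> Prop) (u : U -> U) (D : U -> 'M[R]_n) (B m : R).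
Hypothesis HS : forall f, S f -> exists df, qd f df /\ forall j, S (df j).
Hypothesis Su : forall i, S (fun x => u x 0 i).
Hypothesis SD : forall i j, S (fun x => D x i j).
Hypothesis B0 : 0 <= B.
Hypothesis nm : n%:R * m <= 1 / 2.
Hypothesis Db : forall x i j, `|D x i j| <= m.
Hypothesis u1 : forall x h, `|u (x + h) - u x| <= 1 / 2 * `|h|.
Hypothesis u2 : forall x h, `|u (x + h) - u x - h *m D x| <= B * `|h| ^+ 2.

Let Phi x := x + u x.
Let J x := 1%:M + D x.

Lemma nearid_unit x : J x \in unitmx /\ forall i j, `|invmx (J x) i j| <= 2.
Proof. by apply: (near1_real nm) => i j; rewrite /J addrAC subrr add0r. Qed.

Lemma nearid_lip x y : `|u x - u y| <= 1 / 2 * `|x - y|.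
Proof. by have := u1 y (x - y); rewrite [y + _]addrC subrK. Qed.

Lemma nearid_expand x y : `|x - y| <= 2 * `|Phi x - Phi y|.
Proof.
have E : x - y = (Phi x - Phi y) - (u x - u y) by rewrite /Phi opprD addrACA addrK.
have := nearid_lip x y; have := ler_normB (Phi x - Phi y) (u x - u y); rewrite -E.
move: `|_| `|_| `|_| => t1 t2 t3; lra.
Qed.

Lemma nearid_quad x h : `|Phi (x + h) - Phi x - h *m J x| <= B * `|h| ^+ 2.
Proof.
apply: le_trans (u2 x h); rewrite le_eqVlt; apply/orP; left; apply/eqP; congr `|_|.
rewrite /Phi /J mulmxDr mulmx1.
apply/rowP => i; rewrite !mxE; ring.
Qed.

(** Fixed-point iteration for [x = y - u x], a contraction of ratio 1/2, with the limit taken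
    coordinate by coordinate. *)
Lemma nearid_surj y : exists x, Phi x = y.
Proof.
pose xs := fix xs j := if j is j'.+1 then y - u (xs j') else 0.
have d j : `|xs j.+1 - xs j| <= (1 / 2) ^+ j * `|xs 1%N - xs 0%N|.
  elim: j => [|j IH]; first by rewrite expr0 mul1r.
  have -> : xs j.+2 - xs j.+1 = u (xs j) - u (xs j.+1).
    by apply/rowP => i; rewrite !mxE; ring.
  apply: le_trans (nearid_lip _ _) _; rewrite exprS -[leRHS]mulrA ler_wpM2l ?divr_ge0 //.
  by rewrite distrC.
have b0 := normr_ge0 (xs 1%N - xs 0%N); move: `|_| b0 d => b b0 d.
have /choice[l hl] : forall i, exists l : C, forall j, nc (l - cR (xs j 0 i)) <= 2 * b * (1 / 2) ^+ j.
  move=> i; apply: geo_lim => [|j]; first exact: b0.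
  rewrite -cRB nc_cR mulrC; apply: le_trans (d j).
  by have := normr_le_mx (xs j.+1 - xs j) i; rewrite !mxE.
pose x : U := \row_i complex.Re (l i).
have hx j : `|x - xs j| <= 2 * b * (1 / 2) ^+ j.
  apply: mx_normr_le => [|i]; first by apply: mulr_ge0; [exact: mulr_ge0 | rewrite exprn_ge0 ?divr_ge0].
  by apply: le_trans (hl i j); apply: le_trans (nc_Re _); rewrite !mxE; case: (l i).
exists x; apply/eqP; rewrite -subr_eq0 -normr_le0; apply/ler_addgt0Pl => e e0; rewrite addr0.
have [j0 hj] := half_small (2 * b) e0.
have := hj _ (leqnn j0); apply: le_trans.
have -> : Phi x - y = (x - xs j0.+1) + (u x - u (xs j0)).
  by rewrite /Phi /= opprB; apply/rowP => i; rewrite !mxE; ring.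
apply: le_trans (ler_normD _ _) _; have := nearid_lip x (xs j0).
have := hx j0; have := hx j0.+1; rewrite exprS.
by move: `|_| `|_| `|_| (_ ^+ _) => t1 t2 t3 p; lra.
Qed.

Theorem nearid_diffeo : exists Psi,
  [/\ cancel Phi Psi, cancel Psi Phi, smooth Phi & smooth Psi].
Proof.
have /choice[Psi hPsi] := nearid_surj.
have K2 : cancel Psi Phi by [].
have K1 : cancel Phi Psi.
  move=> x; apply/eqP; rewrite -subr_eq0 -normr_le0; apply: le_trans (nearid_expand _ _) _.
  by rewrite K2 subrr normr0 mulr0.
have P1 y h : `|Psi (y + h) - Psi y| <= 2 * `|h|.
  by apply: le_trans (nearid_expand _ _) _; rewrite !K2 addrAC subrr add0r.
(* The expansion of [Phi] at [Psi y] is solved for the increment of [Psi]: [|de| <= 2 |h|] gives the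
   factor 4, and the inverse Jacobian, with entries at most 2, the factor [n * 2]. *)
have P2 y h : `|Psi (y + h) - Psi y - h *m invmx (J (Psi y))| <= n%:R * 2 * (4 * B) * `|h| ^+ 2.
  set de := Psi (y + h) - Psi y.
  have [uJ bJ] := nearid_unit (Psi y).
  have hd : h = Phi (Psi y + de) - Phi (Psi y).
    by rewrite /de [Psi y + _]addrC subrK !K2 addrAC subrr add0r.
  have q := nearid_quad (Psi y) de; rewrite -hd in q.
  have -> : de - h *m invmx (J (Psi y)) = - ((h - de *m J (Psi y)) *m invmx (J (Psi y))).
    by rewrite mulmxBl -mulmxA mulmxV // mulmx1 opprB.
  rewrite normrN; apply: le_trans (le_mulmx_norm _ _ bJ) _ => //.
  rewrite -[leRHS]mulrA ler_wpM2l ?mulr_ge0 //; apply: le_trans q _.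
  rewrite [4 * B]mulrC -mulrA ler_wpM2l //.
  have -> : 4 * `|h| ^+ 2 = (2 * `|h|) ^+ 2 :> R by ring.
  by rewrite lerXn2r ?nnegrE ?mulr_ge0 // /de P1.
pose T := n%:R * 2 * (4 * B) + 2.
have T1 : 0 <= T by rewrite addr_ge0 // !mulr_ge0.
exists Psi; split => //.
  (* [Phi] itself is handled by the same lemma, with the identity as inner map. *)
  apply: (@affcls_smooth _ _ S HS id (fun=> 1%:M) 1) => //.
  - by move=> y h; rewrite addrAC subrr add0r mul1r.
  - by move=> y h; rewrite /= mulmx1 (addrAC y) subrr add0r subrr normr0 mulr_ge0 ?exprn_ge0.
  - by move=> i j; exact: cls_cst.
  move=> i; exists (delta_mx 0 i), (fun x => u x 0 i); split; first exact: cls_base.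
  move=> y; rewrite mxE; congr (_ + _); rewrite /dotp (bigD1 i) //= big1 ?addr0.
    by rewrite mxE !eqxx mul1r.
  by move=> j ji; rewrite mxE eqxx (negPf ji) mul0r.
apply: (@affcls_smooth _ _ S HS Psi (fun x => invmx (J x)) T) => //.
- by move=> y h; apply: le_trans (P1 y h) _; rewrite ler_wpM2r // lerDr !mulr_ge0.
- by move=> y h; apply: le_trans (P2 y h) _; rewrite ler_wpM2r ?exprn_ge0 // lerDl.
- apply: (@cls_invmx _ _ S _ J 2).
  + move=> i j; apply: (@cls_ext _ _ S (fun x => (1%:M : 'M[R]_n) i j + D x i j)).
      by move=> x; rewrite !mxE.
    by apply: cls_add; [exact: cls_cst | exact: cls_base].
  + by move=> x; case: (nearid_unit x).
  + by move=> x; case: (nearid_unit x).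
move=> i; exists (delta_mx 0 i), (fun x => - 1 * u x 0 i); split.
  by apply: cls_mul; [exact: cls_cst | exact: cls_base].
(* The fixed-point equation shows [Psi] as the identity plus a class function of [Psi]; this starts
   the bootstrap to all orders. *)
move=> y; have {1}-> : Psi y = y - u (Psi y) by rewrite -{2}(K2 y) /Phi addrK.
rewrite !mxE mulN1r; congr (_ + _); rewrite /dotp (bigD1 i) //= big1 ?addr0.
  by rewrite mxE !eqxx mul1r.
by move=> j ji; rewrite mxE eqxx (negPf ji) mul0r.
Qed.

End NearIdentity.

(** * Diffeomorphisms given by Fourier series *)

Section FourierDiffeo.
Context {R : realType} {n : nat}.
Local Notation C := R[i].
Local Notation U := 'rV[R]_n.
Local Notation K := 'rV[int]_n.
Local Notation CN := (@Cn R n).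
Implicit Types (x y h : U) (k l : K) (a c : K -> C).

Lemma sum_pw_tail (A : seq K) N : uniq A ->
  \sum_(k <- A | (N < supn k)%N) pw k <= @Tl R n N.
Proof.
move=> uA; pose M := maxn N (\max_(k <- A) supn k).
have AM k : k \in A -> k \in @box n M.
  by move=> kA; rewrite mem_box leq_max (leq_bigmax_seq k) ?orbT.
have hM : \sum_(k <- @box n M | (N < supn k)%N) pw k <= @Tl R n N.
  rewrite /Tl -[leLHS](addKr (@pwbox R n N)) addrC lerD2r //.
  by rewrite /pwbox -(box_split _ (leq_maxl _ _)) le_pwbox.
apply: le_trans hM; rewrite [leRHS](bigID (mem A)) /= -[leLHS]addr0; apply: lerD.
  rewrite -big_filter -[leRHS]big_filter le_eqVlt; apply/orP; left; apply/eqP/perm_big.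
  apply: uniq_perm; rewrite ?filter_uniq ?box_uniq // => k.
  rewrite !mem_filter; case kA: (k \in A); last by rewrite !andbF.
  by rewrite (AM _ kA) !andbT.
by apply: sumr_ge0 => k _; exact: pw_ge0.
Qed.

(** Partial sums over arbitrary finite sets containing a large box are needed because [feval] uses
    unconditional summation; what such a set contains beyond the box is controlled by the tail. *)
Lemma tsum_fset a B N (A : seq K) : dom a B -> uniq A -> {subset @box n N <= A} ->
  nc (tsum a - \sum_(k <- A) a k) <= 2 * B * @Tl R n N.
Proof.
move=> da uA sA; have B0 := dom_ge0 da.
have -> : \sum_(k <- A) a k = Sbox N a + \sum_(k <- A | (N < supn k)%N) a k.
  rewrite (bigID (fun k => (supn k <= N)%N)) /=; congr (_ + _); last first.
    by apply: eq_bigl => k; rewrite ltnNge.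
  rewrite -big_filter; apply: perm_big; apply: uniq_perm; rewrite ?filter_uniq ?box_uniq // => k.
  rewrite mem_filter mem_box; case: leqP => //= kb.
  by rewrite sA // mem_box.
rewrite opprD addrA; apply: le_trans (ncB _ _) _.
rewrite (_ : 2 * B * _ = B * @Tl R n N + B * @Tl R n N); last by ring.
apply: lerD; first exact: tsum_tail.
apply: le_trans (nc_sum _ _ _) _; apply: (@le_trans _ _ (\sum_(k <- A | (N < supn k)%N) B * pw k)).
  by apply: ler_sum => k _; exact: da.
by rewrite -mulr_sumr ler_wpM2l // sum_pw_tail.
Qed.

Lemma feval_ser c x B : pdec 0 c B -> feval c x = complex.Re (ser c (toC x)).
Proof.
move=> hc; have hx : l1im (toC x) <= 0 by rewrite l1im_toC.
have d := pdec_dom hc hx; have B0 := dom_ge0 d.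
have PF := @summability.totally_filter K.
have FF : Filter (@summability.totally K) by exact: filter_filter.
set g : K -> R^o := fun k => complex.Re (c k * expi (2 * pi * dotp (toR k) x)).
suff H : (summability.partial_sum g @ @summability.totally K --> (complex.Re (ser c (toC x)) : R^o))%classic.
  exact: cvg_lim H.
have := @cvgrPdist_le R R^o _ _ FF (summability.partial_sum g) (complex.Re (ser c (toC x))).
move=> [_]; apply=> e /(@small_MTl R n (2 * B))[N hN].
exists [fset k in @box n N]%fset => //= A hA.
have -> : summability.partial_sum g A = complex.Re (\sum_(k <- A) c k * ek k (toC x)).
  rewrite /summability.partial_sum Re_sum big_seq_fsetE /=.
  by apply: eq_bigr => k _; rewrite ek_toC.
rewrite -ReN -ReD; apply: le_trans (nc_Re _) _; apply: le_trans (hN N (leqnn _)).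
apply: tsum_fset d (fset_uniq A) _ => k kb; apply: (fsubsetP hA); by rewrite inE.
Qed.

Definition serR c x := complex.Re (ser c (toC x)).

(** The base class for the smoothness argument: decay beyond every power is preserved by
    multiplication with frequencies, that is by differentiation. *)
Definition rapid (f : U -> R) := exists c,
  (forall m, exists B, pdec m c B) /\ f = serR c.

Lemma serR_lip B c x h : pdec 1 c B ->
  `|serR c (x + h) - serR c x| <= 2 * pi * n%:R * B * CN * `|h|.
Proof.
by move=> hc; rewrite /serR -ReN -ReD; apply: le_trans (nc_Re _) (ser_lip_real _ _ hc).
Qed.

Lemma serR_taylor B c x h : pdec 2 c B ->
  `|serR c (x + h) - serR c x - \sum_j h 0 j * serR (dc j c) x| <=
    2 * (2 * pi * n%:R) ^+ 2 * B * CN * `|h| ^+ 2.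
Proof.
move=> hc; apply: le_trans (ser_taylor x h hc); apply: le_trans (nc_Re _).
rewrite !ReD !ReN Re_sum; under eq_bigr do rewrite -Re_cRM.
exact: lexx.
Qed.

Lemma rapid_qd f : rapid f -> exists df, qd f df /\ forall j, rapid (df j).
Proof.
move=> [c [hc ->]]; exists (fun j => serR (dc j c)); split; last first.
  move=> j; exists (dc j c); split=> // m; have [B hB] := hc m.+1.
  by exists (2 * pi * B); exact: pdec_dc.
have [B0 h0] := hc 0%N; have [B1 h1] := hc 1%N; have [B2 h2] := hc 2%N.
have b0 : 0 <= B0 * CN by rewrite mulr_ge0 ?(pdec_ge0 h0) // ltW // Cn_gt0.
have b1 : 0 <= 2 * pi * n%:R * B1 * CN.
  by rewrite mulr_ge0 ?(ltW Cn_gt0) // mulr_ge0 ?(pdec_ge0 h1) // mulr_ge0 ?pi2_ge0.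
have b2 : 0 <= 2 * (2 * pi * n%:R) ^+ 2 * B2 * CN.
  by rewrite mulr_ge0 ?(ltW Cn_gt0) // mulr_ge0 ?(pdec_ge0 h2) // mulr_ge0 ?sqr_ge0.
exists (B0 * CN + (2 * pi * n%:R * B1 * CN + 2 * (2 * pi * n%:R) ^+ 2 * B2 * CN)).
  by rewrite !addr_ge0.
split=> [x|x h|x h].
- by apply: le_trans (nc_Re _) _; apply: le_trans (ser_pbound x h0) _; rewrite lerDl addr_ge0.
- apply: le_trans (serR_lip x h h1) _; rewrite ler_wpM2r // addrCA lerDl addr_ge0 //.
apply: le_trans (serR_taylor x h h2) _; rewrite ler_wpM2r ?exprn_ge0 //.
by rewrite addrA lerDr addr_ge0.
Qed.

Lemma ser_periodic c x k : ser c (toC (x + toR k)) = ser c (toC x).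
Proof.
congr tsum; apply/funext => l; congr (_ * _).
rewrite !ek_toC; have -> : dotp (toR l) (x + toR k) =
    dotp (toR l) x + (\sum_i l 0 i * k 0 i)%:~R :> R.
  rewrite /dotp rmorph_sum -big_split /=; apply: eq_bigr => i _.
  by rewrite !mxE mulrDr rmorphM.
by rewrite mulrDr expiD expi_int mulr1.
Qed.

Variables (G : 'I_n -> K -> C) (b : R).
Hypothesis hG : forall m, exists B, forall i, pdec m (G i) B.
Hypothesis hb : forall i, pdec 1 (G i) b.
Hypothesis b0 : 0 <= b.
Hypothesis small : n%:R * (2 * pi * b * CN) <= 1 / 2.

Let D x : 'M[R]_n := \matrix_(l, i) serR (dc l (G i)) x.

Lemma dserR_le x i j : `|D x i j| <= 2 * pi * b * CN.
Proof.
rewrite mxE; apply: le_trans (nc_Re _) _; apply: ser_pbound; apply: pdec_dc; exact: hb.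
Qed.

Lemma uR_taylor : exists2 B, 0 <= B &
  forall x h, `|uR G (x + h) - uR G x - h *m D x| <= B * `|h| ^+ 2.
Proof.
have [B hB] := hG 2; pose B' := 2 * (2 * pi * n%:R) ^+ 2 * `|B| * CN.
have B'0 : 0 <= B' by rewrite mulr_ge0 ?(ltW Cn_gt0) // mulr_ge0 // mulr_ge0 ?sqr_ge0.
exists B' => // x h; apply: mx_normr_le => [|i]; first by rewrite mulr_ge0 ?exprn_ge0.
have hB' : pdec 2 (G i) `|B|.
  by move=> k; apply: le_trans (hB i k) _; rewrite ler_wpM2r ?pw_ge0 ?ler_norm.
apply: le_trans (serR_taylor x h hB'); rewrite le_eqVlt; apply/orP; left; apply/eqP.
congr `|_|; rewrite !mxE; congr (_ - _); apply: eq_bigr => j _; by rewrite mxE.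
Qed.

Lemma uR_lip x h : `|uR G (x + h) - uR G x| <= 1 / 2 * `|h|.
Proof.
apply: mx_normr_le => [|i]; first by rewrite mulr_ge0 ?divr_ge0.
rewrite !mxE; apply: le_trans (serR_lip x h (hb i)) _; rewrite ler_wpM2r //.
apply: le_trans small; rewrite le_eqVlt; apply/orP; left; apply/eqP; ring.
Qed.

Lemma fourier_jacobian x :
  jacobian (fun x => x + uR G x) x = 1%:M + D x /\ 1%:M + D x \in unitmx.
Proof.
have [B B0 hB] := uR_taylor; split.
  by apply: quad_jacobian => h; exact: (nearid_quad (u := uR G) hB).
by case: (nearid_unit (D := D) small dserR_le x).
Qed.

Lemma fourier_diffeo : torus_diffeo (fun x => x + uR G x).
Proof.
have [B B0 hB] := uR_taylor.
have SG i : rapid (fun x => uR G x 0 i).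
  exists (G i); split; last by apply/funext => x; rewrite mxE.
  by move=> m; have [B' h] := hG m; exists B'.
have SD i j : rapid (fun x => D x i j).
  exists (dc i (G j)); split; last by apply/funext => x; rewrite mxE.
  move=> m; have [B' h] := hG m.+1; exists (2 * pi * B'); apply: pdec_dc; exact: h.
have [Psi [K1 K2 s1 s2]] := nearid_diffeo rapid_qd SG SD B0 small dserR_le uR_lip hB.
split; last by split=> //; exists Psi.
have per x k : uR G (x + toR k) = uR G x.
  by apply/rowP => i; rewrite !mxE ser_periodic.
by move=> x k; rewrite per; exact: addrAC.
Qed.

End FourierDiffeo.

(** * From norms and arithmetic classes to coefficients, and the final assembly *)

Section Norms.
Context {R : realType} {n : nat}.
Local Notation K := 'rV[int]_n.
Implicit Types (k : K) (a r tau : R) (F : vfseries R n).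

Lemma fnorm_leP a r (f : fseries R n) (b : R) :
  (fnorm a r f <= b%:E)%E <-> forall k, nc (f k) <= b * expR (- (r * phi a (supn k)%:R)).
Proof.
split=> [h k|h].
  rewrite expRN ler_pdivlMr ?expR_gt0 // -lee_fin; apply: le_trans h.
  by apply: ereal_sup_ubound; exists k.
apply: ge_ereal_sup => _ [k _ <-]; rewrite lee_fin.
by rewrite -ler_pdivlMr ?expR_gt0 // -expRN.
Qed.

Lemma vfnorm_leP a r F (b : R) : 0 <= b -> (vfnorm a r F <= b%:E)%E <->
  forall i k, nc (F i k) <= b * expR (- (r * phi a (supn k)%:R)).
Proof.
move=> b0; split=> [h i|h].
  by apply/fnorm_leP; apply: le_trans h; exact: (@le_bigmax _ _ _ 0%E (fun i => fnorm a r (F i))).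
by apply: bigmax_le => [|i _]; [rewrite lee_fin | exact/fnorm_leP].
Qed.

Lemma gamma_spec a tau (omega : 'rV[R]_n) : (0 < n)%N -> arithm a tau omega ->
  0 < gamma a tau omega /\ forall k, k != 0 -> `|2 * pi * dotp (toR k) omega|^-1 <=
    (gamma a tau omega)^-1 * expR (tau * phi a (supn k)%:R).
Proof.
move=> n0 [hk]; rewrite /gamma.
have ub k : k != 0 -> ((`|2 * pi * dotp (toR k) omega|^-1 *
    expR (- (tau * phi a (supn k)%:R)))%:E <= gammaV a tau omega)%E.
  by move=> k0; apply: ereal_sup_ubound; exists k.
(* One nonzero frequency is exhibited to see that the supremum is positive, so that its inverse is a
   genuine positive constant. *)
have k1 : const_mx 1 != 0 :> K.
  by apply/eqP => /rowP /(_ (Ordinal n0)); rewrite !mxE.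
have := ub _ k1; have p0 : 0 < 2 * pi :> R by rewrite mulr_gt0 // pi_gt0.
case: (gammaV a tau omega) ub => [g|//|] ub //=; rewrite lee_fin => h _.
have g0 : 0 < g.
  apply: lt_le_trans h; rewrite mulr_gt0 ?expR_gt0 // invr_gt0 normr_gt0.
  by rewrite mulf_neq0 ?hk // gt_eqF.
rewrite invr_gt0 invrK; split=> // k /ub; rewrite lee_fin expRN ler_pdivrMr ?expR_gt0 //.
Qed.

End Norms.

Section Assembly.
Context {R : realType} {n : nat}.
Local Notation K := 'rV[int]_n.

Lemma pdec_of_phi (a d b C1 : R) m (c : K -> R[i]) : 0 <= b ->
  (forall k : K, (1 + supn k)%:R ^+ m * expR (- (d * phi a (supn k)%:R)) <= C1 * pw k) ->
  (forall k, nc (c k) <= b * expR (- (d * phi a (supn k)%:R))) -> pdec m c (b * C1).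
Proof.
move=> b0 h1 hc k; apply: le_trans (ler_wpM2l (exprn_ge0 m (ler0n R (1 + supn k))) (hc k)) _.
by rewrite mulrCA -mulrA ler_wpM2l.
Qed.

(** The equation for [G] says that the field at [Phi x] is [omega] times the Jacobian at [x];
    multiplying by the inverse Jacobian leaves [omega]. *)
Lemma pullback_of_series (omega lam : 'rV[R]_n) (Fc G : vfseries R n) (x : 'rV[R]_n) B :
  (forall i, pdec 0 (Fc i) B) ->
  (forall i, \sum_l cR (omega 0 l) * ser (dc l (G i)) (toC x) =
    ser (Fc i) (toC (x + uR G x)) - cR (lam 0 i)) ->
  jacobian (fun x => x + uR G x) x = 1%:M + \matrix_(l, i) serR (dc l (G i)) x /\
    1%:M + \matrix_(l, i) serR (dc l (G i)) x \in unitmx ->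
  pullback (fun x => x + uR G x) (fun y => (omega + vfeval Fc y) - lam) x = omega.
Proof.
move=> hF hE [hJ uJ]; rewrite /pullback hJ.
have -> : omega + vfeval Fc (x + uR G x) - lam =
    omega *m (1%:M + \matrix_(l, i) serR (dc l (G i)) x).
  rewrite mulmxDr mulmx1 -addrA; congr (_ + _); apply/rowP => i; rewrite !mxE.
  rewrite (feval_ser _ (hF i)); have := congr1 (@complex.Re R) (hE i).
  rewrite Re_sum ReD ReN => <-; apply: eq_bigr => l _.
  by rewrite Re_cRM mxE.
by rewrite -mulmxA mulmxV // mulmx1.
Qed.

Lemma powR_ge_id (t p : R) : 0 <= t -> t <= 1 -> 0 < p -> p <= 1 -> t <= t `^ p.
Proof.
move=> t0 t1 p0 p1; have [->|tn] := eqVneq t 0; first by rewrite powR0 ?gt_eqF.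
have tp : 0 < t by rewrite lt_neqAle eq_sym tn.
rewrite /powR (negPf tn) -{1}(lnK tp) ler_expR.
by have := ln_le0 t1; nra.
Qed.

End Assembly.

Unset Implicit Arguments.
Set Strict Implicit.
Local Open Scope classical_set_scope.

Theorem theorem1 (R : realType) (n : nat) (a r0 r tau tau0 kappa : R)
    (hn : (2 <= n)%N) (ha0 : 0 < a) (ha1 : a < 1)
    (hr : 0 < r) (hr0 : r < r0)
    (htau0 : 0 < tau0) (htau : tau0 < tau)
    (hkappa1 : 1 < kappa) (hkappa2 : kappa < 2)
    (hrc : c_ak a kappa * tau < r) :
  let rho := r - c_ak a kappa * tau in
  let upsilon := 8 `^ (- (a / (1 - a))) * rho in
  let nu := upsilon / 2 in
  let iota := 8 `^ (- (a / (1 - a))) * (2 * r)^-1 * upsilon in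
  exists epsstar C : R, 0 < epsstar /\ 0 < C /\
    forall (omega : 'rV[R]_n) (F : vfseries R n) (eps : R),
      arithm a tau0 omega ->
      vin_F a r0 F ->
      vfnorm a r0 F = eps%:E ->
      eps <= gamma a tau0 omega * epsstar ->
      exists (lambda : 'rV[R]_n) (Phi : 'rV[R]_n -> 'rV[R]_n)
             (G : vfseries R n),
        [/\ torus_diffeo Phi,
            vin_F a nu G /\ (forall x, Phi x - x = vfeval G x),
            (forall x, pullback Phi (fun y => (omega + vfeval F y) - lambda) x
                       = omega),
            `|lambda| <= C * eps
          & (vfnorm a nu G <= (C * (eps / gamma a tau0 omega) `^ iota)%:E)%E].
Proof.
move=> rho upsilon nu iota.
have [es [Cm [es0 [Cm0 hkam]]]] :=
  @kam_main R n a r0 r tau tau0 kappa ha0 ha1 hr hr0 htau0 htau hkappa1 hkappa2 hrc.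
have rho0 : 0 < rho by rewrite subr_gt0.
have p80 : 0 < 8 `^ (- (a / (1 - a))) :> R by rewrite powR_gt0.
have p81 : 8 `^ (- (a / (1 - a))) <= 1 :> R.
  rewrite -[leRHS](powRr0 8); apply: ler_powR; first by rewrite ler1n.
  by rewrite oppr_le0 divr_ge0 ?(ltW ha0) // subr_ge0 ltW.
have ups0 : 0 < upsilon by rewrite mulr_gt0.
have nu0 : 0 < nu by rewrite divr_gt0.
have iota0 : 0 < iota by rewrite mulr_gt0 // mulr_gt0 // invr_gt0 mulr_gt0.
have iota1 : iota <= 1.
  have c0 : 0 <= c_ak a kappa.
    by rewrite mulr_ge0 ?powR_ge0 // mulr_ge0 ?powR_ge0 // subr_ge0 ltW.
  have rr : rho <= r by rewrite gerBl mulr_ge0 // ltW // (lt_trans htau0).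
  have ur : upsilon <= r by apply: le_trans rr; rewrite ler_piMl // ltW.
  have h2 : (2 * r)^-1 * upsilon <= 1.
    rewrite mulrC ler_pdivrMr ?mulr_gt0 // mul1r; apply: le_trans ur _.
    by rewrite ler_peMl ?ler1n // ltW.
  rewrite /iota -mulrA -[leRHS]mulr1; apply: ler_pM => //.
  by rewrite mulr_ge0 ?(ltW ups0) // invr_ge0 mulr_ge0 // ltW.
have [C1 C10 hC1] := @phi_pw R n a nu 1 ha0 nu0.
have [CF CF0 hCF] := @phi_pw R n a r0 0 ha0 (lt_trans hr hr0).
(* Three thresholds: [eps / gamma <= 1] for the comparison with the power [iota], the threshold of
   the scheme, and a Lipschitz constant at most 1/2 for [G]. *)
pose cs : seq (R * R) := [:: (1, 1); (1, es); (n%:R * (2 * pi * (Cm * C1) * @Cn R n), 1 / 2)].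
have [|e e0 he] := @eps_ex R cs.
  move=> p; rewrite !inE => /or3P[] /eqP -> //=; exact: divr_gt0.
exists e, Cm; split=> //; split=> // omega F eps har hF heps hle.
have n0 : (0 < n)%N by exact: leq_trans hn.
have [g0 hg] := gamma_spec n0 har; set gam := gamma a tau0 omega in g0 hg hle *.
have eps0 : 0 <= eps.
  by rewrite -lee_fin -heps /vfnorm; exact: bigmax_ge_id.
have hFb : forall i k, nc (F i k) <= eps * expR (- (r0 * phi a (supn k)%:R)).
  by apply/vfnorm_leP => //; rewrite heps.
have dl0 : 0 <= eps / gam by rewrite divr_ge0 // ltW.
have dle : eps / gam <= e by rewrite ler_pdivrMr // mulrC.
have {}he p : p \in cs -> eps / gam * p.1 <= p.2 := he _ dl0 dle p.
have dl1 : eps / gam <= 1 by have := he (1, 1); rewrite /= mulr1; apply; rewrite !inE eqxx.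
have dls : eps / gam <= es.
  by have := he (1, es); rewrite /= mulr1; apply; rewrite !inE eqxx ?orbT.
have dlb : eps / gam * (n%:R * (2 * pi * (Cm * C1) * @Cn R n)) <= 1 / 2.
  by apply: (he (_, _)); rewrite !inE eqxx !orbT.
have [G [lam [hG Greal hlam hE]]] := hkam omega F eps gam g0 eps0
  (fun k k0 => conj (har.1 k k0) (hg k k0)) (fun i => (hF i).1) hFb dls.
have Cdl0 : 0 <= Cm * (eps / gam) by rewrite mulr_ge0 // ltW.
have GB m : exists B, forall i, pdec m (G i) B.
  have [C2 _ hC2] := @phi_pw R n a nu m ha0 nu0.
  by exists (Cm * (eps / gam) * C2) => i; exact: (pdec_of_phi Cdl0 hC2 (hG i)).
have G1 i : pdec 1 (G i) (Cm * (eps / gam) * C1) := pdec_of_phi Cdl0 hC1 (hG i).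
have small : n%:R * (2 * pi * (Cm * (eps / gam) * C1) * @Cn R n) <= 1 / 2.
  by apply: le_trans dlb; rewrite le_eqVlt; apply/orP; left; apply/eqP; ring.
have GN : (vfnorm a nu G <= (Cm * (eps / gam))%:E)%E by apply/vfnorm_leP.
exists lam, (fun x => x + uR G x), G; split.
- exact: fourier_diffeo GB G1 small.
- split=> [i|x].
    split=> [k|]; first exact/esym/Greal.
    by apply: le_lt_trans (ltry (Cm * (eps / gam))); apply/fnorm_leP.
  rewrite addrAC subrr add0r; apply/rowP => i; rewrite !mxE.
  have [B hB] := GB 0; exact/esym/(feval_ser _ (hB i)).
- move=> x; apply: (pullback_of_series (B := eps * CF)) (fourier_jacobian GB G1 small x).
    by move=> i; exact: (pdec_of_phi eps0 hCF (hFb i)).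
  by move=> i; exact: hE.
- by apply: mx_normr_le => //; rewrite mulr_ge0 // ltW.
apply: le_trans GN _; rewrite lee_fin; apply: ler_wpM2l; first exact: ltW.
exact: powR_ge_id.
Qed.
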